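(* Let $\vec p=(p_1,\dots,p_n)$ with $1<p_i<\infty$ for all $i$, and let $t,r$ satisfy either $1<\frac{n}{\sum_{i=1}^n 1/p_i}<t<r<\infty$ or $1<\frac{n}{\sum_{i=1}^n 1/p_i}\le t<r=\infty$. Then the dual space of $\mathcal H_{\vec p\,'}^{t',r'}$ is $M_{\vec p}^{t,r}$ in the following sense. (i) If $f\in M_{\vec p}^{t,r}$, then the linear functional $$L_f:\ g\mapsto L_f(g):=\int_{\mathbb R^n} g(x)f(x)\,dx$$ is bounded on $\mathcal H_{\vec p\,'}^{t',r'}$. (ii) Conversely, every continuous linear functional on $\mathcal H_{\vec p\,'}^{t',r'}$ is of the form $L_f$ for a unique $f\in M_{\vec p}^{t,r}$. Moreover, $\|f\|_{M_{\vec p}^{t,r}}=\|L_f\|_{(\mathcal H_{\vec p\,'}^{t',r'})^*}$, and for every $g\in\mathcal H_{\vec p\,'}^{t',r'}$ $$\|g\|_{\mathcal H_{\vec p\,'}^{t',r'}}=\max\left\{\left|\int_{\mathbb R^n} g(x)f(x)\,dx\right| : f\in M_{\vec p}^{t,r},\ \|f\|_{M_{\vec p}^{t,r}}\le 1\right\}.$$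
   Context: For $j\in\mathbb Z$, $k\in\mathbb Z^n$, let $Q_{j,k}=\prod_{i=1}^n[2^{-j}k_i,2^{-j}(k_i+1))$; $\mathcal D$ is the family of all these dyadic cubes. A prime on an exponent denotes the conjugate exponent, and $\vec p\,'=(p_1',\dots,p_n')$. Mixed Lebesgue norm: for $\vec p\in(0,\infty]^n$ and measurable $f$ on $\mathbb R^n$, $$\|f\|_{L^{\vec p}}=\Big(\int_{\mathbb R}\cdots\Big(\int_{\mathbb R}|f(x_1,\dots,x_n)|^{p_1}dx_1\Big)^{p_2/p_1}\cdots dx_n\Big)^{1/p_n}$$ (innermost integration in $x_1$; usual modification if some $p_j=\infty$). Mixed Bourgain-Morrey space $M_{\vec p}^{t,r}$: all measurable $f$ on $\mathbb R^n$ with $$\|f\|_{M_{\vec p}^{t,r}}=\Big(\sum_{Q\in\mathcal D}|Q|^{\frac rt-\frac rn\sum_{i=1}^n\frac1{p_i}}\|f\chi_Q\|_{L^{\vec p}}^r\Big)^{1/r}<\infty$$ (supremum over $Q\in\mathcal D$ if $r=\infty$). Blocks: a measurable function $b$ is a $(\vec p\,',t')$-block supported on a cube $Q$ if $b$ is supported on $Q$ and $\|b\|_{L^{\vec p\,'}}\le|Q|^{\frac1t-\frac1n\sum_{i=1}^n\frac1{p_i}}$. Block space $\mathcal H_{\vec p\,'}^{t',r'}$: all measurable $g$ that can be written $g=\sum_{(j,k)\in\mathbb Z^{n+1}}\lambda_{j,k}b_{j,k}$ with convergence almost everywhere on $\mathbb R^n$, where $\lambda=\{\lambda_{j,k}\}\in\ell^{r'}(\mathbb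 Z^{n+1})$ and each $b_{j,k}$ is a $(\vec p\,',t')$-block supported on $Q_{j,k}$; $\|g\|_{\mathcal H_{\vec p\,'}^{t',r'}}=\inf_\lambda\|\lambda\|_{\ell^{r'}}$, the infimum being over all such representations. *)

(* Defs.v *)
From HB Require Import structures.
From mathcomp Require Import all_boot all_order all_algebra.
From mathcomp Require Import complex.
From mathcomp Require Import all_classical all_reals all_analysis.
From mathcomp Require Import showcase.summability.

Set Implicit Arguments.
Unset Strict Implicit.
Unset Printing Implicit Defensive.
Import Order.TTheory GRing.Theory Num.Theory.
Import numFieldNormedType.Exports.
Import ComplexField.

Local Open Scope classical_set_scope.
Local Open Scope ring_scope.

Section space.
Variable R : realType.

(* The coordinates (x_1, ..., x_n) are stored as a tuple, x_1 being its head;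
   the sigma-algebra is the Borel one. *)
Definition Rn (n : nat) := n.-tuple (measurableTypeR R).
HB.instance Definition _ n := Measurable.on (Rn n).

Definition consRn n (z : measurableTypeR R * Rn n) : Rn n.+1 :=
  [tuple of z.1 :: z.2].
Definition unconsRn n (x : Rn n.+1) : measurableTypeR R * Rn n :=
  (thead x, [tuple of behead x]).

Lemma consRnK n : cancel (@consRn n) (@unconsRn n).
Proof. by case=> a y; congr (_, _); apply/val_inj. Qed.

Lemma measurable_consRn n : measurable_fun [set: _] (@consRn n).
Proof. exact: measurable_cons. Qed.

Lemma measurable_unconsRn n : measurable_fun [set: _] (@unconsRn n).
Proof.
apply/measurable_fun_pairP; split.
  exact: measurable_tnth.
exact: measurable_behead.
Qed.

Section step.
Context n (mu : {sigma_finite_measure set (Rn n) -> \bar R}).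

Definition lebesgue_consRn : set (Rn n.+1) -> \bar R :=
  pushforward (@lebesgue_measure R \x mu)%E (@consRn n).

Let lebesgue_consRn0 : lebesgue_consRn set0 = 0%E.
Proof. by rewrite /lebesgue_consRn /pushforward preimage_set0 measure0. Qed.

Let lebesgue_consRn_ge0 A : (0 <= lebesgue_consRn A)%E.
Proof. by rewrite /lebesgue_consRn /pushforward; exact: measure_ge0. Qed.

Let lebesgue_consRn_sigma_additive : semi_sigma_additive lebesgue_consRn.
Proof.
have mc := @measurable_consRn n.
move=> F mF tF mUF; rewrite /lebesgue_consRn /pushforward preimage_bigcup.
apply: measure_semi_sigma_additive.
- by move=> k; rewrite -[X in measurable X]setTI; exact: mc.
- apply/trivIsetP => /= i j _ _ ij; rewrite -preimage_setI.
  by move/trivIsetP : tF => /(_ _ _ _ _ ij) ->//; rewrite preimage_set0.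
- by rewrite -preimage_bigcup -[X in measurable X]setTI; exact: mc.
Qed.

HB.instance Definition _ := isMeasure.Build _ _ _ lebesgue_consRn
  lebesgue_consRn0 lebesgue_consRn_ge0 lebesgue_consRn_sigma_additive.

Let lebesgue_consRn_sigma_finite : sigma_finite setT lebesgue_consRn.
Proof.
have /sigma_finiteP[F [TF ndF Foo]] := sigma_finiteT (@lebesgue_measure R).
have /sigma_finiteP[G [TG ndG Goo]] := sigma_finiteT mu.
exists (fun k => @unconsRn n @^-1` (F k `*` G k)).
  apply/esym; rewrite -subTset => x _.
  have [k _ Fk] : (\bigcup_k F k) (unconsRn x).1 by rewrite -TF.
  have [m _ Gm] : (\bigcup_k G k) (unconsRn x).2 by rewrite -TG.
  exists (maxn k m) => //; split.
    by move: Fk; exact/subsetPset/ndF/leq_maxl.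
  by move: Gm; exact/subsetPset/ndG/leq_maxr.
move=> k; have [mF Fk] := Foo k; have [mG Gk] := Goo k; split.
  rewrite -[X in measurable X]setTI; apply: measurable_unconsRn => //.
  exact: measurableX.
rewrite /lebesgue_consRn /pushforward -comp_preimage.
rewrite (_ : _ \o _ = id); last by apply/funext => z; exact: consRnK.
by rewrite preimage_id product_measure1E// lte_mul_pinfty// ge0_fin_numE.
Qed.

HB.instance Definition _ := Measure_isSigmaFinite.Build _ _ _ lebesgue_consRn
  lebesgue_consRn_sigma_finite.

End step.

(* n-dimensional Lebesgue measure, as an iterated product; [lebesgueRn_box]
   below gives the volume of boxes, which determines it. *)
Fixpoint lebesgueRn n : {sigma_finite_measure set (Rn n) -> \bar R} :=
  match n with
  | 0 => dirac [tuple]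
  | m.+1 => lebesgue_consRn (lebesgueRn m)
  end.

Lemma lebesgueRn_box n (A : 'I_n -> set (measurableTypeR R)) :
  (forall i, measurable (A i)) ->
  lebesgueRn n [set x | forall i, A i (tnth x i)] =
  (\prod_(i < n) lebesgue_measure (A i))%E.
Proof.
elim: n A => [|n IHn] A mA.
  by rewrite big_ord0 /= diracE mem_set//= => -[].
rewrite big_ord_recl -IHn //= /lebesgue_consRn /pushforward.
rewrite -product_measure1E//; last first.
  rewrite [X in measurable X](_ : _ = \bigcap_(i in [set: 'I_n])
      ((fun x => tnth x i) @^-1` A (lift ord0 i))); last first.
    by apply/seteqP; split => x /= Ax i; [move=> _; exact: Ax|exact: Ax].
  apply: fin_bigcap_measurable => // i _.
  by rewrite -[X in measurable X]setTI; exact: measurable_tnth.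
congr product_measure1; apply/seteqP; split => -[a y] /=.
  by move=> Ay; split=> [|i]; [exact: (Ay ord0)|have := Ay (lift ord0 i); rewrite tnthS].
move=> [Aa Ay] i; case: (unliftP ord0 i) => [j|] ->//.
by rewrite tnthS.
Qed.

End space.

Arguments lebesgueRn {R} n.

Section complex_functions.
Variables (R : realType) (n : nat).
Local Notation mu := (@lebesgueRn R n).
Implicit Type f : Rn R n -> R[i].

Definition cmeasurable f : Prop :=
  measurable_fun setT (fun x => complex.Re (f x) : R) /\
  measurable_fun setT (fun x => complex.Im (f x) : R).

Definition cintegrable f : Prop :=
  mu.-integrable setT (fun x => (complex.Re (f x))%:E) /\
  mu.-integrable setT (fun x => (complex.Im (f x))%:E).

Definition cintegral f : R[i] :=
  (\int[mu]_x complex.Re (f x) +i* \int[mu]_x complex.Im (f x))%C.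

Definition pairing f : (Rn R n -> R[i]) -> R[i] :=
  fun g => cintegral (fun x => g x * f x).

End complex_functions.

(* Iterated L^p norm, innermost in x_1; [Lnorm] is the essential supremum of
   the absolute value when the exponent is +oo. *)
Fixpoint mixed_norm (R : realType) (n : nat) :
    n.-tuple (\bar R) -> (Rn R n -> \bar R) -> \bar R :=
  match n with
  | 0 => fun _ f => `|f [tuple]|%E
  | m.+1 => fun p f => mixed_norm [tuple of behead p]
      (fun y => Lnorm (@lebesgue_measure R) (thead p)
                      (fun a => f (consRn (a, y))))
  end.

(* The l^q norm of a family of scalars, for 0 < q <= +oo. *)
Definition lq_norm (R : realType) (I : choiceType) (q : \bar R)
    (a : I -> R[i]) : \bar R :=
  match q with
  | q%:E => ((\esum_(i in [set: I]) (Normc.normc (a i))%:E `^ q) `^ q^-1)%E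
  | _ => ereal_sup [set (Normc.normc (a i))%:E | i in [set: I]]
  end.

(* The pair (j, k) in Z x Z^n indexes the dyadic cube Q_{j,k}; for n > 0
   distinct indices give distinct cubes. *)
Definition dyadic_index (n : nat) := (int * n.-tuple int)%type.

Definition dyadic_cube (R : realType) (n : nat) (q : dyadic_index n) :
    set (Rn R n) :=
  [set x | forall i : 'I_n,
     ((2 : R) ^ (- q.1) * (tnth q.2 i)%:~R <= tnth x i :> R) /\
     (tnth x i < (2 : R) ^ (- q.1) * ((tnth q.2 i)%:~R + 1) :> R)].

(* All the spaces are parametrised by the unprimed exponents p, t, r; the
   primed ones are their Hoelder conjugates. Thus [block_space p t r] is
   H_{p'}^{t',r'} and [is_block p t] means (p', t')-block. *)
Section spaces.
Variables (R : realType) (n : nat).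
Local Notation X := (Rn R n).
Local Notation mu := (@lebesgueRn R n).
Local Notation cube := (@dyadic_cube R n).
Implicit Types (f g : X -> R[i]) (p : n.-tuple R) (t : R) (r : \bar R).

Definition sum_inv p : R := \sum_(i < n) (tnth p i)^-1.

Definition exponents p : n.-tuple (\bar R) := [tuple of map EFin p].

Definition conj_exponents p : n.-tuple (\bar R) :=
  [tuple of map (fun s => hoelder_conjugate s%:E) p].

Definition Lp_norm (p : n.-tuple (\bar R)) f : \bar R :=
  mixed_norm p (fun x => (Normc.normc (f x))%:E).

Definition morrey_norm p t r f : \bar R :=
  match r with
  | r%:E => ((\esum_(q in [set: dyadic_index n])
       (mu (cube q) `^ (r / t - r / n%:R * sum_inv p) *
        Lp_norm (exponents p) (fun x => (f x * \1_(cube q) x)%R) `^ r))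
      `^ r^-1)%E
  | _ => ereal_sup
      [set (mu (cube q) `^ (t^-1 - n%:R^-1 * sum_inv p) *
            Lp_norm (exponents p) (fun x => (f x * \1_(cube q) x)%R))%E
      | q in [set: dyadic_index n]]
  end.

Definition morrey_space p t r : set (X -> R[i]) :=
  [set f | cmeasurable f /\ (morrey_norm p t r f < +oo)%E].

Definition is_block p t (Q : set X) (b : X -> R[i]) : Prop :=
  [/\ cmeasurable b,
      forall x, ~ Q x -> b x = 0 &
      (Lp_norm (conj_exponents p) b
         <= mu Q `^ (t^-1 - n%:R^-1 * sum_inv p))%E].

(* The series over Z^{n+1} carries no order: it converges at x along the net
   of finite partial sums. *)
Definition block_decomposition p t r g
    (lambda : dyadic_index n -> R[i])
    (b : dyadic_index n -> X -> R[i]) : Prop :=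
  [/\ (lq_norm (hoelder_conjugate r) lambda < +oo)%E,
      forall q, is_block p t (cube q) (b q) &
      {ae mu, forall x,
        partial_sum (fun q => lambda q * b q x) @ totally
          --> (g x : (R[i])^o)}].

Definition block_space p t r : set (X -> R[i]) :=
  [set g | cmeasurable g /\
           exists lambda b, block_decomposition p t r g lambda b].

Definition block_norm p t r g : \bar R :=
  ereal_inf [set lq_norm (hoelder_conjugate r) lambda
            | lambda in [set lambda |
                exists b, block_decomposition p t r g lambda b]].

(* A functional on the block space is a total function on X -> R[i] of which
   only the values on the block space matter. Compatibility with equality
   almost everywhere follows from continuity. *)
Definition linear_on_block_space p t r (L : (X -> R[i]) -> R[i]) : Prop :=
  forall (a : R[i]) g h, block_space p t r g -> block_space p t r h ->
    L (fun x => a * g x + h x) = a * L g + L h.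

Definition continuous_on_block_space p t r (L : (X -> R[i]) -> R[i]) : Prop :=
  forall g, block_space p t r g -> forall e : R, 0 < e ->
  exists2 d : R, 0 < d & forall h, block_space p t r h ->
    (block_norm p t r (fun x => (h x - g x)%R) < d%:E)%E ->
    Normc.normc (L h - L g) < e.

Definition bounded_on_block_space p t r (L : (X -> R[i]) -> R[i]) : Prop :=
  exists C : R, forall g, block_space p t r g ->
    ((Normc.normc (L g))%:E <= C%:E * block_norm p t r g)%E.

Definition dual_norm p t r (L : (X -> R[i]) -> R[i]) : \bar R :=
  ereal_sup [set (Normc.normc (L g))%:E
            | g in [set g | block_space p t r g /\
                            (block_norm p t r g <= 1)%E]].

End spaces.

(* Main.v *)
(* By Hoelder's inequality on each dyadic cube, first for the mixed norms and
   then for the sums over cubes, the pairing satisfies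
   |L_f g| <= |f|_M |g|_H. For the converse, fix a weight w > 0, a rapidly
   convergent combination of indicators of dyadic cubes, such that w u has block
   norm at most sup |u| for every bounded u. If L is continuous, A |-> L(w 1_A)
   is then a complex measure with a density h by the Radon-Nikodym theorem, and
   L g = L_f g with f = h / w for bounded g supported on a cube. Testing L on
   finite combinations of blocks which are almost extremal for f bounds |f|_M by
   the norm of L; by truncation L and L_f agree on blocks, hence everywhere.
   The formula for |g|_H follows from the Hahn-Banach theorem and the
   representation of the functional that norms g. *)
From HB Require Import structures.
Require Import Defs.
From mathcomp Require Import all_boot all_order all_algebra finmap.
From mathcomp Require Import complex.
From mathcomp Require Import all_classical all_reals all_analysis.
From mathcomp Require Import measurable_realfun showcase.summability.
From mathcomp Require Import ring.

Set Implicit Arguments.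
Unset Strict Implicit.
Unset Printing Implicit Defensive.
Import Order.TTheory GRing.Theory Num.Theory.
Import numFieldNormedType.Exports.
Import ComplexField.

Local Open Scope classical_set_scope.
Local Open Scope ring_scope.

(** A dyadic cube never crosses a hyperplane x_i = 0, so no increasing sequence of cubes exhausts
    the space and a density cannot be built along one. The weight replaces such an exhaustion by a
    single finite complex measure; dividing by it afterwards is harmless on each cube, where it has
    a positive lower bound. Countable additivity of that measure and the density of finite block
    sums both rest on r' being finite: tails of l^{r'} coefficients tend to 0. When the norm of f is
    estimated, L is known to be L_f only on bounded functions supported on one cube. This is why the
    test functions in the duality of mixed norms must be bounded and vanish where the given function
    does. The same duality yields the triangle inequality for mixed norms, hence subadditivity of
    the block norm, which Hahn-Banach requires. Functions equal almost everywhere are not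
    identified, so the block norm is a seminorm on a set of functions, and Hahn-Banach is proved in
    that form. *)

Local Notation normc := Normc.normc.
Local Notation Re := complex.Re.
Local Notation Im := complex.Im.

(** * Powers and suprema of nonnegative extended reals *)

Section poweR_sup.
Context {R : realType}.
Implicit Types (x y l : \bar R) (s : R).
Local Open Scope ereal_scope.

Lemma le_poweR s x y : (0 <= s)%R -> 0 <= x -> x <= y -> x `^ s <= y `^ s.
Proof.
move=> s0 x0 xy; apply: gt0_ler_poweR => //.
  by rewrite in_itv/= x0 leey.
by rewrite in_itv/= (le_trans x0 xy) leey.
Qed.

Lemma poweRK s x : (s != 0)%R -> 0 <= x -> (x `^ s) `^ s^-1 = x.
Proof. by move=> s0 x0; rewrite -poweRrM mulfV// poweRe1. Qed.

Lemma poweRVK s x : (s != 0)%R -> 0 <= x -> (x `^ s^-1) `^ s = x.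
Proof. by move=> s0 x0; rewrite -poweRrM mulVf// poweRe1. Qed.

Lemma lt_poweR s x y : (0 < s)%R -> 0 <= x -> 0 <= y -> x < y ->
  x `^ s < y `^ s.
Proof.
move=> s0 x0 y0 xy; rewrite ltNge; apply/negP => yx.
have s'0 : (0 <= s^-1)%R by rewrite invr_ge0 ltW.
have := le_poweR s'0 (poweR_ge0 _ _) yx.
by rewrite !poweRK ?gt_eqF// leNgt xy.
Qed.

(** For s > 0 the power is an increasing bijection of [0, +oo], so it commutes with suprema. The
    inequality that monotonicity does not give directly comes from monotonicity of the inverse power
    s^-1. *)
Lemma poweR_ereal_sup s (u : (\bar R)^nat) : (0 < s)%R -> (forall n, 0 <= u n) ->
  ereal_sup (range (fun n => u n `^ s)) = ereal_sup (range u) `^ s.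
Proof.
move=> s0 u0; have S0 : 0 <= ereal_sup (range u).
  by apply: le_trans (u0 0%N) _; apply: ereal_sup_ubound; exists 0%N.
apply/eqP; rewrite eq_le; apply/andP; split.
  apply: ge_ereal_sup => _ [n _ <-]; apply: le_poweR => //; first exact: ltW.
  by apply: ereal_sup_ubound; exists n.
have T0 : 0 <= ereal_sup (range (fun n => u n `^ s)).
  by apply: le_trans (poweR_ge0 (u 0%N) s) _; apply: ereal_sup_ubound; exists 0%N.
have sn0 : (s != 0)%R by rewrite gt_eqF.
rewrite -[leRHS](poweRVK sn0)//; apply: le_poweR => //; first exact: ltW.
apply: ge_ereal_sup => _ [n _ <-].
rewrite -[leLHS](poweRK sn0)//; apply: le_poweR; first by rewrite invr_ge0 ltW.
  exact: poweR_ge0.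
by apply: ereal_sup_ubound; exists n.
Qed.

(** An extended real that lies in [0, e) is finite, so convergence to 0 can be tested without
    mentioning [fine]. *)
Lemma cvge0P (u : (\bar R)^nat) : (forall n, 0 <= u n) ->
  u @ \oo --> 0 <-> forall e : R, (0 < e)%R -> \forall n \near \oo, u n < e%:E.
Proof.
move=> u0; split=> [/fine_cvgP[ufin /cvgrPdist_lt uc] e e0|h].
  near=> n; have un : u n \is a fin_num by near: n.
  rewrite -(fineK un) lte_fin.
  have : (`|0 - fine (u n)| < e)%R by near: n; exact: uc.
  by rewrite sub0r normrN ger0_norm// fine_ge0.
apply/fine_cvgP; split.
  near=> n; rewrite ge0_fin_numE//; apply: (@lt_trans _ _ 1%:E); last exact: ltry.
  by near: n; exact: h.
apply/cvgrPdist_lt => e e0; near=> n.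
have un : u n < e%:E by near: n; exact: h.
have ufin : u n \is a fin_num by rewrite ge0_fin_numE// (lt_trans un)// ltry.
by rewrite sub0r normrN ger0_norm ?fine_ge0// -lte_fin fineK.
Unshelve. all: by end_near. Qed.

Lemma poweR_cvg0 s (u : (\bar R)^nat) : (0 < s)%R -> (forall n, 0 <= u n) ->
  u @ \oo --> 0 -> (fun n => u n `^ s) @ \oo --> 0.
Proof.
move=> s0 u0 /(cvge0P u0) ucvg; apply/cvge0P => [n|e e0]; first exact: poweR_ge0.
have sn0 : (s != 0)%R by rewrite gt_eqF.
near=> n; have : u n < (e `^ s^-1)%:E.
  by near: n; apply: ucvg; rewrite powR_gt0.
by move/(lt_poweR s0 (u0 n)) => /(_ (poweR_ge0 e%:E _)); rewrite -poweR_EFin poweRVK// lee_fin ltW.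
Unshelve. all: by end_near. Qed.

Lemma ereal_sup_cvgn (u : (\bar R)^nat) l : nondecreasing_seq u ->
  ereal_sup (range u) = l -> u @ \oo --> l.
Proof. by move=> ndu <-; exact: ereal_nondecreasing_cvgn. Qed.

End poweR_sup.

(** * One-variable L^s norms of nonnegative extended-real functions *)

Section one_dim.
Context d (T : measurableType d) (R : realType).
Variable mu : {measure set T -> \bar R}.
Implicit Types (f g h : T -> \bar R) (s : R).
Local Open Scope ereal_scope.
Local Notation "'N_ s [ f ]" := (Lnorm mu s%:E f).

Lemma ge0_LnormE s f : (forall x, 0 <= f x) ->
  'N_s[f] = (\int[mu]_x f x `^ s) `^ s^-1.
Proof. by move=> f0; rewrite unlock; congr (_ `^ _); apply: eq_integral => x _; rewrite gee0_abs. Qed.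

Lemma measurable_poweR_comp s f : measurable_fun setT f ->
  measurable_fun setT (fun x => f x `^ s).
Proof.
move=> mf; apply: (@measurableT_comp _ _ _ _ _ _ (poweR ^~ s)) => //.
exact: measurable_poweR.
Qed.

Lemma ge0_Lnorm_poweR s f : (0 < s)%R -> (forall x, 0 <= f x) ->
  'N_s[f] `^ s = \int[mu]_x f x `^ s.
Proof.
move=> s0 f0; rewrite ge0_LnormE// poweRVK ?gt_eqF//.
by apply: integral_ge0 => x _; exact: poweR_ge0.
Qed.

Lemma le_Lnorm s f g : (0 < s)%R -> measurable_fun setT f ->
  measurable_fun setT g -> (forall x, 0 <= f x) -> (forall x, f x <= g x) ->
  'N_s[f] <= 'N_s[g].
Proof.
move=> s0 mf mg f0 fg; have g0 x : 0 <= g x by exact: le_trans (fg x).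
rewrite !ge0_LnormE//; apply: le_poweR; first by rewrite invr_ge0 ltW.
  by apply: integral_ge0 => x _; exact: poweR_ge0.
by apply: ge0_le_integral => //; do ?[by move=> *; exact: poweR_ge0|exact: measurable_poweR_comp];
  move=> x _; apply: le_poweR => //; exact: ltW.
Qed.

Lemma ge0_LnormZ s (c : R) f : (0 < s)%R -> (0 <= c)%R ->
  measurable_fun setT f -> (forall x, 0 <= f x) ->
  'N_s[(fun x => c%:E * f x)] = c%:E * 'N_s[f].
Proof.
move=> s0 c0 mf f0; have sn0 : (s != 0)%R by rewrite gt_eqF.
rewrite !ge0_LnormE//; last by move=> x; rewrite mule_ge0.
under eq_integral do rewrite poweRM//.
rewrite ge0_integralZl//; last 3 first.
- exact: measurable_poweR_comp.
- by move=> x _; exact: poweR_ge0.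
- exact: poweR_ge0.
rewrite poweRM ?poweR_ge0 ?poweRK//.
by apply: integral_ge0 => x _; exact: poweR_ge0.
Qed.

Lemma ge0_Lnorm_eq0 s f : (0 < s)%R -> measurable_fun setT f ->
  'N_s[f] = 0 -> ae_eq mu setT f (cst 0).
Proof. by move=> s0 mf f0; exact: (Lnorm_eq0_eq0 mf _ f0). Qed.

Lemma Lnorm_fin_ae s f : (0 < s)%R -> measurable_fun setT f ->
  (forall x, 0 <= f x) -> 'N_s[f] < +oo -> {ae mu, forall x, f x \is a fin_num}.
Proof.
move=> s0 mf f0 foo.
have : mu.-integrable setT (fun x => f x `^ s).
  apply/integrableP; split; first exact: measurable_poweR_comp.
  under eq_integral do rewrite gee0_abs ?poweR_ge0//.
  by rewrite -ge0_Lnorm_poweR// poweR_lty.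
move/(integrable_ae measurableT); apply: filterS => x /(_ Logic.I).
rewrite !ge0_fin_numE ?poweR_ge0//; apply: lty_poweRy; first by rewrite gt_eqF.
Qed.

(** Values in [0, +oo] are allowed because the inner norms of an iterated norm may be infinite. If a
    norm vanishes, the product is 0 almost everywhere; if one is infinite and the other positive,
    the bound is trivial; otherwise both functions agree almost everywhere with their finite parts,
    where [hoelder] applies. *)
Lemma ge0_hoelder f g p q : measurable_fun setT f -> measurable_fun setT g ->
  (forall x, 0 <= f x) -> (forall x, 0 <= g x) ->
  (0 < p)%R -> (0 < q)%R -> (p^-1 + q^-1 = 1)%R ->
  \int[mu]_x (f x * g x) <= 'N_p[f] * 'N_q[g].
Proof.
move=> mf mg f0 g0 p0 q0 pq.
have mfg : measurable_fun setT (fun x => f x * g x) by exact: emeasurable_funM.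
have [fN|fN] := eqVneq 'N_p[f] 0.
  rewrite fN mul0e (@ae_eq_integral _ _ _ mu setT (cst 0)) ?integral0//.
  have := ge0_Lnorm_eq0 p0 mf fN; apply: filterS => x /= /(_ Logic.I) -> _.
  by rewrite mul0e.
have [gN|gN] := eqVneq 'N_q[g] 0.
  rewrite gN mule0 (@ae_eq_integral _ _ _ mu setT (cst 0)) ?integral0//.
  have := ge0_Lnorm_eq0 q0 mg gN; apply: filterS => x /= /(_ Logic.I) -> _.
  by rewrite mule0.
have fN0 : 0 < 'N_p[f] by rewrite lt0e fN Lnorm_ge0.
have gN0 : 0 < 'N_q[g] by rewrite lt0e gN Lnorm_ge0.
have [foo|] := leP +oo 'N_p[f].
  by move: foo; rewrite leye_eq => /eqP ->; rewrite gt0_mulye// leey.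
have [goo|] := leP +oo 'N_q[g].
  by move: goo; rewrite leye_eq => /eqP -> _; rewrite gt0_muley// leey.
move=> goo foo.
have faef : ae_eq mu setT f (fun x => (fine (f x))%:E).
  by have := Lnorm_fin_ae p0 mf f0 foo; apply: filterS => x fx _; rewrite fineK.
have gaeg : ae_eq mu setT g (fun x => (fine (g x))%:E).
  by have := Lnorm_fin_ae q0 mg g0 goo; apply: filterS => x fx _; rewrite fineK.
have mf' : measurable_fun setT (fun x => fine (f x)) by exact: measurableT_comp.
have mg' : measurable_fun setT (fun x => fine (g x)) by exact: measurableT_comp.
have ff0 x : (0 <= fine (f x))%R by exact: fine_ge0.
have gg0 x : (0 <= fine (g x))%R by exact: fine_ge0.
have NE s h : (0 < s)%R -> measurable_fun setT h -> (forall x, 0 <= h x) ->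
    ae_eq mu setT h (fun x => (fine (h x))%:E) ->
    'N_s[h] = 'N_s[EFin \o (fun x => fine (h x))].
  move=> s0 mh h0 hae; rewrite !ge0_LnormE//; last by move=> x; rewrite lee_fin fine_ge0.
  congr (_ `^ _); apply: ge0_ae_eq_integral => //.
  - exact: measurable_poweR_comp.
  - by apply: measurable_poweR_comp; apply/measurable_EFinP; exact: measurableT_comp.
  - by move=> x _; exact: poweR_ge0.
  - by move=> x _; exact: poweR_ge0.
  by move: hae; apply: filterS => x /(_ Logic.I) {1}-> _.
rewrite (NE p f)// (NE q g)//; apply: le_trans; last exact: hoelder mf' mg' p0 q0 pq.
rewrite Lnorm1.
rewrite (@ge0_ae_eq_integral _ _ _ mu setT _
  (fun x => `|(EFin \o (fun x => fine (f x)) \* (fun x => fine (g x)))%R x|))//.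
- by apply: measurableT_comp => //; apply/measurable_EFinP; exact: measurable_funM.
- by move=> x _; rewrite mule_ge0.
- move: faef gaeg; apply: filterS2 => x /(_ Logic.I) {1}-> /(_ Logic.I) {1}-> _.
  by rewrite /= ger0_norm ?EFinM// mulr_ge0.
Qed.

(** Monotone convergence. It is stated with suprema because these commute with the outer power, so
    that the result iterates over the variables. *)
Lemma Lnorm_sup s (F : (T -> \bar R)^nat) f : (0 < s)%R ->
  (forall n, measurable_fun setT (F n)) -> (forall n x, 0 <= F n x) ->
  (forall x, nondecreasing_seq (F ^~ x)) ->
  (forall x, ereal_sup (range (F ^~ x)) = f x) ->
  'N_s[f] = ereal_sup (range (fun n => 'N_s[F n])).
Proof.
move=> s0 mF F0 ndF Ff.
have f0 x : 0 <= f x.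
  by rewrite -Ff; apply: le_trans (F0 0%N x) _; apply: ereal_sup_ubound; exists 0%N.
rewrite ge0_LnormE//; under [in RHS]eq_fun do rewrite ge0_LnormE//.
rewrite poweR_ereal_sup; last 2 first.
- by rewrite invr_gt0.
- by move=> n; apply: integral_ge0 => x _; exact: poweR_ge0.
congr (_ `^ _).
have ndFs x : nondecreasing_seq (fun n => F n x `^ s).
  by move=> m n mn; apply: le_poweR => //; [exact: ltW|exact: ndF].
have cF : \int[mu]_x (F n x `^ s) @[n --> \oo] --> \int[mu]_x (f x `^ s).
  rewrite (eq_integral (fun x => limn (fun n => F n x `^ s))).
    apply: cvg_monotone_convergence => //.
    - by move=> n; exact: measurable_poweR_comp.
    - by move=> n x _; exact: poweR_ge0.
  move=> x _; apply/esym/cvg_lim => //; apply: ereal_sup_cvgn; first exact: ndFs.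
  by rewrite poweR_ereal_sup// Ff.
rewrite -(cvg_lim _ cF)//; apply/cvg_lim => //.
apply: ereal_nondecreasing_cvgn => m n mn; apply: ge0_le_integral => //.
- by move=> x _; exact: poweR_ge0.
- exact: measurable_poweR_comp.
- exact: measurable_poweR_comp.
- by move=> x _; exact: ndFs.
Qed.

(** Pointwise convergence is demanded only where g is finite: in the induction on the variables g is
    itself a slice norm, which may be infinite on a null set of slices. *)
Lemma Lnorm_dominated_cvg0 s (F : (T -> \bar R)^nat) g : (0 < s)%R ->
  (forall n, measurable_fun setT (F n)) -> measurable_fun setT g ->
  (forall n x, 0 <= F n x) -> (forall n x, F n x <= g x) ->
  (forall x, g x < +oo -> F ^~ x @ \oo --> 0) ->
  'N_s[g] < +oo -> (fun n => 'N_s[F n]) @ \oo --> 0.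
Proof.
move=> s0 mF mg F0 Fg Fc goo.
have g0 x : 0 <= g x by exact: le_trans (Fg 0%N x).
under eq_fun do rewrite ge0_LnormE//.
apply: poweR_cvg0; first by rewrite invr_gt0.
  by move=> n; apply: integral_ge0 => x _; exact: poweR_ge0.
have [|||||_ _] := @dominated_convergence _ _ _ mu setT measurableT
  (fun n x => F n x `^ s) (cst 0) (fun x => g x `^ s).
- by move=> n; exact: measurable_poweR_comp.
- exact: measurable_cst.
- have := Lnorm_fin_ae s0 mg g0 goo; apply: filterS => x gx _.
  by apply: poweR_cvg0 => //; apply: Fc; rewrite -ge0_fin_numE.
- apply/integrableP; split; first exact: measurable_poweR_comp.
  under eq_integral do rewrite gee0_abs ?poweR_ge0//.
  by rewrite -ge0_Lnorm_poweR// poweR_lty.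
- by apply/nearW => x n _; rewrite gee0_abs ?poweR_ge0// le_poweR// ltW.
by rewrite integral0.
Qed.

End one_dim.

(** * Mixed Lebesgue norms *)

Section mixed.
Context {R : realType}.
Local Notation leb := (@lebesgue_measure R).
Local Notation MN p f := (mixed_norm (exponents p) f).
Implicit Types (n : nat) (s : R).
Local Open Scope ereal_scope.

Lemma mixed_norm_cons n s (p : n.-tuple R) (f : Rn R n.+1 -> \bar R) :
  MN [tuple of s :: p] f =
  MN p (fun y => Lnorm leb s%:E (fun a => f (consRn (a, y)))).
Proof.
rewrite /=; congr (mixed_norm _ _); last by apply/val_inj.
Qed.

Lemma measurable_slice n (f : Rn R n.+1 -> \bar R) y :
  measurable_fun setT f -> measurable_fun setT (fun a => f (consRn (a, y))).
Proof.
move=> mf; have mfc := measurableT_comp mf (@measurable_consRn R n).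
exact: (measurableT_comp mfc (pair2_measurable y)).
Qed.

Lemma measurable_Lnorm_slice n s (f : Rn R n.+1 -> \bar R) :
  measurable_fun setT f -> (forall x, 0 <= f x) ->
  measurable_fun setT (fun y => Lnorm leb s%:E (fun a => f (consRn (a, y)))).
Proof.
move=> mf f0; under eq_fun do rewrite ge0_LnormE//.
apply: measurable_poweR_comp.
apply: (@measurable_fun_fubini_tonelli_G _ _ _ _ _ leb (fun z => f (consRn z) `^ s)).
  by apply: measurable_poweR_comp; exact: measurableT_comp mf (@measurable_consRn R n).
by move=> z; exact: poweR_ge0.
Qed.

(** Tonelli's theorem with x_1 innermost, the order in which [mixed_norm] integrates. *)
Lemma ge0_integral_consRn n (f : Rn R n.+1 -> \bar R) :
  measurable_fun setT f -> (forall x, 0 <= f x) ->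
  \int[lebesgueRn n.+1]_x f x =
  \int[lebesgueRn n]_y \int[leb]_a f (consRn (a, y)).
Proof.
move=> mf f0.
have mfc := measurableT_comp mf (@measurable_consRn R n).
rewrite -(@fubini_tonelli2 _ _ _ _ _ leb (lebesgueRn n) (f \o @consRn R n))//; last first.
  by move=> z; exact: f0.
transitivity (\int[pushforward (leb \x lebesgueRn n) (@consRn R n)]_x f x).
  by apply: eq_measure_integral; [exact: measurable_consRn|move=> ? A mA _].
rewrite ge0_integral_pushforward//; first exact: measurable_consRn.
Qed.

Lemma mixed_norm_ge0 n (p : n.-tuple (\bar R)) (f : Rn R n -> \bar R) : 0 <= mixed_norm p f.
Proof. by elim: n p f => [|n IHn] p f /=; [exact: abse_ge0|exact: IHn]. Qed.

Lemma le_mixed_norm n (p : n.-tuple R) (f g : Rn R n -> \bar R) :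
  all (fun s => 0 < s)%R p -> measurable_fun setT f -> measurable_fun setT g ->
  (forall x, 0 <= f x) -> (forall x, f x <= g x) -> MN p f <= MN p g.
Proof.
elim: n p f g => [|n IHn] p f g p0 mf mg f0 fg.
  by rewrite /= !gee0_abs//; exact: le_trans (fg _).
case/tupleP: p p0 => s p /andP[s0 p0].
have g0 x : 0 <= g x by exact: le_trans (fg x).
rewrite !mixed_norm_cons; apply: IHn => //.
- exact: measurable_Lnorm_slice.
- exact: measurable_Lnorm_slice.
- by move=> y; exact: Lnorm_ge0.
- by move=> y; apply: le_Lnorm => //; exact: measurable_slice.
Qed.

Lemma mixed_normZ n (p : n.-tuple R) (c : R) (f : Rn R n -> \bar R) :
  all (fun s => 0 < s)%R p -> (0 <= c)%R -> measurable_fun setT f ->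
  (forall x, 0 <= f x) -> MN p (fun x => c%:E * f x) = c%:E * MN p f.
Proof.
elim: n p f => [|n IHn] p f p0 c0 mf f0.
  by rewrite /= !gee0_abs// mule_ge0.
case/tupleP: p p0 => s p /andP[s0 p0].
rewrite !mixed_norm_cons -IHn//.
- congr (mixed_norm _ _); apply/funext => y.
  by rewrite ge0_LnormZ//; exact: measurable_slice.
- exact: measurable_Lnorm_slice.
- by move=> y; exact: Lnorm_ge0.
Qed.

Lemma mixed_norm_sup n (p : n.-tuple R) (F : (Rn R n -> \bar R)^nat) f :
  all (fun s => 0 < s)%R p ->
  (forall k, measurable_fun setT (F k)) -> (forall k x, 0 <= F k x) ->
  (forall x, nondecreasing_seq (F ^~ x)) ->
  (forall x, ereal_sup (range (F ^~ x)) = f x) ->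
  MN p f = ereal_sup (range (fun k => MN p (F k))).
Proof.
elim: n p F f => [|n IHn] p F f p0 mF F0 ndF Ff.
  rewrite /= gee0_abs -Ff.
    by congr (ereal_sup _); apply: eq_imagel => k _ /=; rewrite gee0_abs.
  by apply: le_trans (F0 0%N [tuple]) _; apply: ereal_sup_ubound; exists 0%N.
case/tupleP: p p0 => s p /andP[s0 p0].
rewrite mixed_norm_cons; under [in RHS]eq_fun do rewrite mixed_norm_cons.
apply: IHn => //.
- by move=> k; exact: measurable_Lnorm_slice.
- by move=> k y; exact: Lnorm_ge0.
- move=> y k l kl; apply: le_Lnorm => //; try exact: measurable_slice.
  by move=> a; exact: ndF.
- move=> y; apply/esym; apply: Lnorm_sup => //; move=> k; exact: measurable_slice.
Qed.

Lemma mixed_norm_dominated_cvg0 n (p : n.-tuple R) (F : (Rn R n -> \bar R)^nat) g :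
  all (fun s => 0 < s)%R p ->
  (forall k, measurable_fun setT (F k)) -> measurable_fun setT g ->
  (forall k x, 0 <= F k x) -> (forall k x, F k x <= g x) ->
  (forall x, g x < +oo -> F ^~ x @ \oo --> 0) ->
  MN p g < +oo -> (fun k => MN p (F k)) @ \oo --> 0.
Proof.
elim: n p F g => [|n IHn] p F g p0 mF mg F0 Fg Fc.
  have g0 x : 0 <= g x by exact: le_trans (Fg 0%N x).
  rewrite /= gee0_abs// => /Fc; apply: cvg_trans.
  by apply: near_eq_cvg; near=> k; rewrite gee0_abs.
have g0 x : 0 <= g x by exact: le_trans (Fg 0%N x).
case/tupleP: p p0 => s p /andP[s0 p0].
rewrite mixed_norm_cons; under [X in _ -> X @ _ --> _]eq_fun do rewrite mixed_norm_cons.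
apply: IHn => //.
- by move=> k; exact: measurable_Lnorm_slice.
- exact: measurable_Lnorm_slice.
- by move=> k y; exact: Lnorm_ge0.
- by move=> k y; apply: le_Lnorm => //; exact: measurable_slice.
- move=> y; apply: Lnorm_dominated_cvg0 => //.
  + by move=> k; exact: measurable_slice.
  + exact: measurable_slice.
  + by move=> a; exact: Fc.
Unshelve. all: by end_near. Qed.

Lemma measurable_powR_comp d (T : measurableType d) (f : T -> R) r :
  measurable_fun setT f -> measurable_fun setT (fun x => f x `^ r)%R.
Proof.
by move=> mf; apply: (@measurableT_comp _ _ _ _ _ _ (@powR R ^~ r)).
Qed.

(** A relation rather than a function: it is symmetric, so Hoelder and duality can be used in both
    directions, and an induction peels off both heads at once. *)
Definition conjugate_exponents n (p q : n.-tuple R) : bool :=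
  all2 (fun s t => [&& 0 < s, 0 < t & s^-1 + t^-1 == 1])%R p q.

Lemma conjugate_exponents_sym n (p q : n.-tuple R) :
  conjugate_exponents p q -> conjugate_exponents q p.
Proof.
elim: n p q => [|n IHn] p q; first by rewrite [p]tuple0 [q]tuple0.
case/tupleP: p => s p; case/tupleP: q => t q /andP[/and3P[s0 t0 st] pq].
by apply/andP; split; [rewrite addrC; apply/and3P|exact: IHn].
Qed.

Lemma conjugate_exponents_gt0 n (p q : n.-tuple R) :
  conjugate_exponents p q -> all (fun s => 0 < s)%R p.
Proof.
elim: n p q => [|n IHn] p q; first by rewrite [p]tuple0.
case/tupleP: p => s p; case/tupleP: q => t q /andP[/and3P[s0 t0 st] pq].
by apply/andP; split => //; exact: IHn pq.
Qed.

(** Tonelli reduces the integral to slices; the one-variable inequality bounds each slice by a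
    product of two slice norms, and the induction hypothesis applies to these. *)
Lemma mixed_hoelder n (p q : n.-tuple R) (f g : Rn R n -> \bar R) :
  conjugate_exponents p q -> measurable_fun setT f -> measurable_fun setT g ->
  (forall x, 0 <= f x) -> (forall x, 0 <= g x) ->
  \int[lebesgueRn n]_x (f x * g x) <= MN p f * MN q g.
Proof.
elim: n p q f g => [|n IHn] p q f g pq mf mg f0 g0.
  rewrite /= integral_dirac//; last exact: emeasurable_funM.
  by rewrite !gee0_abs// diracT mul1e.
case/tupleP: p pq => s p; case/tupleP: q => t q /andP[/and3P[s0 t0 /eqP st] pq].
rewrite !mixed_norm_cons ge0_integral_consRn//; last 2 first.
- exact: emeasurable_funM.
- by move=> x; exact: mule_ge0.
apply: le_trans; last first.
  apply: IHn => //; try exact: measurable_Lnorm_slice.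
  - by move=> y; exact: Lnorm_ge0.
  - by move=> y; exact: Lnorm_ge0.
apply: ge0_le_integral => //.
- by move=> y _; apply: integral_ge0 => a _; exact: mule_ge0.
- apply: (@measurable_fun_fubini_tonelli_G _ _ _ _ _ leb
    (fun z => f (consRn z) * g (consRn z))).
    apply: emeasurable_funM; apply: measurableT_comp => //; exact: measurable_consRn.
  by move=> z; exact: mule_ge0.
- by apply: emeasurable_funM; exact: measurable_Lnorm_slice.
by move=> y _; apply: ge0_hoelder => //; exact: measurable_slice.
Qed.

Definition boxRn n (K : R) : set (Rn R n) :=
  [set x | forall i, `|tnth x i| <= K]%R.

Lemma boxRn_cons n K a (y : Rn R n) :
  boxRn K (consRn (a, y)) <-> (`|a| <= K)%R /\ boxRn K y.
Proof.
split=> [h|[ha hy] i].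
  split; first exact: (h ord0).
  by move=> i; have := h (lift ord0 i); rewrite tnthS.
by case: (unliftP ord0 i) => [j|] ->//; rewrite tnthS; exact: hy.
Qed.

Lemma measurable_boxRn n K : measurable (@boxRn n K).
Proof.
rewrite (_ : boxRn _ = \bigcap_(i in [set: 'I_n]) ((fun x => `|tnth x i|%R) @^-1` `]-oo, K])).
  apply: fin_bigcap_measurable => // i _.
  rewrite -[X in measurable X]setTI.
  apply: (measurableT_comp (@normr_measurable R setT) (@measurable_tnth _ _ _ i)) => //.
by apply/seteqP; split=> x h i; have := h i; rewrite /= in_itv/=; [move=> ? _|apply].
Qed.

(** * Slices of bounded functions supported in a box *)

Section bounded_slices.
Variables (n : nat) (s K M : R) (h : Rn R n.+1 -> R).
Hypotheses (s0 : (0 < s)%R) (mh : measurable_fun setT h).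
Hypotheses (h0 : forall x, (0 <= h x)%R) (hM : forall x, (h x <= M)%R).
Hypothesis hK : forall x, h x != 0%R -> boxRn K x.

Let N y := Lnorm leb s%:E (fun a => (h (consRn (a, y)))%:E).

(** Every slice is dominated by M times the indicator of [-K, K], whose norm does not depend on
    y. *)
Lemma Lnorm_bounded_slice : exists2 M' : R, (0 <= M')%R & forall y, N y <= M'%:E.
Proof.
pose I : set (measurableTypeR R) := `[(- K)%R, K]%classic.
pose c a : \bar R := M%:E * (\1_I a)%:E.
have M0 : (0 <= M)%R by exact: le_trans (hM (point : Rn R n.+1)).
have c0 a : 0 <= c a by rewrite mule_ge0.
have mc : measurable_fun setT c.
  by apply: measurable_funeM; apply/measurable_EFinP; apply: measurable_indic; exact: measurable_itv.
have Ioo : leb I < +oo.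
  have := lebesgue_measure_itv `[(- K)%R, K] => /= ->.
  by case: ifP => _ //; rewrite -EFinB ltry.
have cfin : Lnorm leb s%:E c < +oo.
  rewrite /c ge0_LnormZ//; last by apply/measurable_EFinP; apply: measurable_indic; exact: measurable_itv.
  rewrite lte_mul_pinfty// ge0_LnormE// poweR_lty//.
  rewrite (eq_integral (EFin \o \1_I)).
    rewrite integral_indic//; last exact: measurable_itv.
    by rewrite setIT; exact: Ioo.
  move=> a _ /=; rewrite indicE; case: (a \in _); first by rewrite powR1.
  by rewrite powR0// gt_eqF.
exists (fine (Lnorm leb s%:E c)); first by rewrite fine_ge0// Lnorm_ge0.
move=> y; rewrite fineK ?ge0_fin_numE ?Lnorm_ge0//.
apply: le_Lnorm => //; first by apply: (@measurable_slice _ (EFin \o h) y); exact/measurable_EFinP.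
  by move=> a; rewrite lee_fin.
move=> a; rewrite /c indicE; case: (boolP (a \in _)) => aK.
  by rewrite mule1 lee_fin.
have [->|hn] := eqVneq (h (consRn (a, y))) 0%R; first by rewrite mule0.
have [ha _] := (boxRn_cons _ _ _).1 (hK hn).
exfalso; move/negP: aK; apply; apply/mem_set; change (a \in `[(- K)%R, K]).
by rewrite in_itv/= -ler_norml.
Qed.

Lemma Lnorm_bounded_slice_box y : N y != 0 -> boxRn K y.
Proof.
move=> Ny; apply: contrapT => yK; move/eqP: Ny; apply.
rewrite /N (_ : (fun _ => _) = cst 0) ?Lnorm0 ?eqe ?gt_eqF//.
apply/funext => a /=; congr EFin; apply: contrapT => /eqP/hK/boxRn_cons[_].
exact: yK.
Qed.

(** Being measurable, nonnegative, bounded and supported in a box passes from a function to its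
    slice norms; this is the invariant of the inductions below. *)
Lemma Lnorm_bounded_slice_fine : exists N' : Rn R n -> R,
  [/\ measurable_fun setT N', forall y, (0 <= N' y)%R,
      exists M' : R, forall y, (N' y <= M')%R,
      forall y, N' y != 0%R -> boxRn K y &
      forall y, N y = (N' y)%:E].
Proof.
have [M' M'0 NM'] := Lnorm_bounded_slice.
have Nfin y : N y \is a fin_num.
  by rewrite ge0_fin_numE ?Lnorm_ge0// (le_lt_trans (NM' y))// ltry.
exists (fine \o N); split => [|y||y|y].
- apply: (@measurableT_comp _ _ _ _ _ _ (@fine R)) => //.
  apply: (@measurable_Lnorm_slice _ s (EFin \o h)) => [|x]; last exact: h0.
  exact/measurable_EFinP.
- by rewrite /= fine_ge0// Lnorm_ge0.
- by exists M' => y; rewrite /= -lee_fin fineK.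
- by move=> Ny; apply: Lnorm_bounded_slice_box; apply: contra Ny => /eqP /= ->.
- by rewrite /= fineK.
Qed.

End bounded_slices.

Lemma mixed_norm_bounded_lty n (p : n.-tuple R) (K M : R) (h : Rn R n -> R) :
  all (fun s => 0 < s)%R p -> measurable_fun setT h ->
  (forall x, (0 <= h x)%R) -> (forall x, (h x <= M)%R) ->
  (forall x, h x != 0%R -> boxRn K x) ->
  MN p (EFin \o h) < +oo.
Proof.
elim: n p M h => [|n IHn] p M h p0 mh h0 hM hK; first by rewrite /= ltry.
case/tupleP: p p0 => s p /andP[s0 p0]; rewrite mixed_norm_cons.
have [N [mN N0 [M' NM'] NK NE]] := Lnorm_bounded_slice_fine s0 mh h0 hM hK.
rewrite (_ : (fun _ => _) = EFin \o N); last by apply/funext => y; exact: NE.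
exact: IHn.
Qed.

(* The extremal function is built one variable at a time: on the slice through
   y it is g(y) (h / |h(., y)|_s)^(s - 1), g being extremal for the function
   y |-> |h(., y)|_s (the junk value 0^-1 = 0 covers the null slices). *)
Lemma mixed_norm_extremal n (p q : n.-tuple R) (K M : R) (h : Rn R n -> R) :
  conjugate_exponents p q -> measurable_fun setT h ->
  (forall x, (0 <= h x)%R) -> (forall x, (h x <= M)%R) ->
  (forall x, h x != 0%R -> boxRn K x) ->
  exists g : Rn R n -> R, [/\ measurable_fun setT g, forall x, (0 <= g x)%R,
    forall x, h x = 0%R -> g x = 0%R, MN q (EFin \o g) <= 1 &
    \int[lebesgueRn n]_x (g x * h x)%:E = MN p (EFin \o h)].
Proof.
elim: n p q M h => [|n IHn] p q M h pq mh h0 hM hK.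
  exists (fun x => if h x == 0%R then 0%R else 1%R); split => [|x|x ->||].
  - by apply: measurable_fun_ifT => //; exact: measurable_fun_eqr.
  - by case: ifP.
  - by rewrite eqxx.
  - by rewrite /=; case: ifP; rewrite ?normr0 ?normr1 ?lexx// lee_fin.
  - rewrite /= integral_dirac//; last first.
      apply/measurable_EFinP; apply: measurable_funM => //.
      by apply: measurable_fun_ifT => //; exact: measurable_fun_eqr.
    rewrite diracT mul1e ger0_norm//; case: ifPn => [/eqP ->|_].
      by rewrite mulr0.
    by rewrite mul1r.
case/tupleP: p pq => s p; case/tupleP: q => t q /andP[/and3P[s0 t0 /eqP st] pq].
have [N [mN N0 [M' NM'] NK NE]] := Lnorm_bounded_slice_fine s0 mh h0 hM hK.
have [g [mg g0 gN gq gE]] := IHn _ _ _ _ pq mN N0 NM' NK.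
have s1 : (1 < s)%R.
  rewrite -invf_lt1// -st ltrDl invr_gt0//.
(* Because (s - 1) t = s, the t-norm of h^(s-1) on a slice is N^(s/t) = N^(s-1), which the
   normalisation of G cancels. *)
have stE : ((s - 1) * t = s)%R.
  have : (t * s * (s^-1 + t^-1) = t * s)%R by rewrite st mulr1.
  have sn0 : (s != 0)%R by rewrite gt_eqF.
  have tn0 : (t != 0)%R by rewrite gt_eqF.
  rewrite mulrDr mulfK// mulrAC mulfV// mul1r => ts.
  by rewrite mulrBl mul1r mulrC -ts addrC addKr.
have s10 : (0 < s - 1)%R by rewrite subr_gt0.
pose G x := let z := unconsRn x in
  (g z.2 / (N z.2) `^ (s - 1) * (h x) `^ (s - 1))%R.
have mG : measurable_fun setT G.
  have m2 : measurable_fun setT (fun x : Rn R n.+1 => (unconsRn x).2).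
    exact: measurable_behead.
  apply: measurable_funM; first apply: measurable_funM.
  - exact: measurableT_comp mg m2.
  - rewrite (_ : (fun _ => _) = fun x => (N (unconsRn x).2 `^ (- (s - 1)))%R); last first.
      by apply/funext => x; rewrite powRN.
    apply: measurable_powR_comp; exact: measurableT_comp mN m2.
  - exact: measurable_powR_comp.
have G0 x : (0 <= G x)%R by rewrite !mulr_ge0// ?invr_ge0 powR_ge0.
have unc a (y : Rn R n) : unconsRn (consRn (a, y)) = (a, y) by exact: consRnK.
have NsE y : \int[leb]_a (h (consRn (a, y)) `^ s)%:E = (N y `^ s)%:E.
  rewrite -poweR_EFin -NE ge0_Lnorm_poweR//; last by move=> a; rewrite lee_fin.
have mhs y r : measurable_fun setT (fun a => (h (consRn (a, y)) `^ r)%:E).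
  apply/measurable_EFinP; apply: measurable_powR_comp.
  apply/measurable_EFinP; apply: (@measurable_slice _ (EFin \o h) y).
  exact/measurable_EFinP.
exists G; split => // [x hx||].
- by rewrite /G hx powR0 ?mulr0// gt_eqF.
- rewrite mixed_norm_cons; apply: le_trans gq; apply: le_mixed_norm.
  + exact: conjugate_exponents_gt0 (conjugate_exponents_sym pq).
  + by apply: measurable_Lnorm_slice => //; exact/measurable_EFinP.
  + exact/measurable_EFinP.
  + by move=> y; exact: Lnorm_ge0.
  move=> y; rewrite (_ : (fun _ => _) = (fun a => (g y / N y `^ (s - 1))%:E *
      (h (consRn (a, y)) `^ (s - 1))%:E)); last first.
    by apply/funext => a; rewrite /= /G unc EFinM.
  rewrite ge0_LnormZ//; last 2 first.
  - by rewrite divr_ge0 ?powR_ge0.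
  - by move=> a; rewrite lee_fin powR_ge0.
  rewrite ge0_LnormE; last by move=> a; rewrite lee_fin powR_ge0.
  under eq_integral do rewrite poweR_EFin -powRrM stE.
  rewrite NsE poweR_EFin -powRrM (_ : (s / t = s - 1)%R); last first.
    by rewrite -[in LHS]stE mulfK// gt_eqF.
  rewrite /= lee_fin; have [->|Ny] := eqVneq (N y) 0%R.
    by rewrite powR0 ?mulr0// gt_eqF.
  by rewrite mulfVK// powR_eq0 negb_and Ny.
- rewrite mixed_norm_cons (_ : (fun y => Lnorm _ _ _) = EFin \o N); last first.
    by apply/funext => y; exact: NE.
  rewrite -gE ge0_integral_consRn//; last first.
  + by move=> x; rewrite lee_fin mulr_ge0.
  + by apply/measurable_EFinP; exact: measurable_funM.
  apply: eq_integral => y _.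
  rewrite (eq_integral (fun a => (g y / N y `^ (s - 1))%:E * (h (consRn (a, y)) `^ s)%:E)); last first.
    move=> a _; rewrite /G unc -EFinM -mulrA; congr (_ * _)%:E.
    by rewrite mulrC mulr_powRB1.
  rewrite ge0_integralZl//.
  + rewrite NsE -EFinM; congr EFin; have [->|Ny] := eqVneq (N y) 0%R.
      have sn0 : (s != 0)%R by rewrite gt_eqF.
      by rewrite (powR0 sn0) !mulr0.
    rewrite -(mulr_powRB1 (N0 y) s0) (mulrC (N y)) mulrA mulfVK//.
    by rewrite powR_eq0 negb_and Ny.
  + by move=> a _; rewrite lee_fin powR_ge0.
  + by rewrite lee_fin divr_ge0 ?powR_ge0.
Qed.

(** Cutting both in height and in space gives real functions that increase to f and satisfy the
    hypotheses of [mixed_norm_extremal]. *)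
Definition truncRn n (f : Rn R n -> \bar R) (k : nat) (x : Rn R n) : R :=
  (fine (mine (f x) k%:R%:E) * \1_(boxRn k%:R) x)%R.

Lemma truncRnE n (f : Rn R n -> \bar R) k x : 0 <= f x ->
  (truncRn f k x)%:E = mine (f x) k%:R%:E * (\1_(boxRn k%:R) x)%:E.
Proof.
move=> f0; rewrite /truncRn EFinM fineK// ge0_fin_numE.
  by rewrite gt_min ltry orbT.
by rewrite le_min f0/= lee_fin.
Qed.

Lemma measurable_truncRn n (f : Rn R n -> \bar R) k : measurable_fun setT f ->
  measurable_fun setT (truncRn f k).
Proof.
move=> mf; apply: measurable_funM.
  by apply: (@measurableT_comp _ _ _ _ _ _ (@fine R)) => //; exact: measurable_mine.
by apply: measurable_indic; exact: measurable_boxRn.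
Qed.

Lemma truncRn_ge0 n (f : Rn R n -> \bar R) k x : 0 <= f x -> (0 <= truncRn f k x)%R.
Proof. by move=> f0; rewrite mulr_ge0// fine_ge0// le_min f0/= lee_fin. Qed.

Lemma truncRn_le n (f : Rn R n -> \bar R) k x : 0 <= f x -> (truncRn f k x <= k%:R)%R.
Proof.
move=> f0; rewrite -lee_fin truncRnE// indicE; case: (_ \in _).
  by rewrite mule1 ge_min lexx orbT.
by rewrite mule0 lee_fin.
Qed.

Lemma truncRn_lef n (f : Rn R n -> \bar R) k x : 0 <= f x -> (truncRn f k x)%:E <= f x.
Proof.
move=> f0; rewrite truncRnE// indicE; case: (_ \in _); last by rewrite mule0.
by rewrite mule1 ge_min lexx.
Qed.

Lemma truncRn_box n (f : Rn R n -> \bar R) k x : truncRn f k x != 0%R -> boxRn k%:R x.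
Proof.
rewrite /truncRn indicE; case: (boolP (x \in _)) => [/set_mem//|_].
by rewrite mulr0 eqxx.
Qed.

Lemma truncRn_nd n (f : Rn R n -> \bar R) x : 0 <= f x ->
  nondecreasing_seq (fun k => (truncRn f k x)%:E).
Proof.
move=> f0 k l kl; rewrite !truncRnE// !indicE.
have kl' : (k%:R <= l%:R :> R)%R by rewrite ler_nat.
case: (boolP (x \in boxRn k%:R)) => [/set_mem xk|_]; last first.
  by rewrite mule0 mule_ge0// le_min f0/= lee_fin.
rewrite mem_set ?mule1; last by move=> i; exact: le_trans (xk i) kl'.
rewrite le_min ge_min lexx/=.
by rewrite ge_min lee_fin kl' orbT.
Qed.

Lemma truncRn_sup n (f : Rn R n -> \bar R) x : 0 <= f x ->
  ereal_sup (range (fun k => (truncRn f k x)%:E)) = f x.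
Proof.
move=> f0; apply/eqP; rewrite eq_le; apply/andP; split.
  by apply: ge_ereal_sup => _ [k _ <-]; exact: truncRn_lef.
have [K0 xK0] : exists K, boxRn K%:R x.
  exists (\sum_(i < n) (Num.truncn `|tnth x i|).+1)%N => i.
  apply: (le_trans (ltW (truncnS_gt _))).
  by rewrite ler_nat (bigD1 i)//= leq_addr.
have xK k : (K0 <= k)%N -> mine (f x) k%:R%:E <= ereal_sup (range (fun k => (truncRn f k x)%:E)).
  move=> Kk; apply: ereal_sup_ubound; exists k => //.
  rewrite truncRnE// indicE mem_set ?mule1// => i.
  by apply: (le_trans (xK0 i)); rewrite ler_nat.
move: f0 xK; case: (f x) => [r| |//] r0 xK.
  pose k := (maxn K0 (Num.truncn r).+1).
  apply: le_trans (xK k (leq_maxl _ _)); rewrite le_min lexx/= lee_fin.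
  by apply: (le_trans (ltW (truncnS_gt r))); rewrite ler_nat leq_maxr.
rewrite leye_eq; apply/eqP/eq_infty => r.
pose k := (maxn K0 (Num.truncn r).+1).
apply: le_trans (xK k (leq_maxl _ _)); rewrite le_min leey/= lee_fin.
by apply: (le_trans (ltW (truncnS_gt r))); rewrite ler_nat leq_maxr.
Qed.

(** The case s = 1 of [Lnorm_sup]. *)
Lemma ge0_integral_sup d (T : measurableType d) (mu : {measure set T -> \bar R})
    (F : (T -> \bar R)^nat) f :
  (forall n, measurable_fun setT (F n)) -> (forall n x, 0 <= F n x) ->
  (forall x, nondecreasing_seq (F ^~ x)) ->
  (forall x, ereal_sup (range (F ^~ x)) = f x) ->
  \int[mu]_x f x = ereal_sup (range (fun n => \int[mu]_x F n x)).
Proof.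
move=> mF F0 ndF Ff.
have f0 x : 0 <= f x.
  by rewrite -Ff; apply: le_trans (F0 0%N x) _; apply: ereal_sup_ubound; exists 0%N.
have N1 g : (forall x, 0 <= g x) -> Lnorm mu 1%:E g = \int[mu]_x g x.
  by move=> g0; rewrite Lnorm1; apply: eq_integral => x _; rewrite gee0_abs.
rewrite -N1// (Lnorm_sup mu _ mF F0 ndF Ff)//.
by congr ereal_sup; apply: eq_imagel => n _; rewrite N1.
Qed.

(** Two monotone limits make the test function bounded: f is first replaced by a truncation, which
    has an exact extremal g, and g is then capped at height m. The strict inequality with c survives
    both. Vanishing where f does lets the test function inherit the support of f. *)
Lemma mixed_norm_dual n (p q : n.-tuple R) (f : Rn R n -> \bar R) c :
  conjugate_exponents p q -> measurable_fun setT f -> (forall x, 0 <= f x) ->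
  c < MN p f ->
  exists g : Rn R n -> R, [/\ measurable_fun setT g,
    (forall x, 0 <= g x)%R /\ (exists B, forall x, g x <= B)%R,
    forall x, f x = 0 -> g x = 0%R, MN q (EFin \o g) <= 1 &
    c < \int[lebesgueRn n]_x ((g x)%:E * f x)].
Proof.
move=> pq mf f0.
have p0 := conjugate_exponents_gt0 pq.
have q0 := conjugate_exponents_gt0 (conjugate_exponents_sym pq).
rewrite (@mixed_norm_sup _ p (fun k x => (truncRn f k x)%:E) f)//; last 4 first.
- by move=> k; apply/measurable_EFinP; exact: measurable_truncRn.
- by move=> k x; rewrite lee_fin truncRn_ge0.
- by move=> x; exact: truncRn_nd.
- by move=> x; exact: truncRn_sup.
move=> /ereal_sup_gt[_ [k _ <-]] ck.
have mh := measurable_truncRn k mf.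
have [g [mg g0 gh gq gE]] := mixed_norm_extremal pq mh
  (fun x => truncRn_ge0 k (f0 x)) (fun x => truncRn_le k (f0 x)) (@truncRn_box n f k).
move: ck; rewrite -[MN p _]gE (@ge0_integral_sup _ _ _
    (fun m x => (Num.min (g x) m%:R * truncRn f k x)%:E)); last 4 first.
- move=> m; apply/measurable_EFinP; apply: measurable_funM => //.
  exact: measurable_minr.
- by move=> m x; rewrite lee_fin mulr_ge0 ?truncRn_ge0// le_min g0/=.
- move=> x m m' mm'; rewrite lee_fin ler_wpM2r ?truncRn_ge0//.
  by rewrite le_min ge_min lexx/= ge_min ler_nat mm' orbT.
- move=> x; apply/eqP; rewrite eq_le; apply/andP; split.
    apply: ge_ereal_sup => _ [m _ <-]; rewrite lee_fin ler_wpM2r ?truncRn_ge0//.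
    by rewrite ge_min lexx.
  apply: ereal_sup_ubound; exists (Num.truncn (g x)).+1 => //.
  by rewrite min_l// ltW// truncnS_gt.
move=> /ereal_sup_gt[_ [m _ <-]] cm.
have gm0 x : (0 <= Num.min (g x) m%:R)%R by rewrite le_min g0/=.
have mgm : measurable_fun setT (fun x => Num.min (g x) m%:R) by exact: measurable_minr.
exists (fun x => Num.min (g x) m%:R); split => //.
- by split => //; exists m%:R => x; rewrite ge_min lexx orbT.
- move=> x fx; rewrite gh ?min_l//; apply/eqP; rewrite -eqe truncRnE// fx.
  by rewrite min_l ?mul0e// lee_fin.
- apply: le_trans gq; apply: le_mixed_norm => //; try exact/measurable_EFinP.
  by move=> x; rewrite lee_fin ge_min lexx.
apply: lt_le_trans cm _; apply: ge0_le_integral => //.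
- by move=> x _; rewrite lee_fin mulr_ge0 ?truncRn_ge0.
- by apply/measurable_EFinP; exact: measurable_funM.
- by apply: emeasurable_funM => //; exact/measurable_EFinP.
- by move=> x _; rewrite EFinM lee_wpmul2l ?lee_fin ?truncRn_lef.
Qed.

(* The triangle inequality follows from duality: test f + g against an almost
   extremal function of the conjugate exponents. *)
Lemma mixed_normD n (p q : n.-tuple R) (f g : Rn R n -> \bar R) :
  conjugate_exponents p q -> measurable_fun setT f -> measurable_fun setT g ->
  (forall x, 0 <= f x) -> (forall x, 0 <= g x) ->
  MN p (fun x => f x + g x) <= MN p f + MN p g.
Proof.
move=> pq mf mg f0 g0; rewrite leNgt; apply/negP => lt.
have [||h [mh [h0 _] _ hq]] := mixed_norm_dual pq _ _ lt.
- exact: emeasurable_funD.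
- by move=> x; exact: adde_ge0.
apply/negP; rewrite -leNgt.
have mhE : measurable_fun setT (EFin \o h) by exact/measurable_EFinP.
under eq_integral do rewrite ge0_muleDr//.
rewrite ge0_integralD//; last 4 first.
- by move=> x _; rewrite mule_ge0// lee_fin.
- exact: emeasurable_funM.
- by move=> x _; rewrite mule_ge0// lee_fin.
- exact: emeasurable_funM.
have H u : measurable_fun setT u -> (forall x, 0 <= u x) ->
    \int[lebesgueRn n]_x ((h x)%:E * u x) <= MN p u.
  move=> mu u0; under eq_integral do rewrite muleC.
  apply: (le_trans (@mixed_hoelder n p q u (EFin \o h) pq mu mhE u0 _)) => //.
  by rewrite -[leRHS]mule1 lee_wpmul2l// mixed_norm_ge0.
by apply: leeD; exact: H.
Qed.

End mixed.

(** * Complex-valued functions *)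

Section complex_facts.
Context {R : realType}.
Implicit Types z w : R[i].

Lemma normc_ge0 z : 0 <= normc z.
Proof. by case: z => a b; exact: sqrtr_ge0. Qed.

Lemma normcR (a : R) : normc (a%:C)%C = `|a|.
Proof. by rewrite /Normc.normc /= expr0n addr0 sqrtr_sqr. Qed.

Lemma normr_normc z : `|z| = (normc z)%:C%C.
Proof. by rewrite normc_def; case: z. Qed.

Lemma ler_Re_normc z : `|Re z| <= normc z.
Proof.
case: z => a b /=; rewrite -[leLHS]sqrtr_sqr ler_sqrt ?addr_ge0 ?sqr_ge0//.
by rewrite lerDl sqr_ge0.
Qed.

Lemma ler_Im_normc z : `|Im z| <= normc z.
Proof.
case: z => a b /=; rewrite -[leLHS]sqrtr_sqr ler_sqrt ?addr_ge0 ?sqr_ge0//.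
by rewrite lerDr sqr_ge0.
Qed.

Lemma normc_le_ReIm z : normc z <= `|Re z| + `|Im z|.
Proof.
case: z => a b /=; rewrite -[leRHS]ger0_norm ?addr_ge0//.
rewrite -[leRHS]sqrtr_sqr ler_sqrt ?sqr_ge0// sqrrD -!normrX (ger0_norm (sqr_ge0 a)) (ger0_norm (sqr_ge0 b)).
by rewrite -addrA lerD2l lerDr mulrn_wge0// mulr_ge0.
Qed.

Lemma normc_eq0 z : (normc z == 0) = (z == 0).
Proof.
apply/eqP/eqP => [/Normc.eq0_normc//|->]; exact: Normc.normc0.
Qed.

Lemma normc_conj z : normc (z^*)%C = normc z.
Proof. by case: z => a b /=; rewrite sqrrN. Qed.

Lemma mulc_conj z : z * (z^*)%C = ((normc z) ^+ 2)%:C%C.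
Proof.
case: z => a b; rewrite /Normc.normc sqr_sqrtr ?addr_ge0 ?sqr_ge0//.
by apply/eqP; rewrite eq_complex /=; apply/andP; split; apply/eqP; ring.
Qed.

Lemma ReM z w : Re (z * w) = Re z * Re w - Im z * Im w.
Proof. by case: z => a b; case: w. Qed.

Lemma ImM z w : Im (z * w) = Re z * Im w + Im z * Re w.
Proof. by case: z => a b; case: w. Qed.

Lemma ReD z w : Re (z + w) = Re z + Re w.
Proof. by case: z => a b; case: w. Qed.

Lemma ImD z w : Im (z + w) = Im z + Im w.
Proof. by case: z => a b; case: w. Qed.

(** The rotation carrying z to its modulus; it turns bounds on real parts into bounds on moduli,
    both for integrals and in Hahn-Banach. *)
Lemma unimodular z : exists2 u, normc u = 1 & u * z = (normc z)%:C%C.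
Proof.
have [->|z0] := eqVneq z 0.
  by exists 1; rewrite ?Normc.normc1// Normc.normc0 mulr0.
have nz : normc z != 0 by rewrite normc_eq0.
exists ((normc z)^-1%:C%C * (z^*)%C).
  by rewrite Normc.normcM normcR normc_conj ger0_norm ?invr_ge0 ?normc_ge0// mulVf.
rewrite -mulrA [_^*%C * _]mulrC mulc_conj -rmorphM /=.
by rewrite expr2 mulKf.
Qed.

(** The norm of R[i] takes values in R[i], where a positive e has zero imaginary part, so real radii
    suffice. *)
Lemma cvg_normcP (T : Type) (F : set_system T) (FF : Filter F) (f : T -> R[i]) z :
  f @ F --> (z : R[i]^o) <->
  forall e : R, 0 < e -> \forall x \near F, normc (z - f x) < e.
Proof.
split=> [/(@cvgrPdist_lt _ R[i]^o _ F FF f z) h e e0|h].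
  have := h (e%:C)%C; rewrite ltcR => /(_ e0); apply: filterS => x.
  by rewrite normr_normc ltcR.
apply/(@cvgrPdist_lt _ R[i]^o _ F FF f z) => e; rewrite ltcE /= => /andP[/eqP Ie e0].
apply: filterS (h (Re e) e0) => x.
by rewrite normr_normc ltcE /= Ie eqxx.
Qed.

End complex_facts.

(** * Measurability and integration of complex-valued functions *)

Section cmeasurable_facts.
Context {R : realType} {n : nat}.
Local Notation X := (Rn R n).
Local Notation mu := (@lebesgueRn R n).
Implicit Types f g : X -> R[i].

Lemma measurable_normc f : cmeasurable f -> measurable_fun setT (fun x => normc (f x)).
Proof.
move=> [mr mi].
rewrite (_ : (fun _ => _) = (fun x => Num.sqrt ((Re (f x)) ^+ 2 + (Im (f x)) ^+ 2))); last first.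
  by apply/funext => x; case: (f x).
apply: (measurableT_comp (f := @Num.sqrt R)).
  by apply: continuous_measurable_fun; exact: sqrt_continuous.
by apply: measurable_funD; exact: measurable_funX.
Qed.

Lemma measurable_EFin_normc f : cmeasurable f ->
  measurable_fun setT (fun x => (normc (f x))%:E).
Proof. by move=> mf; apply/measurable_EFinP; exact: measurable_normc. Qed.

Lemma cmeasurableD f g : cmeasurable f -> cmeasurable g ->
  cmeasurable (fun x => f x + g x).
Proof.
move=> [f1 f2] [g1 g2]; split.
  by under eq_fun do rewrite ReD; exact: measurable_funD.
by under eq_fun do rewrite ImD; exact: measurable_funD.
Qed.

Lemma cmeasurableM f g : cmeasurable f -> cmeasurable g ->
  cmeasurable (fun x => f x * g x).
Proof.
move=> [f1 f2] [g1 g2]; split.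
  under eq_fun do rewrite ReM.
  by apply: measurable_funB; exact: measurable_funM.
under eq_fun do rewrite ImM.
by apply: measurable_funD; exact: measurable_funM.
Qed.

Lemma cmeasurable_cst z : cmeasurable (fun _ : X => z).
Proof. by split; exact: measurable_cst. Qed.

Lemma cmeasurable_real (u : X -> R) : measurable_fun setT u ->
  cmeasurable (fun x => (u x)%:C%C).
Proof. by move=> mu'; split => //=; exact: measurable_cst. Qed.

Lemma cmeasurable_conj f : cmeasurable f -> cmeasurable (fun x => (f x)^*%C).
Proof.
move=> [f1 f2]; split.
  by rewrite (_ : (fun _ => _) = (fun x => Re (f x)))//; apply/funext => x; case: (f x).
rewrite (_ : (fun _ => _) = (fun x => - Im (f x))); first exact: measurable_funN.
by apply/funext => x; case: (f x).
Qed.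

Lemma cmeasurable_indic (A : set X) : measurable A ->
  cmeasurable (fun x => \1_A x).
Proof.
move=> mA; rewrite (_ : (fun _ => _) = fun x => ((\1_A x : R)%:C)%C).
  by apply: cmeasurable_real; exact: measurable_indic.
by apply/funext => x; rewrite !indicE; case: (_ \in _).
Qed.

Lemma cmeasurable_sum (I : Type) (s : seq I) (F : I -> X -> R[i]) :
  (forall i, cmeasurable (F i)) -> cmeasurable (fun x => \sum_(i <- s) F i x).
Proof.
move=> mF; elim: s => [|i s IHs].
  by under eq_fun do rewrite big_nil; exact: cmeasurable_cst.
by under eq_fun do rewrite big_cons; exact: cmeasurableD.
Qed.

Local Open Scope ereal_scope.

Lemma cintegrableP f : cmeasurable f ->
  cintegrable f <-> \int[mu]_x (normc (f x))%:E < +oo.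
Proof.
move=> mf; have [mr mi] := mf; split.
  move=> [/integrableP[_ ir] /integrableP[_ ii]].
  apply: (@le_lt_trans _ _ (\int[mu]_x (`|(Re (f x))%:E| + `|(Im (f x))%:E|))).
    apply: ge0_le_integral => //.
    - by move=> x _; rewrite lee_fin normc_ge0.
    - exact: measurable_EFin_normc.
    - by apply: emeasurable_funD; apply: measurableT_comp => //; exact/measurable_EFinP.
    - by move=> x _; rewrite -EFinD lee_fin normc_le_ReIm.
  rewrite ge0_integralD//; last 2 first.
  - by apply: measurableT_comp => //; exact/measurable_EFinP.
  - by apply: measurableT_comp => //; exact/measurable_EFinP.
  exact: lte_add_pinfty.
move=> foo; split; apply/integrableP; split; try exact/measurable_EFinP.
  apply: le_lt_trans foo; apply: ge0_le_integral => //.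
  - by apply: measurableT_comp => //; exact/measurable_EFinP.
  - exact: measurable_EFin_normc.
  - by move=> x _; rewrite lee_fin ler_Re_normc.
apply: le_lt_trans foo; apply: ge0_le_integral => //.
- by apply: measurableT_comp => //; exact/measurable_EFinP.
- exact: measurable_EFin_normc.
- by move=> x _; rewrite lee_fin ler_Im_normc.
Qed.

Local Close Scope ereal_scope.

Lemma cintegralD f g : cintegrable f -> cintegrable g ->
  cintegral (fun x => f x + g x) = cintegral f + cintegral g.
Proof.
move=> [f1 f2] [g1 g2]; apply/eqP; rewrite eq_complex /=; apply/andP; split; apply/eqP.
  by under eq_Rintegral do rewrite ReD; rewrite RintegralD.
by under eq_Rintegral do rewrite ImD; rewrite RintegralD.
Qed.

Lemma cintegrableZ z f : cintegrable f -> cintegrable (fun x => z * f x).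
Proof.
move=> [f1 f2]; split.
  under eq_fun do rewrite ReM EFinB !EFinM.
  by apply: integrableB => //; exact: integrableZl.
under eq_fun do rewrite ImM EFinD !EFinM.
by apply: integrableD => //; exact: integrableZl.
Qed.

Lemma cintegralZ z f : cintegrable f -> cintegral (fun x => z * f x) = z * cintegral f.
Proof.
move=> [f1 f2].
have iZ (a : R) (u : X -> R) : mu.-integrable setT (EFin \o u) ->
    mu.-integrable setT (EFin \o (fun x => a * u x)).
  by move=> iu; rewrite (_ : _ \o _ = (fun x => a%:E * (u x)%:E)%E)//; exact: integrableZl.
apply/eqP; rewrite eq_complex ReM ImM /=; apply/andP; split; apply/eqP.
  under eq_Rintegral do rewrite ReM; rewrite RintegralB ?RintegralZl//; exact: iZ.
under eq_Rintegral do rewrite ImM; rewrite RintegralD ?RintegralZl//; exact: iZ.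
Qed.

Lemma cintegral_real (u : X -> R) : cintegral (fun x => (u x)%:C%C) = (\int[mu]_x u x)%:C%C.
Proof. by apply/eqP; rewrite eq_complex /= eqxx/= Rintegral_cst//= mul0r. Qed.

(** After a rotation the integral equals its modulus, hence is the integral of a real part bounded
    by the modulus of f. *)
Lemma le_normc_cintegral f : cmeasurable f -> cintegrable f ->
  ((normc (cintegral f))%:E <= \int[mu]_x (normc (f x))%:E)%E.
Proof.
move=> mf fi; have [u u1 uE] := unimodular (cintegral f).
have [ufr _] := cintegrableZ u fi.
have -> : normc (cintegral f) = \int[mu]_x Re (u * f x).
  have := cintegralZ u fi; rewrite uE => /(congr1 (@complex.Re R)) /= <-.
  by [].
rewrite /Rintegral fineK; last exact: integrable_fin_num.
apply: (le_trans (lee_abs _)); apply: (le_trans (le_abse_integral _ _ _)) => //.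
  by case/integrableP: ufr.
apply: ge0_le_integral => //.
- by apply: measurableT_comp => //; case/integrableP: ufr.
- exact: measurable_EFin_normc.
- by move=> x _; rewrite lee_fin (le_trans (ler_Re_normc _))// Normc.normcM u1 mul1r.
Qed.

End cmeasurable_facts.

(** * Sums over dyadic cubes *)

Section enumeration.
Context {R : realType} {I : countType}.
Implicit Types (a : I -> \bar R) (s : R).
Local Open Scope ereal_scope.

(** Transport along the coding of a countable type, with value 0 at numbers that code nothing. It
    turns an l^q norm into an [Lnorm] for the counting measure, so the one-variable lemmas apply to
    families. *)
Definition enumf a (k : nat) : \bar R := oapp a 0 (pickle_inv k).

Lemma enumf_pickle a i : enumf a (choice.pickle i) = a i.
Proof. by rewrite /enumf pickleK_inv. Qed.

Lemma enumf_ge0 a : (forall i, 0 <= a i) -> forall k, 0 <= enumf a k.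
Proof. by move=> a0 k; rewrite /enumf; case: (pickle_inv k). Qed.

Lemma esum_enumf a : (forall i, 0 <= a i) ->
  \esum_(i in [set: I]) a i = \int[counting]_k enumf a k.
Proof.
move=> a0; rewrite ge0_integral_count; last exact: enumf_ge0.
rewrite nneseries_esumT; last exact: enumf_ge0.
transitivity (\esum_(k in choice.pickle @` [set: I]) enumf a k).
  rewrite esum_image; last by move=> i j _ _ /(pcan_inj pickleK_inv).
  by apply: eq_esum => i _; rewrite enumf_pickle.
rewrite esum_mkcond; apply: eq_esum => k _; case: ifPn => // /negP kP.
rewrite /enumf; case E : (pickle_inv k) => [i|//]; exfalso; apply: kP.
by apply/mem_set; exists i => //; have := @pickle_invK I k; rewrite E.
Qed.

Lemma esum_enumf_series a : (forall i, 0 <= a i) ->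
  \esum_(i in [set: I]) a i = \sum_(k <oo) enumf a k.
Proof.
by move=> a0; rewrite esum_enumf// ge0_integral_count//; exact: enumf_ge0.
Qed.

Lemma esum_poweR a s : (0 < s)%R -> (forall i, 0 <= a i) ->
  (\esum_(i in [set: I]) a i `^ s) `^ s^-1 = Lnorm counting s%:E (enumf a).
Proof.
move=> s0 a0; rewrite ge0_LnormE; last exact: enumf_ge0.
rewrite esum_enumf; last by move=> i; exact: poweR_ge0.
congr (_ `^ _); apply: eq_integral => k _; rewrite /enumf.
by case: (pickle_inv k) => //=; rewrite powR0 ?gt_eqF.
Qed.

Lemma lq_normE (l : I -> R[i]) s : (0 < s)%R ->
  lq_norm s%:E l = Lnorm counting s%:E (enumf (fun i => (normc (l i))%:E)).
Proof. by move=> s0; rewrite -esum_poweR// => i; rewrite lee_fin normc_ge0. Qed.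

Lemma le_lq_norm (l l' : I -> R[i]) s : (0 < s)%R ->
  (forall i, normc (l i) <= normc (l' i))%R -> lq_norm s%:E l <= lq_norm s%:E l'.
Proof.
move=> s0 ll; rewrite !lq_normE//; apply: le_Lnorm => //.
  by apply: enumf_ge0 => i; rewrite lee_fin normc_ge0.
by move=> k; rewrite /enumf; case: (pickle_inv k) => //= i; rewrite lee_fin.
Qed.

Lemma lq_norm_ge0 (l : I -> R[i]) s : (0 < s)%R -> 0 <= lq_norm s%:E l.
Proof. by move=> s0; rewrite lq_normE// Lnorm_ge0. Qed.

Lemma lq_normZ (l : I -> R[i]) s (c : R[i]) : (0 < s)%R ->
  lq_norm s%:E (fun i => c * l i)%R = (normc c)%:E * lq_norm s%:E l.
Proof.
move=> s0; rewrite !lq_normE// -ge0_LnormZ ?normc_ge0//; last first.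
  by apply: enumf_ge0 => i; rewrite lee_fin normc_ge0.
congr Lnorm; apply/funext => k; rewrite /enumf; case: (pickle_inv k) => /= [i|].
  by rewrite Normc.normcM EFinM.
by rewrite mule0.
Qed.

Lemma lq_normD (l m : I -> R[i]) s : (1 <= s)%R ->
  lq_norm s%:E (fun i => l i + m i)%R <= lq_norm s%:E l + lq_norm s%:E m.
Proof.
move=> s1; have s0 : (0 < s)%R by exact: lt_le_trans s1.
pose u (l : I -> R[i]) k := oapp (fun i => normc (l i)) 0%R (pickle_inv k).
have uE l' : enumf (fun i => (normc (l' i))%:E) = EFin \o u l'.
  by apply/funext => k; rewrite /enumf /u /=; case: (pickle_inv k).
rewrite !lq_normE// (uE l) (uE m).
apply: le_trans (@minkowski_EFin _ _ _ counting (u l) (u m) s _ _ s1) => //.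
apply: le_Lnorm => //; first by apply: enumf_ge0 => i; rewrite lee_fin normc_ge0.
move=> k; rewrite /enumf /u /=; case: (pickle_inv k) => [i|] /=; last by rewrite addr0.
by rewrite lee_fin le_normcD.
Qed.

Lemma lq_norm_dominated_cvg0 (l : nat -> I -> R[i]) (m : I -> R[i]) s : (0 < s)%R ->
  (forall k i, normc (l k i) <= normc (m i))%R ->
  (forall i, (fun k => (normc (l k i))%:E) @ \oo --> 0) ->
  lq_norm s%:E m < +oo -> (fun k => lq_norm s%:E (l k)) @ \oo --> 0.
Proof.
move=> s0 lm lc; rewrite lq_normE// => moo; under eq_fun do rewrite lq_normE//.
apply: Lnorm_dominated_cvg0 moo => //.
- by move=> k; apply: enumf_ge0 => i; rewrite lee_fin normc_ge0.
- by move=> k j; rewrite /enumf; case: (pickle_inv j) => //= i; rewrite lee_fin.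
- move=> j _; rewrite /enumf; case: (pickle_inv j) => [i|] /=; first exact: lc.
  exact: cvg_cst.
Qed.

End enumeration.

(** * Conjugate exponents *)

Section exponent_facts.
Context {R : realType}.
Implicit Types s : R.

Lemma hoelder_conjugate_EFin s : 1 < s ->
  hoelder_conjugate s%:E = (s / (s - 1))%:E.
Proof.
move=> s1; rewrite /hoelder_conjugate /= eqe gt_eqF ?(lt_trans _ s1)//.
by rewrite inver subr_eq0 gt_eqF// EFinM.
Qed.

Lemma conjugate_gt0 s : 1 < s -> 0 < s / (s - 1).
Proof. by move=> s1; rewrite divr_gt0 ?subr_gt0// (lt_trans _ s1). Qed.

Lemma conjugate_ge1 s : 1 < s -> 1 <= s / (s - 1).
Proof. by move=> s1; rewrite ler_pdivlMr ?subr_gt0// mul1r gerBl. Qed.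

Lemma conjugateV s : 1 < s -> s^-1 + (s / (s - 1))^-1 = 1.
Proof.
move=> s1; have s0 : s != 0 by rewrite gt_eqF// (lt_trans _ s1).
have s10 : s - 1 != 0 by rewrite subr_eq0 gt_eqF.
by field; rewrite s0 s10.
Qed.

Definition conjt n (p : n.-tuple R) : n.-tuple R :=
  [tuple of map (fun s => s / (s - 1)) p].

Lemma conj_exponentsE n (p : n.-tuple R) : all (fun s => 1 < s) p ->
  conj_exponents p = exponents (conjt p).
Proof.
move=> /allP p1; apply/val_inj => /=; rewrite -map_comp; apply/eq_in_map => s /p1 s1 /=.
exact: hoelder_conjugate_EFin.
Qed.

Lemma conjugate_conjt n (p : n.-tuple R) : all (fun s => 1 < s) p ->
  conjugate_exponents p (conjt p).
Proof.
rewrite /conjugate_exponents /=; elim: (tval p) => //= s l IHl /andP[s1 l1].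
by rewrite (lt_trans _ s1)//= conjugate_gt0//= conjugateV// eqxx IHl.
Qed.

End exponent_facts.

Definition dyadic0 n : dyadic_index n := (0, [tuple 0 | i < n]).

(** * Geometry of dyadic cubes *)

Section cubes.
Context {R : realType} {n : nat}.
Local Notation X := (Rn R n).
Local Notation mu := (@lebesgueRn R n).
Local Notation cube := (@dyadic_cube R n).
Implicit Types q : dyadic_index n.

Let side q : R := 2 ^ (- q.1).
Let edge q i : set (measurableTypeR R) :=
  [set` `[side q * (tnth q.2 i)%:~R, side q * ((tnth q.2 i)%:~R + 1)[].

Let cubeE q : cube q = [set x | forall i, edge q i (tnth x i)].
Proof.
apply/seteqP; split => x h i; have := h i; rewrite /edge /= in_itv/=.
  by case=> -> ->.
by move=> /andP[].
Qed.

Let side_gt0 q : 0 < side q.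
Proof. by rewrite /side exprz_gt0. Qed.

Lemma measurable_cube q : measurable (cube q).
Proof.
rewrite cubeE (_ : [set x : X | _] = \bigcap_(i in [set: 'I_n]) ((fun x => tnth x i) @^-1` edge q i)).
  apply: fin_bigcap_measurable => // i _.
  rewrite -[X in measurable X]setTI; apply: measurable_tnth => //.
  exact: measurable_itv.
by apply/seteqP; split => x h i; [move=> _; exact: h|exact: h].
Qed.

Lemma mu_cube q : exists2 v : R, 0 < v & mu (cube q) = v%:E.
Proof.
exists (\prod_(i < n) side q); first by apply: prodr_gt0 => i _; exact: side_gt0.
rewrite cubeE lebesgueRn_box; last by move=> i; exact: measurable_itv.
rewrite -prodEFin; apply: eq_bigr => i _.
have := lebesgue_measure_itv `[side q * (tnth q.2 i)%:~R, side q * ((tnth q.2 i)%:~R + 1)[ => /= ->.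
by rewrite lte_fin mulrDr mulr1 ltrDl side_gt0 -EFinB addrAC subrr add0r.
Qed.

Lemma cube_bounded q : exists K, cube q `<=` boxRn K.
Proof.
pose c i := `|side q * (tnth q.2 i)%:~R| + side q.
have c0 i : 0 <= c i by rewrite addr_ge0// ltW.
(* The sum of the coordinatewise bounds stands in for their maximum. *)
exists (\sum_(i < n) c i) => x; rewrite cubeE => h i.
apply: (@le_trans _ _ (c i)); last by rewrite (bigD1 i)//= lerDl sumr_ge0.
have := h i; rewrite /edge /= in_itv/= mulrDr mulr1 => /andP[h1 h2].
have [x0|x0] := ger0P (tnth x i).
  by apply: (le_trans (ltW h2)); rewrite lerD2r ler_norm.
apply: (@le_trans _ _ `|side q * (tnth q.2 i)%:~R|); last by rewrite lerDl ltW.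
by rewrite -(ltr0_norm x0) ltr0_norm// -[leRHS]normrN (le_trans _ (ler_norm _))// lerN2.
Qed.

Lemma cube_cover (x : X) : exists q, cube q x.
Proof.
exists (0, [tuple Num.floor (tnth x i : R) | i < n]) => i /=.
by rewrite oppr0 expr0z !mul1r tnth_mktuple floor_le_tmp; split=> //;
   have := floorD1_gt (tnth x i : R); rewrite intrD.
Qed.

End cubes.

Arguments dyadic0 {n}.

(** * Local norms and Hoelder's inequality over the cubes *)

Section blocks.
Context {R : realType} {n : nat}.
Variables (p : n.-tuple R) (t : R) (r : \bar R).
Hypothesis p1 : all (fun s => 1 < s) p.
Local Notation X := (Rn R n).
Local Notation mu := (@lebesgueRn R n).
Local Notation cube := (@dyadic_cube R n).
Implicit Types (f : X -> R[i]) (q : dyadic_index n).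

Definition vol_factor q : \bar R := (mu (cube q) `^ (t^-1 - n%:R^-1 * sum_inv p))%E.

(** The Morrey norm is the l^r norm of this family ([morrey_normE], [morrey_normyE]), and a block on
    the cube pairs with f by at most this amount ([block_pairing]). *)
Definition local_norm f q : \bar R :=
  (vol_factor q * Lp_norm (exponents p) (fun x => (f x * \1_(cube q) x)%R))%E.

Lemma vol_factorE q : exists2 v : R, 0 < v & vol_factor q = v%:E.
Proof.
have [v v0 vE] := mu_cube (R:=R) q; exists (v `^ (t^-1 - n%:R^-1 * sum_inv p)).
  exact: powR_gt0.
by rewrite /vol_factor vE.
Qed.

Lemma Lp_norm_ge0 (P : n.-tuple (\bar R)) f : (0 <= Lp_norm P f)%E.
Proof. exact: mixed_norm_ge0. Qed.

Lemma local_norm_ge0 f q : (0 <= local_norm f q)%E.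
Proof.
have [v v0 vE] := vol_factorE q.
by rewrite /local_norm vE mule_ge0 ?Lp_norm_ge0// lee_fin ltW.
Qed.

Lemma morrey_normE (rho : R) f : 0 < rho ->
  morrey_norm p t rho%:E f = Lnorm counting rho%:E (enumf (local_norm f)).
Proof.
move=> rho0; rewrite -esum_poweR//; last exact: local_norm_ge0.
congr (_ `^ _)%E; apply: eq_esum => q _.
have [v v0 vE] := vol_factorE q.
rewrite /local_norm poweRM ?Lp_norm_ge0//; last by rewrite vE lee_fin ltW.
congr (_ * _)%E; rewrite /vol_factor -poweRrM; congr (_ `^ _)%E.
by ring.
Qed.

Lemma morrey_normyE f : morrey_norm p t +oo f = ereal_sup (range (local_norm f)).
Proof. by []. Qed.

Lemma morrey_norm_ge0 f : (0 <= morrey_norm p t r f)%E.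
Proof.
have key q : (0 <= local_norm f q)%E := local_norm_ge0 f q.
case: r => [rho| |]; first exact: poweR_ge0.
  by apply: le_trans (key dyadic0) _; apply: ereal_sup_ubound; exists dyadic0.
by apply: le_trans (key dyadic0) _; apply: ereal_sup_ubound; exists dyadic0.
Qed.

Hypothesis hr : r = +oo%E \/ exists2 rho : R, 1 < rho & r = rho%:E.

Lemma conj_rE : exists2 s : R, 1 <= s & hoelder_conjugate r = s%:E.
Proof.
case: hr => [->|[rho rho1 ->]]; first by exists 1; rewrite // hoelder_conjugatey.
exists (rho / (rho - 1)); [exact: conjugate_ge1|exact: hoelder_conjugate_EFin].
Qed.

(** For r = +oo the conjugate exponent is 1 and the supremum factors out; for finite r this is
    [ge0_hoelder] for the counting measure. *)
Lemma sum_hoelder (l : dyadic_index n -> R[i]) f :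
  (\esum_(q in [set: dyadic_index n]) ((normc (l q))%:E * local_norm f q)
    <= lq_norm (hoelder_conjugate r) l * morrey_norm p t r f)%E.
Proof.
have l0 q : (0 <= (normc (l q))%:E)%E by rewrite lee_fin normc_ge0.
have mf0 := local_norm_ge0 f.
rewrite esum_enumf; last by move=> q; exact: mule_ge0.
rewrite (eq_integral (fun k => enumf (fun q => (normc (l q))%:E) k * enumf (local_norm f) k)%E); last first.
  by move=> k _; rewrite /enumf; case: (pickle_inv k) => //=; rewrite mule0.
have el0 := enumf_ge0 l0; have em0 := enumf_ge0 mf0.
case: hr => [->|[rho rho1 ->]].
  rewrite hoelder_conjugatey lq_normE// ge0_LnormE// invr1 poweRe1; last first.
    by apply: integral_ge0 => k _; exact: poweR_ge0.
  rewrite muleC -ge0_integralZl//; last 2 first.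
  - by move=> k _; exact: poweR_ge0.
  - by apply: le_trans (mf0 dyadic0) _; apply: ereal_sup_ubound; exists dyadic0.
  apply: ge0_le_integral => //.
  - by move=> k _; exact: mule_ge0.
  - move=> k _; rewrite poweRe1// muleC lee_wpmul2r//.
    rewrite /enumf; case: (pickle_inv k) => [q|] /=.
      by apply: ereal_sup_ubound; exists q.
    by apply: le_trans (mf0 dyadic0) _; apply: ereal_sup_ubound; exists dyadic0.
have rho0 : 0 < rho by exact: lt_trans rho1.
rewrite hoelder_conjugate_EFin// lq_normE ?conjugate_gt0// morrey_normE//.
apply: ge0_hoelder => //; first exact: conjugate_gt0.
by rewrite addrC conjugateV.
Qed.

End blocks.

(** * Block spaces *)

Section partial_sums.
Context {R : realType} {I : choiceType}.
Implicit Types (a b : I -> R[i]).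

Lemma partial_sumE a (A : {fset I}) : partial_sum a A = \sum_(i <- A) a i.
Proof. by rewrite /partial_sum big_seq_fsetE. Qed.

Lemma partial_sum_cvgP a z :
  partial_sum a @ totally --> (z : R[i]^o) <->
  forall e : R, 0 < e -> exists A0 : {fset I}, forall A : {fset I},
    (A0 `<=` A)%fset -> normc (z - \sum_(i <- A) a i) < e.
Proof.
split=> [/cvg_normcP h e e0|h].
  have [A0 _ A0h] := h (@filter_filter _ _ (@totally_filter I)) e e0; exists A0 => A A0A.
  by rewrite -partial_sumE; exact: A0h.
apply/(@cvg_normcP _ _ _ (@filter_filter _ _ (@totally_filter I))) => e e0; have [A0 A0h] := h e e0.
by exists A0 => // A /= A0A; rewrite partial_sumE; exact: A0h.
Qed.

Lemma partial_sum_cvg_lincomb a b z w c :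
  partial_sum a @ totally --> (z : R[i]^o) ->
  partial_sum b @ totally --> (w : R[i]^o) ->
  partial_sum (fun i => c * a i + b i) @ totally --> (c * z + w : R[i]^o).
Proof.
move=> /partial_sum_cvgP az /partial_sum_cvgP bw; apply/partial_sum_cvgP => e e0.
have c0 := normc_ge0 c.
(* Adding 1 keeps the divisor positive when c = 0. *)
have [A1 A1h] := az (e / 2 / (1 + normc c)) ltac:(by rewrite !divr_gt0// ltr_pwDl).
have [A2 A2h] := bw (e / 2) ltac:(by rewrite divr_gt0).
exists (A1 `|` A2)%fset => A; rewrite fsubUset => /andP[/A1h h1 /A2h h2].
rewrite big_split -mulr_sumr /=.
set S1 := \sum_(i <- A) a i in h1 *; set S2 := \sum_(i <- A) b i in h2 *.
rewrite (_ : _ - _ = c * (z - S1) + (w - S2)); last by ring.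
apply: (le_lt_trans (le_normcD _ _)); rewrite Normc.normcM [ltRHS](splitr e).
apply: ler_ltD => //.
have c1 : normc c / (1 + normc c) <= 1.
  by rewrite ler_pdivrMr ?ltr_pwDl// mul1r lerDr.
rewrite (le_trans (ler_wpM2l c0 (ltW h1)))// mulrCA ler_piMr//.
by rewrite divr_ge0// ltW.
Qed.

Lemma partial_sum_cvg_finite a (F : {fset I}) : (forall i, i \notin F -> a i = 0) ->
  partial_sum a @ totally --> (\sum_(i <- F) a i : R[i]^o).
Proof.
move=> aF; apply/partial_sum_cvgP => e e0; exists F => A FA.
rewrite (big_fset_incl _ FA) ?subrr ?Normc.normc0// => i _ iF.
exact: aF.
Qed.

Lemma normc_sum (s : seq I) a : normc (\sum_(i <- s) a i) <= \sum_(i <- s) normc (a i).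
Proof.
elim: s => [|i s IHs]; first by rewrite !big_nil Normc.normc0.
by rewrite !big_cons (le_trans (le_normcD _ _))// lerD2l.
Qed.

Lemma partial_sum_le_esum a z : partial_sum a @ totally --> (z : R[i]^o) ->
  ((normc z)%:E <= \esum_(i in [set: I]) (normc (a i))%:E)%E.
Proof.
move=> /partial_sum_cvgP az; apply/lee_addgt0Pr => e e0.
have [A0 /(_ A0 (fsubset_refl _)) h] := az e e0.
apply: (@le_trans _ _ ((\sum_(i <- A0) normc (a i))%:E + e%:E)%E).
  rewrite -EFinD lee_fin -[z](subrK (\sum_(i <- A0) a i)) addrC.
  by rewrite (le_trans (le_normcD _ _))// lerD ?normc_sum// ltW.
rewrite leeD2r//; apply: esum_ge; exists [set` A0]; first by split.
by rewrite -sumEFin fsbig_finite//= set_fsetK.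
Qed.

(** Finite sums of a nonnegative summable family increase along the net and come arbitrarily close
    to their supremum. The factor z will be the value u(x) that multiplies the weight series at a
    point x. *)
Lemma partial_sum_cvg_ge0 (a : I -> R) z : (forall i, 0 <= a i) ->
  (\esum_(i in [set: I]) (a i)%:E < +oo)%E ->
  partial_sum (fun i => (a i)%:C%C * z) @ totally -->
    ((fine (\esum_(i in [set: I]) (a i)%:E))%:C%C * z : R[i]^o).
Proof.
move=> a0 aoo; set S := esum _ _.
have S0 : (0 <= S)%E by apply: esum_ge0 => i _; rewrite lee_fin.
have Sfin : S \is a fin_num by rewrite ge0_fin_numE.
apply/partial_sum_cvgP => e e0.
have d0 : 0 < e / (1 + normc z) by rewrite divr_gt0// ltr_pwDl// normc_ge0.
have [_ [X [finX _] <-] SX] := ub_ereal_sup_adherent d0 Sfin.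
exists (fset_set X) => A XA.
have sub : (\sum_(i <- A) a i)%:E = (\sum_(i \in [set` A]) (a i)%:E)%E.
  by rewrite -sumEFin fsbig_finite//= set_fsetK.
have AS : \sum_(i <- A) a i <= fine S.
  rewrite -lee_fin fineK// sub; apply: esum_ge; exists [set` A] => //; by split.
have SA : fine S - e / (1 + normc z) < \sum_(i <- A) a i.
  rewrite -lte_fin EFinB fineK//; apply: (lt_le_trans SX); rewrite sub.
  apply: lee_fsum_nneg_subset => //.
    by move=> i /set_mem Xi; apply/mem_set; apply: (fsubsetP XA); rewrite in_fset_set//; apply/mem_set.
  by move=> i _; rewrite lee_fin.
rewrite (_ : _ - _ = (fine S - \sum_(i <- A) a i)%:C%C * z); last first.
  by rewrite -mulr_suml -mulrBl rmorphB rmorph_sum.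
rewrite Normc.normcM normcR.
rewrite ger0_norm ?subr_ge0//.
have z1 : 0 < 1 + normc z by rewrite ltr_pwDl// normc_ge0.
rewrite (@le_lt_trans _ _ ((fine S - \sum_(i <- A) a i) * (1 + normc z)))//.
  by rewrite ler_wpM2l ?subr_ge0// lerDr.
by rewrite -ltr_pdivlMr// ltrBlDl -ltrBlDr.
Qed.

End partial_sums.

(** * The block norm and the pairing with the Morrey space *)

Section block_space.
Context {R : realType} {n : nat}.
Variables (p : n.-tuple R) (t : R) (r : \bar R).
Hypothesis p1 : all (fun s => 1 < s) p.
Hypothesis hr : r = +oo%E \/ exists2 rho : R, 1 < rho & r = rho%:E.
Local Notation X := (Rn R n).
Local Notation mu := (@lebesgueRn R n).
Local Notation cube := (@dyadic_cube R n).
Local Notation lq := (@lq_norm R (dyadic_index n) (hoelder_conjugate r)).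
Local Notation BN := (block_norm p t r).
Local Notation BS := (block_space p t r).
Local Notation MN P f := (mixed_norm (exponents P) f).
Implicit Types (f g h : X -> R[i]) (q : dyadic_index n).

Let cpp : conjugate_exponents p (conjt p) := conjugate_conjt p1.
Let cpp' := conjugate_exponents_sym cpp.
Let q0 := conjugate_exponents_gt0 cpp'.
Let p0 := conjugate_exponents_gt0 cpp.

Lemma Lp_conjE f : Lp_norm (conj_exponents p) f = MN (conjt p) (fun x => (normc (f x))%:E).
Proof. by rewrite conj_exponentsE. Qed.

Lemma le_Lp_conj f g : cmeasurable f -> cmeasurable g ->
  (forall x, normc (f x) <= normc (g x)) ->
  (Lp_norm (conj_exponents p) f <= Lp_norm (conj_exponents p) g)%E.
Proof.
move=> mf mg fg; rewrite !Lp_conjE; apply: le_mixed_norm => //; try exact: measurable_EFin_normc.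
by move=> x; rewrite lee_fin normc_ge0.
Qed.

Lemma Lp_conjZ z f : cmeasurable f ->
  Lp_norm (conj_exponents p) (fun x => z * f x) =
  ((normc z)%:E * Lp_norm (conj_exponents p) f)%E.
Proof.
move=> mf; rewrite !Lp_conjE -mixed_normZ ?normc_ge0//; last 2 first.
- exact: measurable_EFin_normc.
- by move=> x; rewrite lee_fin normc_ge0.
by congr mixed_norm; apply/funext => x; rewrite Normc.normcM EFinM.
Qed.

Lemma Lp_conjD f g : cmeasurable f -> cmeasurable g ->
  (Lp_norm (conj_exponents p) (fun x => f x + g x)%R <=
   Lp_norm (conj_exponents p) f + Lp_norm (conj_exponents p) g)%E.
Proof.
move=> mf mg; rewrite !Lp_conjE.
apply: le_trans (mixed_normD cpp' (measurable_EFin_normc mf) (measurable_EFin_normc mg) _ _).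
- apply: le_mixed_norm => //.
  + by apply: measurable_EFin_normc; exact: cmeasurableD.
  + by apply: emeasurable_funD; exact: measurable_EFin_normc.
  + by move=> x; rewrite lee_fin normc_ge0.
  + by move=> x; rewrite -EFinD lee_fin le_normcD.
- by move=> x; rewrite lee_fin normc_ge0.
- by move=> x; rewrite lee_fin normc_ge0.
Qed.

(** Blocks on a fixed cube form an absolutely convex set, by the triangle inequality for mixed
    norms. Subadditivity of the block norm comes from this. *)
Lemma is_block_comb q (b c : X -> R[i]) z w : is_block p t (cube q) b -> is_block p t (cube q) c ->
  normc z + normc w <= 1 -> is_block p t (cube q) (fun x => z * b x + w * c x).
Proof.
move=> [mb b0 bV] [mc c0 cV] zw; have mzb := cmeasurableM (cmeasurable_cst z) mb.
have mwc := cmeasurableM (cmeasurable_cst w) mc.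
split; first exact: cmeasurableD.
  by move=> x nx; rewrite b0// c0// !mulr0 addr0.
apply: (le_trans (Lp_conjD mzb mwc)); rewrite !Lp_conjZ//.
have [v v0 vE] := vol_factorE p t q.
have vE' : (mu (cube q) `^ (t^-1 - n%:R^-1 * sum_inv p) = v%:E)%E := vE.
rewrite vE' in bV cV *.
apply: (@le_trans _ _ ((normc z)%:E * v%:E + (normc w)%:E * v%:E)%E).
  by apply: leeD; apply: lee_wpmul2l => //; rewrite lee_fin normc_ge0.
by rewrite -!EFinM -EFinD lee_fin -mulrDl ler_piMl// ltW.
Qed.

Lemma is_block0 q : is_block p t (cube q) (fun=> 0).
Proof.
split => //.
rewrite (_ : (fun=> 0) = fun x : X => 0 * (cst 0 x)); last by apply/funext => x; rewrite mul0r.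
rewrite Lp_conjZ; last exact: cmeasurable_cst.
by rewrite Normc.normc0 mul0e poweR_ge0.
Qed.

Lemma block_decomposition_comb z g h l m b c :
  block_decomposition p t r g l b -> block_decomposition p t r h m c ->
  exists k d, block_decomposition p t r (fun x => z * g x + h x) k d /\
    (lq k <= (normc z)%:E * lq l + lq m)%E.
Proof.
have [s s1 sE] := conj_rE hr; have s0 : 0 < s by exact: lt_le_trans s1.
move=> [lf bb gE] [mf cb hE].
(* The two blocks on each cube are merged into one. With this coefficient the factors z l / k and m
   / k have moduli adding up to 1, or are both 0 when k = 0, since 0^-1 = 0. *)
pose k q := normc z * normc (l q) + normc (m q).
have k0 q : 0 <= k q by rewrite addr_ge0 ?mulr_ge0 ?normc_ge0.
have kle : (lq (fun q => (k q)%:C%C) <= (normc z)%:E * lq l + lq m)%E.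
  rewrite sE -lq_normZ//.
  pose l' q := (normc (z * l q))%:C%C : R[i]; pose m' q := (normc (m q))%:C%C : R[i].
  have := @lq_normD R _ l' m' s s1.
  have -> : (fun q => l' q + m' q) = (fun q => (k q)%:C%C).
    by apply/funext => q; rewrite /l' /m' /k -rmorphD /= Normc.normcM.
  move=> /le_trans; apply; apply: leeD; apply: le_lq_norm => // q.
    by rewrite normcR ger0_norm ?normc_ge0.
  by rewrite normcR ger0_norm ?normc_ge0.
exists (fun q => (k q)%:C%C), (fun q x => (z * l q / (k q)%:C%C) * b q x + (m q / (k q)%:C%C) * c q x).
split; last exact: kle.
split.
- apply: (le_lt_trans kle); rewrite lte_add_pinfty// lte_mul_pinfty// ?lee_fin ?normc_ge0//.
- move=> q; apply: is_block_comb => //.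
  have [k00|kn0] := eqVneq (k q) 0.
    by rewrite k00 invr0 !mulr0 Normc.normc0 addr0.
  rewrite !Normc.normcM !Normc.normcV normcR ger0_norm// -mulrDl divff//.
- move: gE hE; apply: filterS2 => x gx hx.
  have := partial_sum_cvg_lincomb (c := z) gx hx.
  apply: cvg_trans; rewrite (_ : (fun q => _ * (_ + _)) = (fun q => z * (l q * b q x) + m q * c q x))//.
  apply/funext => q; have [k00|kn0] := eqVneq (k q) 0.
    have : normc z * normc (l q) == 0 /\ normc (m q) == 0.
      by move/eqP: k00; rewrite /k paddr_eq0 ?mulr_ge0 ?normc_ge0// => /andP[].
    rewrite -Normc.normcM !normc_eq0 => -[/eqP zl /eqP ->].
    by rewrite mulrA zl k00 !mul0r addr0.
  have kn : (k q)%:C%C != 0 :> R[i] by rewrite -(rmorph0 (real_complex R)) (inj_eq (@complexI R)).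
  by move: kn; set K := (_)%:C%C => kn; field.
Qed.

Lemma lq_ge0 l : (0 <= lq l)%E.
Proof. by have [s s1 sE] := conj_rE hr; rewrite sE lq_norm_ge0// (lt_le_trans _ s1). Qed.

Lemma BN_ge0 g : (0 <= BN g)%E.
Proof. by apply: le_ereal_inf_tmp => _ [l _ <-]; exact: lq_ge0. Qed.

Lemma BN_le g l b : block_decomposition p t r g l b -> (BN g <= lq l)%E.
Proof. by move=> d; apply: ereal_inf_lbound; exists l => //; exists b. Qed.

Lemma BN_fin g : BS g -> BN g \is a fin_num.
Proof.
move=> [_ [l [b d]]]; rewrite ge0_fin_numE ?BN_ge0//.
by apply: (le_lt_trans (BN_le d)); case: d.
Qed.

Lemma BN_adherent g e : BS g -> 0 < e -> exists l b,
  block_decomposition p t r g l b /\ (lq l < BN g + e%:E)%E.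
Proof.
move=> gB e0; have [_ [l [b d] <-] le] := lb_ereal_inf_adherent e0 (BN_fin gB).
by exists l, b.
Qed.

Lemma BS_comb z g h : BS g -> BS h -> BS (fun x => z * g x + h x).
Proof.
move=> [mg [l [b gd]]] [mh [m [c hd]]]; split.
  by apply: cmeasurableD => //; apply: cmeasurableM => //; exact: cmeasurable_cst.
by have [k [d [kd _]]] := block_decomposition_comb z gd hd; exists k, d.
Qed.

Lemma BN_comb z g h : BS g -> BS h ->
  (BN (fun x => z * g x + h x)%R <= (normc z)%:E * BN g + BN h)%E.
Proof.
move=> gB hB; apply/lee_addgt0Pr => e e0.
have z1 : 0 < 1 + normc z by rewrite ltr_pwDl ?normc_ge0.
have e1 : 0 < e / 2 / (1 + normc z) by rewrite !divr_gt0.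
have [l [b [gd le]]] := BN_adherent gB e1.
have [m [c [hd me]]] := BN_adherent hB (divr_gt0 e0 (ltr0n _ 2)).
have [k [d [kd kle]]] := block_decomposition_comb z gd hd.
apply: (le_trans (BN_le kd)); apply: (le_trans kle).
apply: (@le_trans _ _ ((normc z)%:E * (BN g + (e / 2 / (1 + normc z))%:E) + (BN h + (e / 2)%:E))%E).
  by apply: leeD; [apply: lee_wpmul2l; [rewrite lee_fin normc_ge0|exact: ltW]|exact: ltW].
rewrite -(fineK (BN_fin gB)) -(fineK (BN_fin hB)) -!(EFinD, EFinM) lee_fin.
rewrite mulrDr -addrA -[leRHS]addrA lerD2l addrCA lerD2l [leRHS](splitr e) lerD2r.
have c1 : normc z / (1 + normc z) <= 1 by rewrite ler_pdivrMr// mul1r lerDr.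
by rewrite mulrCA ler_piMr// divr_ge0// ltW.
Qed.

Lemma BS0 : BS (fun=> 0).
Proof.
have [s s1 sE] := conj_rE hr; have s0 : 0 < s by exact: lt_le_trans s1.
split; first exact: cmeasurable_cst.
exists (fun=> 0), (fun _ _ => 0); split => [|q|].
- rewrite sE (_ : (fun=> 0) = (fun q => 0 * 0)); last by apply/funext => q; rewrite mulr0.
  by rewrite lq_normZ// Normc.normc0 mul0e.
- exact: is_block0.
apply/nearW => x; under eq_fun do rewrite mulr0.
have := @partial_sum_cvg_finite R (dyadic_index n) (fun=> 0) fset0 (fun=> fun=> erefl).
by rewrite big_seq_fset0.
Qed.

(** A decomposition need converge only almost everywhere, so zero coefficients decompose g. Every
    bounded functional is thereby compatible with equality almost everywhere. *)
Lemma BN_ae0 g : cmeasurable g -> {ae mu, forall x, g x = 0} -> BS g /\ BN g = 0%E.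
Proof.
move=> mg g0; have [s s1 sE] := conj_rE hr; have s0 : 0 < s by exact: lt_le_trans s1.
have l0 : lq (fun _ : dyadic_index n => 0) = 0%E.
  rewrite sE (_ : (fun=> 0) = (fun q => 0 * 0)); last by apply/funext => q; rewrite mulr0.
  by rewrite lq_normZ// Normc.normc0 mul0e.
have d : block_decomposition p t r g (fun=> 0) (fun _ _ => 0).
  split => [|q|]; [by rewrite l0|exact: is_block0|].
  move: g0; apply: filterS => x ->; under eq_fun do rewrite mulr0.
  have := @partial_sum_cvg_finite R (dyadic_index n) (fun=> 0) fset0 (fun=> fun=> erefl).
  by rewrite big_seq_fset0.
split; first by split => //; exists (fun=> 0), (fun _ _ => 0).
by apply/eqP; rewrite eq_le BN_ge0 andbT -l0; exact: BN_le d.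
Qed.

Lemma finite_lq (F : {fset dyadic_index n}) (l : dyadic_index n -> R[i]) s : 0 < s ->
  (forall q, q \notin F -> l q = 0) ->
  lq_norm s%:E l = ((\sum_(q <- F) normc (l q) `^ s) `^ s^-1)%:E.
Proof.
move=> s0 lF; rewrite /lq_norm -poweR_EFin -sumEFin; congr (_ `^ _)%E.
rewrite -[RHS](_ : \sum_(q \in [set` F]) ((normc (l q))%:E `^ s)%E = _)%E; last first.
  by rewrite fsbig_finite//= set_fsetK; apply: eq_bigr.
rewrite -esum_fset//; last by move=> i _; exact: poweR_ge0.
rewrite [RHS]esum_mkcond; apply: eq_esum => q _.
case: ifPn => // qF; rewrite lF ?Normc.normc0 ?poweR0r ?gt_eqF//.
by apply: contra qF => qF; apply/mem_set.
Qed.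

Lemma finite_block_sum (F : {fset dyadic_index n}) l b :
  (forall q, is_block p t (cube q) (b q)) -> (forall q, q \notin F -> l q = 0) ->
  BS (fun x => \sum_(q <- F) l q * b q x) /\
  (BN (fun x => \sum_(q <- F) l q * b q x)%R <= lq l)%E.
Proof.
move=> bb lF; have [s s1 sE] := conj_rE hr; have s0 : 0 < s by exact: lt_le_trans s1.
have d : block_decomposition p t r (fun x => \sum_(q <- F) l q * b q x) l b.
  split=> //; first by rewrite sE (finite_lq s0 lF) ltry.
  apply/nearW => x; apply: (@partial_sum_cvg_finite _ _ (fun q => l q * b q x)).
  by move=> q qF; rewrite lF// mul0r.
split; last exact: BN_le d.
split; last by exists l, b.
apply: cmeasurable_sum => q; apply: cmeasurableM; first exact: cmeasurable_cst.
by case: (bb q).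
Qed.

Lemma single_block q (b : X -> R[i]) z : is_block p t (cube q) b ->
  BS (fun x => z * b x) /\ (BN (fun x => z * b x)%R <= (normc z)%:E)%E.
Proof.
move=> bb; have [s s1 sE] := conj_rE hr; have s0 : 0 < s by exact: lt_le_trans s1.
pose l q' := if q' == q then z else 0; pose b' q' x := if q' == q then b x else 0.
have [||] := @finite_block_sum [fset q]%fset l b'.
- by move=> q'; rewrite /b'; case: eqVneq => [->|_] //; exact: is_block0.
- by move=> q'; rewrite inE /l => /negbTE ->.
have -> : (fun x => \sum_(q' <- [fset q]%fset) l q' * b' q' x) = (fun x => z * b x).
  by apply/funext => x; rewrite big_seq_fset1 /l /b' eqxx.
move=> lB /le_trans lN; split => //; apply: lN.
rewrite sE (finite_lq (F := [fset q]%fset) s0); last first.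
  by move=> q'; rewrite inE /l => /negbTE ->.
by rewrite big_seq_fset1 /l eqxx -powRrM divff ?gt_eqF// powRr1 ?normc_ge0.
Qed.

Lemma block_pairing q (b : X -> R[i]) f : cmeasurable f -> is_block p t (cube q) b ->
  (\int[mu]_x (normc (b x * f x))%:E <= local_norm p t f q)%E.
Proof.
move=> mf [mb b0 bV].
have mfq : cmeasurable (fun x => f x * \1_(cube q) x).
  by apply: cmeasurableM => //; apply: cmeasurable_indic; exact: measurable_cube.
rewrite (eq_integral (fun x => (normc (b x))%:E * (normc (f x * \1_(cube q) x))%:E)%E); last first.
  move=> x _; rewrite -EFinM -Normc.normcM indicE.
  have [xq|/negP xq] := boolP (x \in cube q); first by rewrite mulr1.
  by rewrite b0 ?mul0r// => /mem_set.
apply: (le_trans (@mixed_hoelder _ _ (conjt p) p _ _ cpp' (measurable_EFin_normc mb)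
  (measurable_EFin_normc mfq) _ _)).
- by move=> x; rewrite lee_fin normc_ge0.
- by move=> x; rewrite lee_fin normc_ge0.
by apply: lee_wpmul2r; [exact: mixed_norm_ge0|rewrite -Lp_conjE].
Qed.

(** Only the nonnegative majorant, the sum of the |l b f|, is integrated term by term, so Tonelli's
    theorem is enough. *)
Lemma decomposition_pairing f g l b : cmeasurable f -> cmeasurable g ->
  block_decomposition p t r g l b ->
  (\int[mu]_x (normc (g x * f x))%:E <= lq l * morrey_norm p t r f)%E.
Proof.
move=> mf mg [lf bb gE].
have mb q : cmeasurable (b q) by case: (bb q).
have mlbf q : cmeasurable (fun x => l q * b q x * f x).
  by apply: cmeasurableM => //; apply: cmeasurableM => //; exact: cmeasurable_cst.
pose e k x := enumf (fun q => (normc (l q * b q x * f x))%:E) k.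
have me k : measurable_fun setT (e k).
  rewrite /e /enumf; case: (pickle_inv k) => [q|] /=; last exact: measurable_cst.
  exact: measurable_EFin_normc.
have e0 k x : (0 <= e k x)%E by apply: enumf_ge0 => q; rewrite lee_fin normc_ge0.
apply: (@le_trans _ _ (\int[mu]_x (\sum_(k <oo) e k x))%E).
  apply: ae_ge0_le_integral => //.
  - by move=> x _; rewrite lee_fin normc_ge0.
  - by apply: measurable_EFin_normc; exact: cmeasurableM.
  - by move=> x _; apply: nneseries_ge0.
  - by apply: ge0_emeasurable_sum => // k x _ _; exact: e0.
  move: gE; apply: filterS => x gx _.
  rewrite /e -esum_enumf_series; last by move=> q; rewrite lee_fin normc_ge0.
  (* The series for g(x) is multiplied by f(x) through a linear combination with the zero family. *)
  have := partial_sum_cvg_lincomb (c := f x) gx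
    (@partial_sum_cvg_finite R (dyadic_index n) (fun=> 0) fset0 (fun=> fun=> erefl)).
  move=> /partial_sum_le_esum; rewrite big_seq_fset0 addr0 mulrC.
  move=> /le_trans; apply; apply: le_esum => q _.
  by rewrite addr0 mulrC.
rewrite integral_nneseries//.
apply: le_trans (@sum_hoelder _ _ p t _ hr l f).
rewrite esum_enumf_series; last first.
  by move=> q; rewrite mule_ge0 ?local_norm_ge0// lee_fin normc_ge0.
apply: lee_nneseries; first by move=> *; exact: integral_ge0.
move=> k *.
rewrite /e /enumf; case: (pickle_inv k) => [q|] /=; last by rewrite integral0.
under eq_integral do rewrite -mulrA Normc.normcM EFinM.
rewrite ge0_integralZl//.
- by apply: lee_wpmul2l; [rewrite lee_fin normc_ge0|exact: block_pairing].
- by apply: measurable_EFin_normc; exact: cmeasurableM.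
- by move=> x _; rewrite lee_fin normc_ge0.
- by rewrite lee_fin normc_ge0.
Qed.

Lemma BN_pairing f g : morrey_space p t r f -> BS g ->
  (\int[mu]_x (normc (g x * f x))%:E <= BN g * morrey_norm p t r f)%E.
Proof.
move=> [mf foo] gB; have [mg _] := gB.
have f0 := morrey_norm_ge0 p t r f.
have ffin : morrey_norm p t r f \is a fin_num by rewrite ge0_fin_numE.
rewrite -(fineK ffin); set M := fine _; have M0 : 0 <= M by exact: fine_ge0.
apply/lee_addgt0Pr => e e0.
have e1 : 0 < e / (1 + M) by rewrite divr_gt0// ltr_pwDl.
have [l [b [gd le]]] := BN_adherent gB e1.
apply: (le_trans (decomposition_pairing mf mg gd)); rewrite -(fineK ffin) -/M.
apply: (@le_trans _ _ ((BN g + (e / (1 + M))%:E) * M%:E)%E).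
  by apply: lee_wpmul2r; [rewrite lee_fin|exact: ltW].
rewrite -(fineK (BN_fin gB)) -!(EFinD, EFinM) lee_fin mulrDl lerD2l.
rewrite mulrAC ler_pdivrMr ?ltr_pwDl// ler_pM2l//.
by rewrite lerDr.
Qed.

Lemma pairing_integrable f g : morrey_space p t r f -> BS g ->
  cintegrable (fun x => g x * f x).
Proof.
move=> fM gB; have [mf foo] := fM; have [mg _] := gB.
apply/cintegrableP; first exact: cmeasurableM.
apply: (le_lt_trans (BN_pairing fM gB)).
by rewrite lte_mul_pinfty ?BN_ge0 ?BN_fin.
Qed.

Lemma pairing_linear f : morrey_space p t r f -> linear_on_block_space p t r (pairing f).
Proof.
move=> fM z g h gB hB; rewrite /pairing.
have ig := pairing_integrable fM gB; have ih := pairing_integrable fM hB.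
rewrite -cintegralZ// -cintegralD//; last exact: cintegrableZ.
by congr cintegral; apply/funext => x; rewrite mulrDl mulrA.
Qed.

Lemma pairing_le f g : morrey_space p t r f -> BS g ->
  ((normc (pairing f g))%:E <= BN g * morrey_norm p t r f)%E.
Proof.
move=> fM gB; apply: le_trans (BN_pairing fM gB).
apply: le_normc_cintegral; last exact: pairing_integrable.
by apply: cmeasurableM; [case: gB|case: fM].
Qed.

Lemma pairing_bounded f : morrey_space p t r f -> bounded_on_block_space p t r (pairing f).
Proof.
move=> fM; exists (fine (morrey_norm p t r f)) => g gB.
rewrite fineK; first by rewrite muleC; exact: pairing_le.
by rewrite ge0_fin_numE ?morrey_norm_ge0//; case: fM.
Qed.

End block_space.

(** * Functionals on the block space *)

Section real_radon_nikodym.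
Context d (T : measurableType d) (R : realType).
Variables (mu : {sigma_finite_measure set T -> \bar R}) (nu : set T -> R).
Hypothesis nu0 : nu set0 = 0.
Hypothesis nuS : semi_sigma_additive (fun A => (nu A)%:E).
Hypothesis nuac : forall A, measurable A -> mu A = 0%E -> nu A = 0.

Definition real_charge (A : set T) : \bar R := (nu A)%:E.

Let real_charge0 : real_charge set0 = 0%E. Proof. by rewrite /real_charge nu0. Qed.
Let real_charge_fin A : measurable A -> real_charge A \is a fin_num.
Proof. by []. Qed.
Let real_chargeS : semi_sigma_additive real_charge. Proof. exact: nuS. Qed.

HB.instance Definition _ := isCharge.Build _ _ _ real_charge
  real_charge0 real_charge_fin real_chargeS.

Lemma real_radon_nikodym : exists h : T -> R,
  mu.-integrable setT (EFin \o h) /\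
  forall A, measurable A -> (nu A)%:E = (\int[mu]_x (h x * \1_A x)%:E)%E.
Proof.
have ac : real_charge `<< mu.
  by apply/null_content_dominatesP => A mA muA; rewrite /real_charge nuac.
pose h := Radon_Nikodym real_charge mu.
have hfin x : h x \is a fin_num by exact: Radon_Nikodym_fin_num.
have ih : mu.-integrable setT h by exact: Radon_Nikodym_integrable.
have hE : EFin \o (fun x => fine (h x)) = h by apply/funext => x /=; rewrite fineK.
exists (fun x => fine (h x)); rewrite hE; split=> // A mA.
have -> : (nu A)%:E = real_charge A by [].
rewrite (Radon_Nikodym_integral ac mA) integral_mkcond; apply: eq_integral => x _.
rewrite -/h /patch indicE EFinM fineK//.
by case: (x \in A); rewrite ?mule1 ?mule0.
Qed.

End real_radon_nikodym.

(** * Bounded functionals and the weight *)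

Section functional.
Context {R : realType} {n : nat}.
Variables (p : n.-tuple R) (t : R) (r : \bar R).
Hypothesis p1 : all (fun s => 1 < s) p.
Hypothesis hr : r = +oo%E \/ exists2 rho : R, 1 < rho & r = rho%:E.
Local Notation X := (Rn R n).
Local Notation mu := (@lebesgueRn R n).
Local Notation cube := (@dyadic_cube R n).
Local Notation lq := (@lq_norm R (dyadic_index n) (hoelder_conjugate r)).
Local Notation BN := (block_norm p t r).
Local Notation BS := (block_space p t r).
Local Notation Lc := (Lp_norm (conj_exponents p)).
Implicit Types (g h u : X -> R[i]) (q : dyadic_index n) (L : (X -> R[i]) -> R[i]).

Lemma functional0 L : linear_on_block_space p t r L -> L (fun=> 0) = 0.
Proof.
move=> Ll; have := Ll 1 _ _ (BS0 t p1 hr) (BS0 t p1 hr).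
rewrite (_ : (fun _ => _) = (fun=> 0)); last by apply/funext => x; rewrite mulr0 addr0.
by rewrite mul1r => /eqP; rewrite -{1}[L _]addr0 (inj_eq (addrI _)) eq_sym => /eqP.
Qed.

Lemma functionalZ L z g : linear_on_block_space p t r L -> BS g ->
  L (fun x => z * g x) = z * L g.
Proof.
move=> Ll gB; have := Ll z _ _ gB (BS0 t p1 hr).
rewrite functional0// addr0 => <-; congr L.
by apply/funext => x; rewrite addr0.
Qed.

Lemma functionalD L g h : linear_on_block_space p t r L -> BS g -> BS h ->
  L (fun x => g x + h x) = L g + L h.
Proof.
move=> Ll gB hB; have := Ll 1 _ _ gB hB; rewrite mul1r => <-; congr L.
by apply/funext => x; rewrite mul1r.
Qed.

Lemma functionalB L g h : linear_on_block_space p t r L -> BS g -> BS h ->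
  L (fun x => g x - h x) = L g - L h.
Proof.
move=> Ll gB hB; have := Ll (-1) _ _ hB gB; rewrite mulN1r addrC => <-; congr L.
by apply/funext => x; rewrite mulN1r addrC.
Qed.

Lemma BSZ z g : BS g -> BS (fun x => z * g x).
Proof.
move=> gB; have := BS_comb p1 hr z gB (BS0 t p1 hr).
by rewrite (_ : (fun x => z * g x + 0) = (fun x => z * g x))//; apply/funext => x; rewrite addr0.
Qed.

Lemma BSD g h : BS g -> BS h -> BS (fun x => g x + h x).
Proof.
move=> gB hB; have := BS_comb p1 hr 1 gB hB.
by rewrite (_ : (fun x => 1 * g x + h x) = (fun x => g x + h x))//; apply/funext => x; rewrite mul1r.
Qed.

Lemma BSB g h : BS g -> BS h -> BS (fun x => g x - h x).
Proof.
move=> gB hB; have := BS_comb p1 hr (-1) hB gB.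
rewrite (_ : (fun x => -1 * h x + g x) = (fun x => g x - h x))//.
by apply/funext => x; rewrite mulN1r addrC.
Qed.

Lemma BS_sum (I : Type) (s : seq I) (F : I -> X -> R[i]) : (forall i, BS (F i)) ->
  BS (fun x => \sum_(i <- s) F i x).
Proof.
move=> FB; elim: s => [|i s IHs].
  rewrite (_ : (fun x => \sum_(j <- [::]) F j x) = fun=> 0); first exact: (BS0 t p1 hr).
  by apply/funext => x; rewrite big_nil.
rewrite (_ : (fun x => \sum_(j <- i :: s) F j x) = fun x => F i x + \sum_(j <- s) F j x).
  exact: (BSD (FB i) IHs).
by apply/funext => x; rewrite big_cons.
Qed.

Lemma functional_sum L (I : Type) (s : seq I) (F : I -> X -> R[i]) :
  linear_on_block_space p t r L -> (forall i, BS (F i)) ->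
  L (fun x => \sum_(i <- s) F i x) = \sum_(i <- s) L (F i).
Proof.
move=> Ll FB; elim: s => [|i s IHs].
  rewrite big_nil -[RHS](functional0 Ll); congr L.
  by apply/funext => x; rewrite big_nil.
rewrite big_cons -IHs -functionalD//; last exact: BS_sum.
by congr L; apply/funext => x; rewrite big_cons.
Qed.

(** [fine] loses nothing here, the block norm being finite on the block space ([BN_fin]). *)
Definition functional_le L (C : R) :=
  forall g, BS g -> normc (L g) <= C * fine (BN g).

Lemma BNZ z g : BS g -> (BN (fun x => z * g x)%R <= (normc z)%:E * BN g)%E.
Proof.
move=> gB; have := BN_comb p1 hr z gB (BS0 t p1 hr).
rewrite (_ : (fun x => z * g x + 0) = (fun x => z * g x)); last first.
  by apply/funext => x; rewrite addr0.
move=> /le_trans; apply.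
have [_ ->] := @BN_ae0 _ _ p t r p1 hr (fun=> 0) (cmeasurable_cst 0) (nearW _ (fun=> erefl)).
by rewrite adde0.
Qed.

Lemma continuous_functional_le L : linear_on_block_space p t r L ->
  continuous_on_block_space p t r L -> exists2 C, 0 < C & functional_le L C.
Proof.
move=> Ll Lc.
have [d d0 dL] := Lc _ (BS0 t p1 hr) 1 ltr01.
exists (2 / d); first by rewrite divr_gt0.
move=> g gB; set N := fine (BN g).
have N0 : 0 <= N by apply: fine_ge0; exact: BN_ge0.
(* The slack e' allows for g of block norm 0, which cannot be normalised; its value makes (2 / d) (N
   + e') equal to (2 / d) N + e. *)
apply/ler_addgt0Pr => e e0; set e' := e * d / 2.
have e'0 : 0 < e' by rewrite divr_gt0// mulr_gt0.
have Ne : 0 < N + e' by rewrite ltr_wpDl.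
pose c := d / 2 / (N + e'); have c0 : 0 < c by rewrite !divr_gt0.
have := dL (fun x => (c%:C%C) * g x) (BSZ _ gB).
rewrite (_ : (fun x => _ - 0) = (fun x => c%:C%C * g x)); last first.
  by apply/funext => x; rewrite subr0.
rewrite functional0// subr0 functionalZ// Normc.normcM normcR gtr0_norm// => H.
have {H} : c * normc (L g) < 1.
  apply: H; apply: (le_lt_trans (BNZ _ gB)).
  rewrite normcR gtr0_norm// -(fineK (BN_fin hr gB)) -EFinM lte_fin -/N.
  apply: (@lt_trans _ _ (c * (N + e'))); first by rewrite ltr_pM2l// ltrDl.
  by rewrite /c mulfVK ?gt_eqF// ltr_pdivrMr// ltr_pMr// ltr1n.
rewrite mulrC -ltr_pdivlMr// => /ltW /le_trans; apply.
rewrite (_ : 2 / d * N + e = 2 / d * (N + e')); last first.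
  by rewrite /e'; field; rewrite gt_eqF.
rewrite /c; move: (N + e') Ne => K K0.
by rewrite (_ : 1 / (d / 2 / K) = 2 / d * K)//; field; rewrite !gt_eqF.
Qed.

Definition cube_cut q u x : R[i] := \1_(cube q) x * u x.

Lemma cmeasurable_cut q u : cmeasurable u -> cmeasurable (cube_cut q u).
Proof.
by move=> mu'; apply: cmeasurableM => //; apply: cmeasurable_indic; exact: measurable_cube.
Qed.

Lemma normc_indic (A : set X) (x : X) : normc (\1_A x : R[i]) = \1_A x.
Proof. by rewrite !indicE; case: (_ \in _); rewrite ?Normc.normc0 ?Normc.normc1. Qed.

Lemma Lc_cut_lty q u M : cmeasurable u -> (forall x, normc (u x) <= M) ->
  (Lc (cube_cut q u) < +oo)%E.
Proof.
move=> mu' uM; rewrite (Lp_conjE p1); have [K qK] := cube_bounded (R:=R) q.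
have pp0 := conjugate_exponents_gt0 (conjugate_exponents_sym (conjugate_conjt p1)).
apply: (@mixed_norm_bounded_lty _ _ _ K M (fun x => normc (cube_cut q u x))) => //.
- by apply: measurable_normc; exact: cmeasurable_cut.
- by move=> x; exact: normc_ge0.
- move=> x; rewrite /cube_cut Normc.normcM normc_indic (le_trans _ (uM x))// ler_piMl ?normc_ge0//.
- move=> x; rewrite normc_eq0 /cube_cut indicE; have [/set_mem /qK//|_] := boolP (x \in cube q).
  by rewrite mul0r eqxx.
Qed.

Lemma Lc_cut_dominated_cvg0 q (u : nat -> X -> R[i]) v :
  (forall k, cmeasurable (u k)) -> cmeasurable v ->
  (forall k x, normc (u k x) <= normc (v x)) ->
  (forall x, (fun k => (normc (u k x))%:E) @ \oo --> 0%E) ->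
  (Lc (cube_cut q v) < +oo)%E ->
  (fun k => Lc (cube_cut q (u k))) @ \oo --> 0%E.
Proof.
move=> mu' mv uv uc; rewrite (Lp_conjE p1) => voo.
under eq_fun do rewrite (Lp_conjE p1).
have pp0 := conjugate_exponents_gt0 (conjugate_exponents_sym (conjugate_conjt p1)).
apply: mixed_norm_dominated_cvg0 voo => //.
- by move=> k; apply: measurable_EFin_normc; exact: cmeasurable_cut.
- by apply: measurable_EFin_normc; exact: cmeasurable_cut.
- by move=> k x; rewrite lee_fin normc_ge0.
- by move=> k x; rewrite lee_fin /cube_cut !Normc.normcM ler_wpM2l ?normc_ge0.
- move=> x _; rewrite /cube_cut indicE; case: (_ \in _).
    by under eq_fun do rewrite mul1r; exact: uc.
  by under eq_fun do rewrite mul0r Normc.normc0; exact: cvg_cst.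
Qed.

Definition vol q : R := fine (vol_factor p t q).

Lemma vol_gt0 q : 0 < vol q.
Proof. by have [v v0 vE] := vol_factorE p t q; rewrite /vol vE. Qed.

Lemma volE q : (mu (cube q) `^ (t^-1 - n%:R^-1 * sum_inv p))%E = (vol q)%:E.
Proof.
have [v v0 vE] := vol_factorE p t q; rewrite /vol vE.
exact: vE.
Qed.

Definition cube_norm q : R := fine (Lc (cube_cut q (fun=> 1))).

Lemma cube_normE q : Lc (cube_cut q (fun=> 1)) = (cube_norm q)%:E.
Proof.
rewrite fineK// ge0_fin_numE ?Lp_norm_ge0//.
apply: (@Lc_cut_lty _ _ 1); first exact: cmeasurable_cst.
by move=> x; rewrite Normc.normc1.
Qed.

Lemma cube_norm_ge0 q : 0 <= cube_norm q.
Proof. by apply: fine_ge0; exact: Lp_norm_ge0. Qed.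

(* The coefficient makes wcoef q 1_Q a block and keeps the weight at most 1. *)
Definition wcoef q : R := vol q / (1 + vol q + cube_norm q).

Lemma wcoef_gt0 q : 0 < wcoef q.
Proof.
by rewrite divr_gt0 ?vol_gt0// ltr_wpDr ?cube_norm_ge0// addr_gt0 ?vol_gt0.
Qed.

Lemma wcoef_le1 q : wcoef q <= 1.
Proof.
have v0 := vol_gt0 q; have c0 := cube_norm_ge0 q.
rewrite ler_pdivrMr ?mul1r; last by rewrite ltr_wpDr// addr_gt0.
by rewrite addrAC lerDr addr_ge0.
Qed.

Lemma wcoef_norm q : wcoef q * cube_norm q <= vol q.
Proof.
have v0 := vol_gt0 q; have c0 := cube_norm_ge0 q.
rewrite /wcoef mulrAC ler_pdivrMr; last by rewrite ltr_wpDr// addr_gt0.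
by rewrite ler_pM2l// lerDr addr_ge0// ltW.
Qed.

Definition geo q : R := 2^-1 ^+ (choice.pickle q).+1.

Lemma geo_gt0 q : 0 < geo q. Proof. by rewrite exprn_gt0. Qed.

Lemma geo_le1 q : geo q <= 1.
Proof. by rewrite exprn_ile1 ?invr_ge0 ?invf_le1 ?ler1n. Qed.

(** Each number codes at most one cube, so the sum is dominated by that of 2^-(k+1) over all k. *)
Lemma esum_geo : (\esum_(q in [set: dyadic_index n]) (geo q)%:E <= 1)%E.
Proof.
rewrite esum_enumf_series; last by move=> q; rewrite lee_fin ltW// geo_gt0.
have <- : (\sum_(k <oo) (1 / (2 ^ (k + 1))%:R)%:E = 1 :> \bar R)%E.
  have := @cvg_geometric_eseries_half R 1 0; rewrite expr0 divr1.
  by move/cvg_lim; apply.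
apply: lee_nneseries => [k _ _|k _].
  by apply: enumf_ge0 => q; rewrite lee_fin ltW// geo_gt0.
rewrite /enumf; have := @pickle_invK (dyadic_index n) k.
case: (pickle_inv k) => [q /= <-|_] /=.
  by rewrite lee_fin /geo exprVn natrX addn1 div1r.
by rewrite lee_fin divr_ge0.
Qed.

(** The conjugate exponent s is at least 1 and [geo] at most 1, so geo^s <= geo and [esum_geo]
    applies. *)
Lemma lq_geo : (lq (fun q => (geo q)%:C%C) <= 1)%E.
Proof.
have [s s1 sE] := conj_rE hr; have s0 : 0 < s by exact: lt_le_trans s1.
rewrite sE /lq_norm; rewrite -[leRHS](poweR1r s^-1).
apply: le_poweR; first by rewrite invr_ge0 ltW.
  by apply: esum_ge0 => q _; exact: poweR_ge0.
apply: le_trans esum_geo; apply: le_esum => q _.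
rewrite normcR gtr0_norm ?geo_gt0// poweR_EFin lee_fin -[leRHS]powRr1; last first.
  by rewrite ltW// geo_gt0.
by apply: ger_powR => //; rewrite geo_gt0 geo_le1.
Qed.

Definition weight_sum (x : X) : \bar R :=
  \esum_(q in [set: dyadic_index n]) (geo q * wcoef q * \1_(cube q) x)%:E.

Let term_ge0 q x : 0 <= geo q * wcoef q * \1_(cube q) x.
Proof.
by apply: mulr_ge0 => //; apply: mulr_ge0; apply: ltW; [exact: geo_gt0|exact: wcoef_gt0].
Qed.

Lemma weight_sum_le1 x : (weight_sum x <= 1)%E.
Proof.
apply: le_trans esum_geo; apply: le_esum => q _; rewrite lee_fin -mulrA.
rewrite ler_piMr ?(ltW (geo_gt0 q))// mulr_ile1 ?(ltW (wcoef_gt0 q)) ?wcoef_le1//.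
Qed.

Definition weight x : R := fine (weight_sum x).

Lemma weight_sumE x : weight_sum x = (weight x)%:E.
Proof.
rewrite fineK// ge0_fin_numE; last by apply: esum_ge0 => q _; exact: term_ge0.
by apply: le_lt_trans (weight_sum_le1 x) _; rewrite ltry.
Qed.

(** A positive lower bound on each cube: a bounded function supported on a cube stays bounded when
    divided by the weight. *)
Lemma weight_ge_cube q x : cube q x -> geo q * wcoef q <= weight x.
Proof.
move=> qx; rewrite -lee_fin -weight_sumE; apply: esum_ge; exists [set q]; first by split.
by rewrite fsbig_set1 indicE mem_set// mulr1.
Qed.

Lemma weight_gt0 x : 0 < weight x.
Proof.
have [q qx] := cube_cover x; apply: lt_le_trans (weight_ge_cube qx).
by rewrite mulr_gt0 ?geo_gt0 ?wcoef_gt0.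
Qed.

Lemma measurable_weight : measurable_fun setT weight.
Proof.
apply: (@measurableT_comp _ _ _ _ _ _ (@fine R)) => //.
rewrite (_ : weight_sum = fun x => (\sum_(k <oo) enumf (fun q => (geo q * wcoef q * \1_(cube q) x)%:E) k)%E).
  apply: ge0_emeasurable_sum => [k x _ _|k _].
    by apply: enumf_ge0 => q; exact: term_ge0.
  rewrite /enumf; case: (pickle_inv k) => [q|] /=; last exact: measurable_cst.
  apply/measurable_EFinP; apply: measurable_funM => //.
  by apply: measurable_indic; exact: measurable_cube.
by apply/funext => x; rewrite -esum_enumf_series// => q; exact: term_ge0.
Qed.

Lemma measurable_weightV : measurable_fun setT (fun x => (weight x)^-1).
Proof.
rewrite (_ : (fun x => _) = (fun x => weight x `^ (-1))).
  by apply: measurable_powR_comp; exact: measurable_weight.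
by apply/funext => x; rewrite powR_inv1// ltW// weight_gt0.
Qed.

Definition wmul u x : R[i] := (weight x)%:C%C * u x.

Lemma cmeasurable_wmul u : cmeasurable u -> cmeasurable (wmul u).
Proof. by move=> mu'; apply: cmeasurableM => //; exact: cmeasurable_real measurable_weight. Qed.

(** The free factor [be] moves size between coefficients and blocks. A constant [be] slightly above
    sup |u| gives the norm bound of [wmul_BS]; factors that become small together with u give the
    convergence of [wmul_cvg0]. *)
Lemma wmul_decomposition u (be : dyadic_index n -> R) : cmeasurable u ->
  (forall q, 0 < be q) ->
  (forall q, (wcoef q)%:E * Lc (cube_cut q u) <= (be q * vol q)%:E)%E ->
  (lq (fun q => (geo q * be q)%:C%C) < +oo)%E ->
  block_decomposition p t r (wmul u) (fun q => (geo q * be q)%:C%C)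
    (fun q x => (wcoef q / be q)%:C%C * cube_cut q u x).
Proof.
move=> mu' be0 beL beoo; split; first exact: beoo.
  move=> q; split.
  - by apply: cmeasurableM; [exact: cmeasurable_cst|exact: cmeasurable_cut].
  - by move=> x qx; rewrite /cube_cut indicE memNset// mul0r mulr0.
  rewrite (Lp_conjZ p1); last exact: cmeasurable_cut.
  rewrite volE normcR ger0_norm; last by rewrite divr_ge0 ?ltW ?wcoef_gt0.
  rewrite mulrC EFinM -muleA.
  apply: (@le_trans _ _ ((be q)^-1%:E * (be q * vol q)%:E)%E).
    by apply: lee_wpmul2l; [rewrite lee_fin invr_ge0 ltW|exact: beL].
  by rewrite -EFinM mulKf// gt_eqF.
apply/nearW => x; rewrite /wmul.
have := @partial_sum_cvg_ge0 R (dyadic_index n) (fun q => geo q * wcoef q * \1_(cube q) x) (u x).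
rewrite -/(weight_sum x) weight_sumE /= => H.
have {H} := H (fun q => term_ge0 q x) (ltry _).
apply: cvg_trans; rewrite (_ : (fun q => _ * (_ * _)) =
   (fun q => (geo q * wcoef q * \1_(cube q) x)%:C%C * u x))//.
apply/funext => q; rewrite /cube_cut.
have -> : (\1_(cube q) x : R[i]) = (\1_(cube q) x : R)%:C%C.
  by rewrite !indicE; case: (_ \in _).
have E (a b w i : R) : b != 0 -> a * b * (w / b) * i = a * w * i by move=> b0; field.
have -> : (geo q * wcoef q * \1_(cube q) x)%:C%C =
    (geo q * be q)%:C%C * (wcoef q / be q)%:C%C * (\1_(cube q) x : R)%:C%C :> R[i].
  by rewrite -!rmorphM; congr (_%:C%C); rewrite E// gt_eqF.
by rewrite !mulrA.
Qed.

Lemma wmul_BS u M : cmeasurable u -> (forall x, normc (u x) <= M) ->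
  BS (wmul u) /\ (BN (wmul u) <= M%:E)%E.
Proof.
move=> mu' uM.
have M0 : 0 <= M by apply: le_trans (uM point); exact: normc_ge0.
have [s s1 sE] := conj_rE hr; have s0 : 0 < s by exact: lt_le_trans s1.
(* The factor must be positive even if M = 0, hence M + e; e disappears when the infimum is
   taken. *)
have lqM e : 0 < e -> (lq (fun q => (geo q * (M + e))%:C%C) <= (M + e)%:E)%E.
  move=> e0; have Me : 0 < M + e by rewrite ltr_wpDl.
  rewrite (_ : (fun q => _) = (fun q => (M + e)%:C%C * (geo q)%:C%C)); last first.
    by apply/funext => q; rewrite -rmorphM /= mulrC.
  rewrite sE lq_normZ// normcR gtr0_norm// -[leRHS]mule1 lee_wpmul2l// ?lee_fin ?(ltW Me)//.
  by rewrite -sE lq_geo.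
have D e : 0 < e -> block_decomposition p t r (wmul u) (fun q => (geo q * (M + e))%:C%C)
    (fun q x => (wcoef q / (M + e))%:C%C * cube_cut q u x).
  move=> e0; have Me : 0 < M + e by rewrite ltr_wpDl.
  apply: (@wmul_decomposition u (fun=> M + e)) => //; last first.
    by apply: le_lt_trans (lqM _ e0) _; rewrite ltry.
  move=> q; apply: (@le_trans _ _ ((wcoef q)%:E * (M%:E * Lc (cube_cut q (fun=> 1%R))))%E).
    apply: lee_wpmul2l; first by rewrite lee_fin ltW// wcoef_gt0.
    have -> : (M%:E * Lc (cube_cut q (fun=> 1%R)) = Lc (fun x => M%:C%C * cube_cut q (fun=> 1) x)%R)%E.
      rewrite (Lp_conjZ p1) ?normcR ?ger0_norm//.
      by apply: cmeasurable_cut; exact: cmeasurable_cst.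
    apply: (le_Lp_conj p1); first exact: cmeasurable_cut.
      apply: cmeasurableM; first exact: cmeasurable_cst.
      by apply: cmeasurable_cut; exact: cmeasurable_cst.
    move=> x; rewrite /cube_cut mulr1 !Normc.normcM normcR (ger0_norm M0) mulrC.
    by rewrite ler_wpM2r ?normc_ge0.
  rewrite cube_normE -!EFinM lee_fin mulrCA ler_pM ?wcoef_norm ?lerDl ?(ltW e0)//.
  by rewrite mulr_ge0 ?cube_norm_ge0// ltW// wcoef_gt0.
split.
  split; first exact: cmeasurable_wmul.
  by eexists; eexists; exact: (D 1 ltr01).
apply/lee_addgt0Pr => e e0; apply: le_trans (BN_le (D e e0)) _.
by apply: le_trans (lqM _ e0) _; rewrite EFinD.
Qed.

(** Dominated convergence is used twice: for the mixed norm on each cube, with majorant 1, and then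
    for the coefficients in l^{r'}, with majorant 2 [geo]. The second use needs r' finite. This
    continuity is the source of countable additivity. *)
Lemma wmul_cvg0 (u : nat -> X -> R[i]) : (forall k, cmeasurable (u k)) ->
  (forall k x, normc (u k x) <= 1) ->
  (forall x, (fun k => (normc (u k x))%:E) @ \oo --> 0%E) ->
  (fun k => BN (wmul (u k))) @ \oo --> 0%E.
Proof.
move=> mu' u1 uc.
have [s s1 sE] := conj_rE hr; have s0 : 0 < s by exact: lt_le_trans s1.
pose a k q : R := fine (Lc (cube_cut q (u k))).
have aE k q : Lc (cube_cut q (u k)) = (a k q)%:E.
  by rewrite /a fineK// ge0_fin_numE ?Lp_norm_ge0//; exact: (@Lc_cut_lty _ _ 1).
have a0 k q : 0 <= a k q by apply: fine_ge0; exact: Lp_norm_ge0.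
have ac q : (fun k => (a k q)%:E) @ \oo --> 0%E.
  under eq_fun do rewrite -aE.
  apply: (@Lc_cut_dominated_cvg0 q u (fun=> 1)) => //.
  - by move=> k x; rewrite Normc.normc1.
  - by rewrite cube_normE ltry.
(* The smallest factor admissible in [wmul_decomposition] is wcoef a / vol, which may be 0; the
   added 1 / (k + 1) keeps it positive and still tends to 0. *)
pose be k q := wcoef q * a k q / vol q + k.+1%:R^-1.
have be0 k q : 0 < be k q.
  apply: ltr_wpDl; last by rewrite invr_gt0 ltr0n.
  apply: divr_ge0; last exact: ltW (vol_gt0 q).
  by apply: mulr_ge0; [exact: ltW (wcoef_gt0 q)|exact: a0].
have aN k q : a k q <= cube_norm q.
  rewrite -lee_fin -aE -cube_normE; apply: (le_Lp_conj p1).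
  - exact: cmeasurable_cut.
  - by apply: cmeasurable_cut; exact: cmeasurable_cst.
  - by move=> x; rewrite /cube_cut !Normc.normcM Normc.normc1 ler_wpM2l ?normc_ge0.
have be2 k q : be k q <= 2.
  rewrite (_ : 2 = 1 + 1 :> R)// lerD//; last by rewrite invf_le1// ler1n.
  rewrite ler_pdivrMr ?vol_gt0// mul1r (le_trans _ (wcoef_norm q))//.
  by rewrite ler_wpM2l// ltW// wcoef_gt0.
have l2 : (lq (fun q => (2 * geo q)%:C%C) < +oo)%E.
  rewrite (_ : (fun q => _) = (fun q => 2%:C%C * (geo q)%:C%C)); last first.
    by apply/funext => q; rewrite -rmorphM.
  rewrite sE lq_normZ// lte_mul_pinfty// ?lee_fin ?normc_ge0//.
  by rewrite -sE (le_lt_trans lq_geo)// ltry.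
have lek k q : normc (geo q * be k q)%:C%C <= normc (2 * geo q)%:C%C.
  rewrite !normcR !ger0_norm ?mulr_ge0 ?(ltW (geo_gt0 q)) ?(ltW (be0 k q))//.
  by rewrite mulrC ler_wpM2r// ltW// geo_gt0.
have D k : block_decomposition p t r (wmul (u k)) (fun q => (geo q * be k q)%:C%C)
    (fun q x => (wcoef q / be k q)%:C%C * cube_cut q (u k) x).
  apply: wmul_decomposition => //.
    move=> q; rewrite aE -EFinM lee_fin /be mulrDl mulfVK ?gt_eqF ?vol_gt0// lerDl.
    by rewrite mulr_ge0// ltW// vol_gt0.
  by apply: le_lt_trans l2; rewrite sE; apply: le_lq_norm.
have lc : (fun k => lq (fun q => (geo q * be k q)%:C%C)) @ \oo --> 0%E.
  rewrite sE; rewrite sE in l2; apply: lq_norm_dominated_cvg0 l2 => // q.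
  apply/cvge0P => [k|e e0]; first by rewrite lee_fin normc_ge0.
  have e2 : 0 < e / 2 by rewrite divr_gt0.
  have c0 : 0 < wcoef q / vol q by rewrite divr_gt0 ?vol_gt0 ?wcoef_gt0.
  have e3 : 0 < e / 2 / (wcoef q / vol q) by rewrite divr_gt0.
  have H1 := (cvge0P (u := fun k => (a k q)%:E) (fun k => a0 k q)).1 (ac q) _ e3.
  near=> k; rewrite lte_fin normcR gtr0_norm; last by rewrite mulr_gt0 ?geo_gt0.
  apply: (@le_lt_trans _ _ (be k q)).
    by rewrite ler_piMl ?geo_le1// ltW.
  rewrite [ltRHS](splitr e) /be ltrD//.
    rewrite mulrAC mulrC -ltr_pdivlMr// -lte_fin.
    by near: k.
  rewrite invf_plt ?posrE//; near: k.
  exists (Num.truncn (e / 2)^-1) => // k /=.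
  rewrite -(ler_nat R) => tk; apply: lt_le_trans (truncnS_gt _) _.
  by rewrite ler_nat ltnS -(ler_nat R).
apply: (@squeeze_cvge _ _ _ _ (cst 0%E) _ (fun k => lq (fun q => (geo q * be k q)%:C%C))).
- by apply: nearW => k; rewrite BN_ge0//=; exact: BN_le (D k).
- exact: cvg_cst.
- exact: lc.
Unshelve. all: by end_near. Qed.

End functional.

(** * The complex measure A |-> L(w 1_A) and its density *)

Section representation.
Context {R : realType} {n : nat}.
Variables (p : n.-tuple R) (t : R) (r : \bar R).
Hypothesis p1 : all (fun s => 1 < s) p.
Hypothesis hr : r = +oo%E \/ exists2 rho : R, 1 < rho & r = rho%:E.
Local Notation X := (Rn R n).
Local Notation mu := (@lebesgueRn R n).
Local Notation BN := (block_norm p t r).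
Local Notation BS := (block_space p t r).
Local Notation wm := (wmul p t).
Variables (L : (X -> R[i]) -> R[i]) (C : R).
Hypothesis Ll : linear_on_block_space p t r L.
Hypothesis C0 : 0 < C.
Hypothesis LC : functional_le p t r L C.
Implicit Types (h u : X -> R[i]) (A : set X).

Lemma wm_BS u M : cmeasurable u -> (forall x, normc (u x) <= M) -> BS (wm u).
Proof. by move=> mu' uM; have [] := wmul_BS t p1 hr mu' uM. Qed.

Lemma functional_wm_le u M : cmeasurable u -> (forall x, normc (u x) <= M) ->
  normc (L (wm u)) <= C * M.
Proof.
move=> mu' uM; have [uB uN] := wmul_BS t p1 hr mu' uM.
apply: (le_trans (LC uB)); rewrite ler_pM2l//.
by rewrite -lee_fin fineK//; exact: BN_fin uB.
Qed.

Lemma normc_indic_le1 A x : normc (\1_A x : R[i]) <= 1.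
Proof. by rewrite normc_indic indicE; case: (_ \in _). Qed.

Lemma indic_BS A : measurable A -> BS (wm (\1_A)).
Proof.
by move=> mA; apply: (@wm_BS _ 1); [exact: cmeasurable_indic|exact: normc_indic_le1].
Qed.

Definition set_functional A : R[i] := L (wm (\1_A)).

Lemma set_functional_null A : measurable A -> mu A = 0%E -> set_functional A = 0.
Proof.
move=> mA A0; have wmA : cmeasurable (wm (\1_A)).
  by apply: cmeasurable_wmul; exact: cmeasurable_indic.
have [|B N] := @BN_ae0 _ _ p t r p1 hr (wm (\1_A)) wmA.
  exists A; split => // x /= nx; apply: contrapT => xA; apply: nx.
  by rewrite /wmul indicE memNset// mulr0.
have := LC B; rewrite N mulr0 => Lle; apply/eqP; rewrite -normc_eq0.
by rewrite eq_le Lle normc_ge0.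
Qed.

Lemma set_functional0 : set_functional set0 = 0.
Proof. by apply: set_functional_null; [exact: measurable0|rewrite measure0]. Qed.

Lemma set_functionalU A B : measurable A -> measurable B -> [disjoint A & B] ->
  set_functional (A `|` B) = set_functional A + set_functional B.
Proof.
move=> mA mB AB; rewrite /set_functional -(functionalD Ll (indic_BS mA) (indic_BS mB)).
congr L; apply/funext => x; rewrite /wmul -mulrDr; congr (_ * _).
rewrite !indicE in_setU; have [xA|xA] := boolP (x \in A); last by rewrite add0r.
rewrite /= (_ : x \in B = false) ?addr0//; apply/negP => xB.
by move/disj_setPS: AB => /(_ x); apply; split; apply/set_mem.
Qed.

(** By finite additivity the error is the value on the remainder D m. These sets decrease to the
    empty set, so their indicators tend to 0 pointwise and [wmul_cvg0] applies. *)
Lemma set_functional_sigma (F : nat -> set X) : (forall i, measurable (F i)) ->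
  trivIset setT F ->
  forall e : R, 0 < e -> \forall m \near \oo,
    normc (set_functional (\bigcup_i F i) - \sum_(0 <= i < m) set_functional (F i)) < e.
Proof.
move=> mF tF e e0; pose U m := \big[setU/set0]_(i < m) F i.
pose D m := (\bigcup_i F i) `\` U m.
have mU m : measurable (U m) by exact: bigsetU_measurable.
have mFF : measurable (\bigcup_i F i) by exact: bigcup_measurable.
have mD m : measurable (D m) by exact: measurableD.
have UE m : set_functional (U m) = \sum_(0 <= i < m) set_functional (F i).
  elim: m => [|m IHm]; first by rewrite /U big_ord0 big_geq// set_functional0.
  have dU : [disjoint U m & F m].
    apply/disj_setPS => x [Ux Fx]; move: Ux; rewrite /U -bigcup_mkord => -[i /= im Fix].
    have : i = m by apply: (tF i m Logic.I Logic.I); exists x.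
    by move=> im'; rewrite im' ltnn in im.
  by rewrite big_nat_recr//= -IHm /U big_ord_recr/= (set_functionalU (mU m)).
have UD m : \bigcup_i F i = U m `|` D m.
  by rewrite /D setDUK// /U -bigcup_mkord => x [i _ Fx]; exists i.
have E m : set_functional (\bigcup_i F i) - \sum_(0 <= i < m) set_functional (F i) =
    set_functional (D m).
  rewrite -UE {1}(UD m) set_functionalU//; first by rewrite addrC addKr.
  by apply/disj_setPS => x [? []].
have cD : (fun m => BN (wm (\1_(D m)))) @ \oo --> 0%E.
  apply: wmul_cvg0 => //.
  - by move=> m; exact: cmeasurable_indic.
  - by move=> m x; exact: normc_indic_le1.
  - move=> x; apply: cvg_near_cst; have [[i _ Fx]|nx] := pselect ((\bigcup_i F i) x).
      exists i.+1 => // m /= im; rewrite normc_indic indicE memNset// => -[_]; apply.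
      by rewrite /U -bigcup_mkord; exists i.
    by apply: nearW => m; rewrite normc_indic indicE memNset// => -[].
have eC : 0 < e / C by rewrite divr_gt0.
have := (cvge0P (u := fun m => BN (wm (\1_(D m)))) (fun m => BN_ge0 p t hr _)).1 cD _ eC.
apply: filterS => m mlt; rewrite E.
have DB := indic_BS (mD m).
apply: (le_lt_trans (LC DB)); rewrite mulrC -ltr_pdivlMr// -lte_fin fineK//.
exact: BN_fin DB.
Qed.

Lemma functional_density : exists h, cintegrable h /\ cmeasurable h /\
  forall A, measurable A -> set_functional A = cintegral (fun x => \1_A x * h x).
Proof.
(* Stated for an abstract [part] so that the real and the imaginary part are treated by one
   argument. *)
have S (part : R[i] -> R) : (forall z w, part (z + w) = part z + part w) -> part 0 = 0 ->
    (forall z, `|part z| <= normc z) ->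
    exists k : X -> R, mu.-integrable setT (EFin \o k) /\
      forall A, measurable A -> (part (set_functional A))%:E = (\int[mu]_x (k x * \1_A x)%:E)%E.
  move=> partD part0 partle; apply: (real_radon_nikodym (mu := mu) (nu := fun A => part (set_functional A))).
  - by rewrite set_functional0.
  - move=> F mF tF mFF.
    have partS m : \sum_(0 <= i < m) part (set_functional (F i)) =
        part (\sum_(0 <= i < m) set_functional (F i)).
      elim: m => [|m IHm]; first by rewrite !big_geq.
      by rewrite !big_nat_recr//= partD IHm.
    under eq_fun do rewrite sumEFin partS.
    apply: cvg_EFin; first exact: nearW.
    apply/cvgrPdist_lt => e e0.
    apply: filterS (set_functional_sigma mF tF e0) => m; apply: le_lt_trans => /=.
    have partB z w : part z - part w = part (z - w).
      by apply/eqP; rewrite subr_eq -partD subrK.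
    by rewrite partB.
  - by move=> A mA A0; rewrite set_functional_null.
have [h1 [ih1 h1E]] := S _ (@ReD R) erefl (@ler_Re_normc R).
have [h2 [ih2 h2E]] := S _ (@ImD R) erefl (@ler_Im_normc R).
exists (fun x => (h1 x +i* h2 x)%C); split; first by [].
split.
  by split => /=; apply/measurable_EFinP; [case/integrableP: ih1|case/integrableP: ih2].
move=> A mA; apply/eqP; rewrite eq_complex /=; apply/andP; split; apply/eqP.
  rewrite /Rintegral -[LHS]/(fine (Re (set_functional A))%:E) h1E//; congr fine.
  apply: eq_integral => x _; rewrite !indicE; case: (_ \in _) => /=.
    by rewrite mul0r subr0 mulr1 mul1r.
  by rewrite !mul0r subr0 mulr0.
rewrite /Rintegral -[LHS]/(fine (Im (set_functional A))%:E) h2E//; congr fine.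
apply: eq_integral => x _; rewrite !indicE; case: (_ \in _) => /=.
  by rewrite mul0r addr0 mulr1 mul1r.
by rewrite !mul0r addr0 mulr0.
Qed.

End representation.

(** * From indicators to bounded functions *)

Section bounded_representation.
Context {R : realType} {n : nat}.
Variables (p : n.-tuple R) (t : R) (r : \bar R).
Hypothesis p1 : all (fun s => 1 < s) p.
Hypothesis hr : r = +oo%E \/ exists2 rho : R, 1 < rho & r = rho%:E.
Local Notation X := (Rn R n).
Local Notation mu := (@lebesgueRn R n).
Local Notation cube := (@dyadic_cube R n).
Local Notation BS := (block_space p t r).
Local Notation wm := (wmul p t).
Variables (L : (X -> R[i]) -> R[i]) (C : R).
Hypothesis Ll : linear_on_block_space p t r L.
Hypothesis C0 : 0 < C.
Hypothesis LC : functional_le p t r L C.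
Variable h : X -> R[i].
Hypotheses (ih : cintegrable h) (mh : cmeasurable h).
Hypothesis hE : forall A, measurable A ->
  set_functional p t L A = cintegral (fun x => \1_A x * h x).
Implicit Types (f g u v : X -> R[i]) (q : dyadic_index n) (A : set X).

Let H : R := fine (\int[mu]_x (normc (h x))%:E)%E.

Let HE : (\int[mu]_x (normc (h x))%:E = H%:E)%E.
Proof.
rewrite fineK// ge0_fin_numE; first exact/cintegrableP.
by apply: integral_ge0 => x _; rewrite lee_fin normc_ge0.
Qed.

Let H0 : 0 <= H.
Proof. by apply: fine_ge0; apply: integral_ge0 => x _; rewrite lee_fin normc_ge0. Qed.

Let int_le u M : cmeasurable u -> (forall x, normc (u x) <= M) ->
  (\int[mu]_x (normc (u x * h x))%:E <= (M * H)%:E)%E.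
Proof.
move=> mu' uM; have M0 : 0 <= M by apply: le_trans (uM point); exact: normc_ge0.
rewrite EFinM -HE -ge0_integralZl//; last 2 first.
- exact: measurable_EFin_normc.
- by move=> x _; rewrite lee_fin normc_ge0.
apply: ge0_le_integral => //.
- by move=> x _; rewrite lee_fin normc_ge0.
- by apply: measurable_EFin_normc; exact: cmeasurableM.
- by apply: emeasurable_funM => //; exact: measurable_EFin_normc.
- move=> x _; rewrite Normc.normcM EFinM.
  by apply: lee_wpmul2r; rewrite lee_fin; [exact: normc_ge0|exact: uM].
Qed.

Lemma bounded_cintegrable u M : cmeasurable u -> (forall x, normc (u x) <= M) ->
  cintegrable (fun x => u x * h x).
Proof.
move=> mu' uM; apply/cintegrableP; first exact: cmeasurableM.
by apply: le_lt_trans (int_le mu' uM) _; rewrite ltry.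
Qed.

Let D u := L (wm u) - cintegral (fun x => u x * h x).

Let D_le u M : cmeasurable u -> (forall x, normc (u x) <= M) ->
  normc (D u) <= (C + H) * M.
Proof.
move=> mu' uM; rewrite (le_trans (le_normcD _ _))// normcN mulrDl lerD//.
  exact: (functional_wm_le p1 hr C0 LC mu' uM).
rewrite -lee_fin mulrC; apply: le_trans (int_le mu' uM).
apply: le_normc_cintegral; first exact: cmeasurableM.
exact: bounded_cintegrable uM.
Qed.

Let D_comb z u v M M' : cmeasurable u -> (forall x, normc (u x) <= M) ->
  cmeasurable v -> (forall x, normc (v x) <= M') ->
  D (fun x => z * u x + v x) = z * D u + D v.
Proof.
move=> mu' uM mv vM; rewrite /D.
have uB := wm_BS t p1 hr mu' uM; have vB := wm_BS t p1 hr mv vM.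
have -> : wm (fun x => z * u x + v x) = (fun x => z * wm u x + wm v x).
  by apply/funext => x; rewrite /wmul mulrDr mulrCA.
rewrite (Ll z uB vB).
have -> : cintegral (fun x => (z * u x + v x) * h x) =
    z * cintegral (fun x => u x * h x) + cintegral (fun x => v x * h x).
  have iu := bounded_cintegrable mu' uM; have iv := bounded_cintegrable mv vM.
  rewrite -cintegralZ// -cintegralD//; last exact: cintegrableZ.
  by congr cintegral; apply/funext => x; rewrite mulrDl mulrA.
by ring.
Qed.

Let D_indic A : measurable A -> D (\1_A) = 0.
Proof. by move=> mA; rewrite /D -hE// subrr. Qed.

(* Subtracting (M / 2) 1_A with A = {u >= M / 2}, which D annihilates, halves
   the bound on u. *)
Let D_halving k (u : X -> R) M : measurable_fun setT u ->
  (forall x, 0 <= u x) -> (forall x, u x <= M) ->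
  normc (D (fun x => (u x)%:C%C)) <= (C + H) * M / 2 ^+ k.
Proof.
elim: k u M => [|k IHk] u M mu' u0 uM.
  rewrite expr0 divr1; apply: D_le; first exact: cmeasurable_real.
  by move=> x; rewrite normcR ger0_norm.
have M0 : 0 <= M by apply: le_trans (u0 point) (uM point).
pose A := [set x | M / 2 <= u x].
have mA : measurable A.
  rewrite -[A]setTI (_ : A = u @^-1` `[M / 2, +oo[); first exact: mu'.
  by apply/seteqP; split => x /=; rewrite in_itv/= andbT.
pose v x := u x - M / 2 * \1_A x.
have mv : measurable_fun setT v.
  by apply: measurable_funB => //; apply: measurable_funM.
have v0 x : 0 <= v x.
  rewrite /v indicE; have [/set_mem xA|xA] := boolP (x \in A).
    by rewrite mulr1 subr_ge0.
  by rewrite mulr0 subr0.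
have vM x : v x <= M / 2.
  rewrite /v indicE; have [/set_mem xA|xA] := boolP (x \in A).
    by rewrite mulr1 lerBlDr -splitr.
  rewrite mulr0 subr0 ltW// ltNge; apply: contra xA => ux.
  exact/mem_set.
have -> : (fun x => (u x)%:C%C) = (fun x => (M / 2)%:C%C * \1_A x + (v x)%:C%C) :> (X -> R[i]).
  apply/funext => x; rewrite /v rmorphB rmorphM /= !indicE.
  by case: (_ \in _) => /=; ring.
rewrite (@D_comb _ _ _ 1 (M / 2)).
- rewrite D_indic// mulr0 add0r (le_trans (IHk _ _ mv v0 vM))//.
  by rewrite exprS invfM !mulrA.
- exact: cmeasurable_indic.
- by move=> x; exact: normc_indic_le1.
- exact: cmeasurable_real.
- by move=> x; rewrite normcR ger0_norm.
Qed.

Let D_ge0 (u : X -> R) M : measurable_fun setT u ->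
  (forall x, 0 <= u x) -> (forall x, u x <= M) -> D (fun x => (u x)%:C%C) = 0.
Proof.
move=> mu' u0 uM; have M0 : 0 <= M by apply: le_trans (u0 point) (uM point).
have K0 : 0 <= (C + H) * M by rewrite mulr_ge0// addr_ge0// ltW.
apply/eqP; rewrite -normc_eq0 eq_le normc_ge0 andbT; apply/ler_addgt0Pr => e e0.
rewrite add0r; set k := (Num.truncn ((C + H) * M / e)).+1.
apply: (le_trans (D_halving k mu' u0 uM)).
have : (C + H) * M / e <= 2 ^+ k.
  by rewrite (le_trans (ltW (truncnS_gt _)))// -natrX ler_nat ltnW// ltn_expl.
by rewrite ler_pdivrMr// => le2; rewrite ler_pdivrMr ?exprn_gt0// [leRHS]mulrC.
Qed.

Let D_real (u : X -> R) M : measurable_fun setT u ->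
  (forall x, `|u x| <= M) -> D (fun x => (u x)%:C%C) = 0.
Proof.
move=> mu' uM; have M0 : 0 <= M by apply: le_trans (uM point).
(* Adding the constant M, a multiple of the indicator of the whole space, makes u nonnegative
   without changing its defect. *)
have -> : (fun x => (u x)%:C%C) = (fun x => (- M)%:C%C * \1_setT x + (u x + M)%:C%C) :> (X -> R[i]).
  by apply/funext => x; rewrite indicT mulr1 -rmorphD addrCA addNr addr0.
have uMM x : 0 <= u x + M <= M + M.
  have := uM x; rewrite ler_norml => /andP[h1 h2].
  by rewrite -lerBlDr sub0r h1 lerD2r.
have muM : measurable_fun setT (fun x => u x + M) by exact: measurable_funD.
rewrite (@D_comb _ _ _ 1 (M + M)).
- rewrite D_indic// mulr0 add0r; apply: (@D_ge0 _ (M + M)) => // x; by case/andP: (uMM x).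
- exact: cmeasurable_indic.
- by move=> x; exact: normc_indic_le1.
- exact: cmeasurable_real.
- by move=> x; rewrite normcR ger0_norm; case/andP: (uMM x).
Qed.

Lemma bounded_representation u M : cmeasurable u -> (forall x, normc (u x) <= M) ->
  L (wm u) = cintegral (fun x => u x * h x).
Proof.
move=> mu' uM; have [m1 m2] := mu'; apply/eqP; rewrite -subr_eq0 -/(D u).
have -> : u = (fun x => 'i%C * (Im (u x))%:C%C + (Re (u x))%:C%C).
  by apply/funext => x; rewrite addrC -complexE.
have i1 x : `|Im (u x)| <= M by rewrite (le_trans (ler_Im_normc _)).
have r1 x : `|Re (u x)| <= M by rewrite (le_trans (ler_Re_normc _)).
rewrite (@D_comb _ _ _ M M).
- by rewrite (D_real m2 i1) (D_real m1 r1) mulr0 addr0.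
- exact: cmeasurable_real.
- by move=> x; rewrite normcR.
- exact: cmeasurable_real.
- by move=> x; rewrite normcR.
Qed.

(** Write g = w (g / w): the quotient is bounded by [weight_ge_cube], and moving 1 / w from g to h
    produces f. *)
Lemma local_representation q g M : cmeasurable g -> (forall x, normc (g x) <= M) ->
  (forall x, ~ cube q x -> g x = 0) ->
  let f x := h x * ((weight p t x)^-1)%:C%C in
  [/\ BS g, cintegrable (fun x => g x * f x) & L g = pairing f g].
Proof.
move=> mg gM gq f; set w := weight p t.
have w0 x : 0 < w x by exact: weight_gt0.
pose u x := g x * ((w x)^-1)%:C%C.
have mu' : cmeasurable u.
  by apply: cmeasurableM => //; apply: cmeasurable_real; exact: measurable_weightV.
have c0 : 0 < @geo R n q * wcoef p t q by rewrite mulr_gt0 ?geo_gt0 ?wcoef_gt0.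
have M0 : 0 <= M by apply: le_trans (gM point); exact: normc_ge0.
have uM x : normc (u x) <= M / (@geo R n q * wcoef p t q).
  have [xq|xq] := pselect (cube q x).
    rewrite Normc.normcM normcR gtr0_norm ?invr_gt0// ler_pM ?normc_ge0 ?invr_ge0//.
      exact: ltW.
    by rewrite lef_pV2 ?posrE//; exact: weight_ge_cube.
  by rewrite /u gq// mul0r Normc.normc0 divr_ge0// ltW.
have gE : wm u = g.
  apply/funext => x; rewrite /wmul /u mulrCA -rmorphM mulfV ?mulr1//.
  by rewrite gt_eqF.
have ufE : (fun x => u x * h x) = (fun x => g x * f x).
  by apply/funext => x; rewrite /u /f -mulrA [_%:C%C * h x]mulrC.
split.
- by rewrite -gE; exact: (wm_BS t p1 hr mu' uM).
- by rewrite -ufE; exact: bounded_cintegrable mu' uM.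
- by rewrite -[in LHS]gE (bounded_representation mu' uM) ufE.
Qed.

End bounded_representation.

(** * The Morrey norm of f is at most the norm of L *)

Section morrey_bound.
Context {R : realType} {n : nat}.
Variables (p : n.-tuple R) (t : R) (r : \bar R).
Hypothesis p1 : all (fun s => 1 < s) p.
Hypothesis hr : r = +oo%E \/ exists2 rho : R, 1 < rho & r = rho%:E.
Local Notation X := (Rn R n).
Local Notation mu := (@lebesgueRn R n).
Local Notation cube := (@dyadic_cube R n).
Local Notation BS := (block_space p t r).
Local Notation Lc := (Lp_norm (conj_exponents p)).
Variables (L : (X -> R[i]) -> R[i]) (C : R) (f : X -> R[i]).
Hypothesis Ll : linear_on_block_space p t r L.
Hypothesis C0 : 0 <= C.
Hypothesis LC : functional_le p t r L C.
Hypothesis mf : cmeasurable f.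
Hypothesis Lf : forall q g M, cmeasurable g -> (forall x, normc (g x) <= M) ->
  (forall x, ~ cube q x -> g x = 0) ->
  cintegrable (fun x => g x * f x) /\ L g = pairing f g.

(** The block is an almost extremal function for |f| on the cube, scaled to the block bound and
    multiplied by the phase conj(f) / |f|. The phase makes L b a real number at least c, so that
    values on different cubes add up without cancellation. *)
Lemma test_block q (c : R) : (c%:E < local_norm p t f q)%E ->
  exists b y, [/\ is_block p t (cube q) b, c <= y & L b = y%:C%C].
Proof.
move=> clt; set v := vol p t q; have v0 : 0 < v by exact: vol_gt0.
have vE : vol_factor p t q = v%:E by exact: volE.
pose F x := (normc (f x * \1_(cube q) x))%:E.
have mfq : cmeasurable (fun x => f x * \1_(cube q) x).
  by apply: cmeasurableM => //; apply: cmeasurable_indic; exact: measurable_cube.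
have mF : measurable_fun setT F by exact: measurable_EFin_normc.
have F0 x : (0 <= F x)%E by rewrite lee_fin normc_ge0.
have clt' : ((c / v)%:E < mixed_norm (exponents p) F)%E.
  by rewrite EFinM lte_pdivrMr// muleC -vE.
have [g [mg [g0 [B gB]] gF gq cg]] := mixed_norm_dual (conjugate_conjt p1) mF F0 clt'.
pose ph x := (f x)^*%C * ((normc (f x)) `^ (-1))%:C%C.
have mph : cmeasurable ph.
  apply: cmeasurableM; first exact: cmeasurable_conj.
  by apply: cmeasurable_real; apply: measurable_powR_comp; exact: measurable_normc.
have phf x : ph x * f x = (normc (f x))%:C%C.
  rewrite /ph mulrAC [_ * f x]mulrC mulc_conj -rmorphM /= powR_inv1 ?normc_ge0//.
  have [->|fn0] := eqVneq (normc (f x)) 0; first by rewrite expr0n mul0r.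
  by rewrite expr2 mulfK.
have ph1 x : normc (ph x) <= 1.
  rewrite /ph Normc.normcM normc_conj normcR ger0_norm ?powR_ge0//.
  rewrite powR_inv1 ?normc_ge0//.
  have [->|fn0] := eqVneq (normc (f x)) 0; first by rewrite mul0r.
  by rewrite mulfV.
pose b x := (v * g x)%:C%C * ph x.
have gcube x : ~ cube q x -> g x = 0.
  by move=> xq; apply: gF; rewrite /F indicE memNset// mulr0 Normc.normc0.
have mb : cmeasurable b.
  by apply: cmeasurableM => //; apply: cmeasurable_real; exact: measurable_funM.
have bcube x : ~ cube q x -> b x = 0.
  by move=> xq; rewrite /b gcube// mulr0 mul0r.
have bg x : normc (b x) <= v * g x.
  rewrite Normc.normcM normcR ger0_norm ?mulr_ge0 ?(ltW v0)//.
  by rewrite ler_piMr// mulr_ge0// ltW.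
have bblock : is_block p t (cube q) b.
  split => //; rewrite volE -/v.
  apply: (@le_trans _ _ (Lc (fun x => v%:C%C * (g x)%:C%C))).
    apply: (le_Lp_conj p1) => //.
      by apply: cmeasurableM; [exact: cmeasurable_cst|exact: cmeasurable_real].
    by move=> x; rewrite -rmorphM normcR ger0_norm// mulr_ge0// ltW.
  rewrite (Lp_conjZ p1); last exact: cmeasurable_real.
  rewrite normcR gtr0_norm// -[leRHS]mule1 lee_wpmul2l// ?lee_fin ?(ltW v0)//.
  rewrite (Lp_conjE p1); apply: le_trans gq; rewrite le_eqVlt; apply/orP; left.
  by apply/eqP; congr mixed_norm; apply/funext => x; rewrite normcR ger0_norm.
have bM x : normc (b x) <= v * B by rewrite (le_trans (bg x))// ler_wpM2l// ltW.
have [ibf Lb] := Lf mb bM bcube.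
have bfE : (fun x => b x * f x) = (fun x => (v * g x * normc (f x))%:C%C).
  by apply/funext => x; rewrite /b -mulrA phf -rmorphM.
exists b, (\int[mu]_x (v * g x * normc (f x))); split => //; last first.
  by rewrite Lb /pairing bfE cintegral_real.
move: ibf; rewrite bfE => -[/= iv _].
rewrite -lee_fin /Rintegral fineK; last exact: integrable_fin_num.
apply: ltW; rewrite (eq_integral (fun x => v%:E * ((g x)%:E * F x))%E).
  rewrite ge0_integralZl//.
  - by rewrite muleC -lte_pdivrMr// -EFinM.
  - by apply: emeasurable_funM => //; exact/measurable_EFinP.
  - by move=> x _; rewrite mule_ge0// lee_fin.
  - by rewrite lee_fin ltW.
move=> x _; rewrite /F -!EFinM -mulrA; congr (_ * _)%:E.
have [xq|xq] := pselect (cube q x); first by rewrite indicE mem_set// mulr1.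
by rewrite gcube// !mul0r.
Qed.

Lemma local_norm_le q : (local_norm p t f q <= C%:E)%E.
Proof.
rewrite leNgt; apply/negP => clt.
(* A real number strictly between is needed since the local norm may still be infinite. *)
have [c [cC clt']] : exists c, C < c /\ (c%:E < local_norm p t f q)%E.
  move: clt; case: (local_norm p t f q) => [a| |//]; last first.
    by move=> _; exists (C + 1); rewrite ltrDl ltr01 ltry.
  by rewrite lte_fin => Ca; exists ((C + a) / 2); rewrite lte_fin !midf_lt.
have [b [y [bb cy Lb]]] := test_block clt'.
have [bB bN] := single_block p1 hr 1 bb.
have b1 : (fun x => 1 * b x) = b by apply/funext => x; rewrite mul1r.
rewrite b1 Normc.normc1 in bB bN.
have := LC bB; rewrite Lb normcR => yle.
have : y <= C.
  apply: (le_trans (ler_norm _)); apply: (le_trans yle).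
  rewrite -[leRHS]mulr1 ler_wpM2l// -lee_fin fineK//.
  exact: BN_fin bB.
by rewrite leNgt (lt_le_trans cC cy).
Qed.

(** Converse Hoelder in l^rho: the coefficients a^(rho-1) have l^s norm S^(1/s), as (rho - 1) s =
    rho, so testing gives S <= C S^(1/s) and division by S^(1/s) finishes. Test blocks reach only
    values below a q, hence the factor th < 1, removed at the end. *)
Lemma finite_morrey_le rho (F : {fset dyadic_index n}) (a : dyadic_index n -> R) :
  1 < rho -> r = rho%:E -> (forall q, 0 <= a q) ->
  (forall q, local_norm p t f q = (a q)%:E) ->
  \sum_(q <- F) a q `^ rho <= C `^ rho.
Proof.
move=> rho1 rE a0 aE; have rho0 : 0 < rho by exact: lt_trans rho1.
set S := \sum_(q <- F) _; have S0 : 0 <= S by apply: sumr_ge0 => q _; exact: powR_ge0.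
have [S00|Sn0] := eqVneq S 0; first by rewrite S00 powR_ge0.
have Spos : 0 < S by rewrite lt0r Sn0.
set s := rho / (rho - 1); have s0 : 0 < s by exact: conjugate_gt0.
have rs : rho^-1 + s^-1 = 1 by exact: conjugateV.
have ths th : 0 < th < 1 -> th * S <= C * S `^ s^-1.
  move=> /andP[th0 th1].
  have blk q : exists by_ : (X -> R[i]) * R, [/\ is_block p t (cube q) by_.1,
      th * a q <= by_.2 & L by_.1 = by_.2%:C%C].
    (* Here th a q is not strictly below a q, so the zero block is taken instead. *)
    have [aq0|aqn0] := eqVneq (a q) 0.
      exists (fun=> 0, 0) => /=; rewrite aq0 mulr0 (functional0 p1 hr Ll); split => //.
      exact: is_block0.
    have [|b [y [bb cy Lb]]] := @test_block q (th * a q); last by exists (b, y).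
    by rewrite aE lte_fin gtr_pMl// lt0r aqn0 a0.
  have [by_ byP] := choice blk.
  pose l q : R[i] := if q \in F then (a q `^ (rho - 1))%:C%C else 0.
  have lF q : q \notin F -> l q = 0 by move=> /negbTE; rewrite /l => ->.
  have bb q : is_block p t (cube q) (by_ q).1 by case: (byP q).
  have [gB gN] := finite_block_sum hr bb lF.
  have := LC gB.
  have lB q : BS (fun x => l q * (by_ q).1 x).
    by have [] := single_block p1 hr (l q) (bb q).
  have b1 q : BS (by_ q).1.
    have [] := single_block p1 hr 1 (bb q).
    by rewrite (_ : (fun x => 1 * (by_ q).1 x) = (by_ q).1)//; apply/funext => x; rewrite mul1r.
  rewrite (functional_sum p1 hr F Ll lB).
  have -> : \sum_(q <- F) L (fun x => l q * (by_ q).1 x) =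
      (\sum_(q <- F) a q `^ (rho - 1) * (by_ q).2)%:C%C.
    rewrite rmorph_sum; apply: eq_big_seq => q qF.
    have [_ _ Lb] := byP q.
    by rewrite (functionalZ p1 hr _ Ll (b1 q)) Lb /l qF -rmorphM.
  rewrite normcR => key.
  have lhs : th * S <= `|\sum_(q <- F) a q `^ (rho - 1) * (by_ q).2|.
    rewrite (le_trans _ (ler_norm _))// mulr_sumr; apply: ler_sum => q _.
    have [_ ty _] := byP q.
    rewrite -(mulr_powRB1 (a0 q) rho0) mulrA mulrC.
    by rewrite ler_wpM2l// powR_ge0.
  apply: (le_trans lhs); apply: (le_trans key).
  rewrite ler_wpM2l// -lee_fin fineK; last exact: BN_fin gB.
  apply: (le_trans gN); rewrite rE hoelder_conjugate_EFin// -/s (finite_lq s0 lF) lee_fin.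
  rewrite (_ : \sum_(q <- F) normc (l q) `^ s = S)//; apply: eq_big_seq => q qF.
  rewrite /l qF normcR ger0_norm ?powR_ge0// -powRrM; congr (_ `^ _).
  by rewrite /s; field; rewrite subr_eq0 gt_eqF.
have Sle : S <= C * S `^ s^-1.
  apply/ler_addgt0Pr => e e0.
  (* The loss (1 - th) S is then at most e, while the cap 2^-1 keeps th positive. *)
  pose th := 1 - Num.min (2^-1) (e / S).
  have m0 : 0 < Num.min 2^-1 (e / S) by rewrite lt_min invr_gt0 ltr0n divr_gt0.
  have th01 : 0 < th < 1.
    rewrite /th subr_gt0 ltrBlDr ltrDl m0 andbT gt_min invf_lt1// ltr1n.
    by [].
  have := ths th th01; rewrite /th mulrBl mul1r lerBlDr => /le_trans; apply.
  by rewrite lerD2l -ler_pdivlMr// ge_min lexx orbT.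
have SE : S `^ rho^-1 <= C.
  have Sp : 0 < S `^ s^-1 by exact: powR_gt0.
  have : S `^ rho^-1 * S `^ s^-1 <= C * S `^ s^-1.
    by rewrite -powRD ?rs ?powRr1// oner_eq0.
  by rewrite ler_pM2r.
have := ge0_ler_powR (ltW rho0) (_ : S `^ rho^-1 \in Num.nneg) (_ : C \in Num.nneg) SE.
rewrite !nnegrE powR_ge0 C0 => /(_ erefl erefl).
by rewrite -powRrM mulVf ?gt_eqF// powRr1.
Qed.

Lemma morrey_norm_le : (morrey_norm p t r f <= C%:E)%E.
Proof.
have [rE|[rho rho1 rE]] := hr.
  by rewrite rE morrey_normyE; apply: ge_ereal_sup => _ [q _ <-]; exact: local_norm_le.
have rho0 : 0 < rho by exact: lt_trans rho1.
pose a q := fine (local_norm p t f q).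
have a0 q : 0 <= a q by apply: fine_ge0; exact: local_norm_ge0.
have aE q : local_norm p t f q = (a q)%:E.
  rewrite /a fineK// ge0_fin_numE ?local_norm_ge0//.
  by apply: le_lt_trans (local_norm_le q) _; rewrite ltry.
rewrite rE morrey_normE// -esum_poweR//; last exact: local_norm_ge0.
rewrite -[leRHS](@poweRK _ rho) ?lee_fin ?gt_eqF//.
apply: le_poweR; first by rewrite invr_ge0 ltW.
  by apply: esum_ge0 => q _; exact: poweR_ge0.
apply: ge_ereal_sup => _ [A [finA _] <-].
rewrite fsbig_finite// poweR_EFin.
under eq_bigr do rewrite aE poweR_EFin.
by rewrite sumEFin lee_fin; exact: finite_morrey_le.
Qed.

End morrey_bound.

(** * Duality *)

Section hahn_banach.
Context {R : realType} (V : lmodType R[i]) (D : set V) (N : V -> R) (v0 : V).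
Hypothesis Dv0 : D v0.
Hypothesis DD : forall a v w, D v -> D w -> D (a *: v + w).
Hypothesis ND : forall v w, D v -> D w -> N (v + w) <= N v + N w.
Hypothesis NZ : forall a v, D v -> N (a *: v) = normc a * N v.

Let DZ a v : D v -> D (a *: v).
Proof.
move=> Dv; have D0 : D 0 by have := DD (-1) Dv Dv; rewrite scaleN1r addNr.
by have := DD a Dv D0; rewrite addr0.
Qed.

Let DA v w : D v -> D w -> D (v + w).
Proof. by move=> Dv Dw; have := DD 1 Dv Dw; rewrite scale1r. Qed.

Let D0 : D 0. Proof. by have := DZ 0 Dv0; rewrite scale0r. Qed.

Let N0 : N 0 = 0.
Proof. by have := NZ 0 Dv0; rewrite scale0r Normc.normc0 mul0r. Qed.

Let N_ge0 v : D v -> 0 <= N v.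
Proof.
move=> Dv; have := ND Dv (DZ (-1) Dv).
rewrite NZ// scaleN1r subrr N0 normcN Normc.normc1 mul1r -mulr2n.
by rewrite pmulrn_lge0.
Qed.

(* A functional is handled through its graph, a set of pairs (x, s). *)
Let good (G : set (V * R)) :=
  (forall x s, G (x, s) -> D x /\ s <= N x) /\
  (forall x s y u (a : R), G (x, s) -> G (y, u) ->
     G (x + a%:C%C *: y, s + a * u)).

Let G0 : set (V * R) := [set z | exists a : R, z = (a%:C%C *: v0, a * N v0)].

Let good0 : good G0.
Proof.
split=> [x s [a [-> ->]]|x s y u a [b [-> ->]] [c [-> ->]]].
  split; first exact: DZ.
  by rewrite NZ// normcR ler_wpM2r ?N_ge0// ler_norm.
by exists (b + a * c); rewrite scalerA -scalerDl rmorphD rmorphM; congr (_, _); ring.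
Qed.

Let maximal_graph : exists G : set (V * R),
  [/\ good G, G0 `<=` G & forall B, good B -> G `<=` B -> B `<=` G].
Proof.
(* Zorn's lemma is applied to the sets A for which A together with [G0] is good, which forces the
   maximal graph to extend [G0]. *)
have [A [PA Amax]] : exists A, good (A `|` G0) /\
    forall B, A `<` B -> ~ good (B `|` G0).
  apply: Zorn_bigcup => F FP Ftot; split=> [x s [[G FG Gxs]|]|].
  - by have [+ _] := FP _ FG; apply; left.
  - by have [+ _] := good0; apply.
  move=> x s y u a [[G FG Gxs]|Gxs] [[G' FG' Gyu]|Gyu].
  - have [GG'|GG'] := Ftot _ _ FG FG'.
      have [_ /(_ x s y u a)] := FP _ FG'.
      by move=> /(_ (or_introl (GG' _ Gxs)) (or_introl Gyu)) [?|?]; [left; exists G'|right].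
    have [_ /(_ x s y u a)] := FP _ FG.
    by move=> /(_ (or_introl Gxs) (or_introl (GG' _ Gyu))) [?|?]; [left; exists G|right].
  - have [_ /(_ x s y u a)] := FP _ FG.
    by move=> /(_ (or_introl Gxs) (or_intror Gyu)) [?|?]; [left; exists G|right].
  - have [_ /(_ x s y u a)] := FP _ FG'.
    by move=> /(_ (or_intror Gxs) (or_introl Gyu)) [?|?]; [left; exists G'|right].
  - by right; have [_] := good0; apply.
exists (A `|` G0); split => // B gB AB; apply: contrapT => nBA.
apply: (Amax B); last by rewrite (setUidl (subset_trans (@subsetUr _ _ _) AB)).
split; first exact: subset_trans (@subsetUl _ _ _) AB.
by move=> BA; apply: nBA => z /BA; left.
Qed.

(** By the triangle inequality every s - N (x - w) lies below every N (y + w) - u, so the supremum c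
    of the former is an admissible value at w. *)
Let extension (G : set (V * R)) w : good G -> G0 `<=` G -> D w ->
  exists B, [/\ good B, G `<=` B & exists c, B (w, c)].
Proof.
move=> [Gle Gcomb] G0G Dw.
have G00 : G (0, 0) by apply: G0G; exists 0; rewrite scale0r mul0r.
have GZ (a : R) x s : G (x, s) -> G (a%:C%C *: x, a * s).
  by move=> Gx; have := Gcomb _ _ _ _ a G00 Gx; rewrite !add0r.
pose S := [set c | exists x s, G (x, s) /\ c = s - N (x - w)].
have DBw x : D x -> D (x - w) by move=> Dx; rewrite -scaleN1r addrC; exact: DD.
have Sub y u : G (y, u) -> ubound S (N (y + w) - u).
  move=> Gy _ [x [s [Gx ->]]]; rewrite lerBlDr addrAC lerBrDr.
  have [_ le] := Gle _ _ (Gcomb _ _ _ _ 1 Gx Gy).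
  rewrite rmorph1 scale1r mul1r in le; apply: (le_trans le).
  have [Dx _] := Gle _ _ Gx; have [Dy _] := Gle _ _ Gy.
  rewrite (_ : x + y = (y + w) + (x - w)); last by rewrite addrACA subrr addr0 addrC.
  by apply: ND; [exact: DA|exact: DBw].
have S0 : S !=set0 by exists (0 - N (0 - w)), 0, 0.
pose c := sup S.
have cge x s : G (x, s) -> s - N (x - w) <= c.
  move=> Gx; apply: ub_le_sup; first by exists (N (0 + w) - 0); exact: Sub.
  by exists x, s.
have cle y u : G (y, u) -> c <= N (y + w) - u.
  by move=> Gy; apply: ge_sup => //; exact: Sub.
exists [set z | exists x s (a : R), G (x, s) /\ z = (x + a%:C%C *: w, s + a * c)].
split.
- split=> [x s [x' [s' [a [Gx [-> ->]]]]]|x s y u b].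
    have [Dx sN] := Gle _ _ Gx; split; first by apply: DA => //; exact: DZ.
    (* Division by |a| reduces to the coefficient -1 or 1, covered by [cge] for negative a and by
       [cle] for positive a. *)
    have [a0|a0|->] := ltgtP a 0; last by rewrite rmorph0 scale0r mul0r !addr0.
      pose b := - a; have b0 : 0 < b by rewrite oppr_gt0.
      have := cge _ _ (GZ b^-1 _ _ Gx).
      have -> : (b^-1)%:C%C *: x' - w = (b^-1)%:C%C *: (x' + a%:C%C *: w).
        have ba : b^-1 * a = -1 by rewrite /b invrN mulNr mulVf// lt_eqF.
        by rewrite scalerDr scalerA -rmorphM ba rmorphN rmorph1 scaleN1r.
      rewrite NZ; last by apply: DA => //; exact: DZ.
      rewrite normcR gtr0_norm ?invr_gt0// -mulrBr ler_pdivrMl// /b.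
      by rewrite mulNr lerBlDr -lerBlDl opprK addrC.
    have := cle _ _ (GZ a^-1 _ _ Gx).
    have -> : (a^-1)%:C%C *: x' + w = (a^-1)%:C%C *: (x' + a%:C%C *: w).
      by rewrite scalerDr scalerA -rmorphM mulVf ?gt_eqF// rmorph1 scale1r.
    rewrite NZ; last by apply: DA => //; exact: DZ.
    rewrite normcR gtr0_norm ?invr_gt0// -mulrBr ler_pdivlMl//.
    by rewrite lerBrDl.
  move=> [x' [s' [a [Gx [-> ->]]]]] [y' [u' [a' [Gy [-> ->]]]]].
  exists (x' + b%:C%C *: y'), (s' + b * u'), (a + b * a'); split; first exact: Gcomb.
  congr (_, _); last by ring.
  by rewrite scalerDr scalerA addrACA -scalerDl rmorphD rmorphM.
- move=> [x s] Gx; exists x, s, 0; split => //.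
  by rewrite rmorph0 scale0r mul0r !addr0.
- exists c, 0, 0, 1; split => //.
  by rewrite rmorph1 scale1r mul1r !add0r.
Qed.

Theorem hahn_banach : exists L : V -> R[i],
  [/\ forall a v w, D v -> D w -> L (a *: v + w) = a * L v + L w,
      forall v, D v -> normc (L v) <= N v & L v0 = (N v0)%:C%C].
Proof.
have [G [gG G0G Gmax]] := maximal_graph; have [Gle Gcomb] := gG.
have Gtot w : exists s, D w -> G (w, s).
  have [Dw|nDw] := pselect (D w); last by exists 0.
  have [B [gB GB [c Bc]]] := extension gG G0G Dw.
  by exists c => _; exact: Gmax Bc.
have [u uG] := choice Gtot.
(* Two values at x put (0, s1 - s2) into the graph, and domination by N 0 = 0 gives s1 <= s2;
   exchanging them gives equality. *)
have Gfun x s s' : G (x, s) -> G (x, s') -> s = s'.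
  have H s1 s2 : G (x, s1) -> G (x, s2) -> s1 <= s2.
    move=> G1 G2; have [_] := Gle _ _ (Gcomb _ _ _ _ (-1) G1 G2).
    by rewrite rmorphN rmorph1 scaleN1r subrr N0 mulN1r subr_le0.
  by move=> G1 G2; apply/eqP; rewrite eq_le !H.
have ucomb (a : R) v w : D v -> D w -> u (v + a%:C%C *: w) = u v + a * u w.
  move=> Dv Dw; apply: Gfun (Gcomb _ _ _ _ a (uG _ Dv) (uG _ Dw)).
  by apply: uG; apply: DA => //; exact: DZ.
have uZ (a : R) v : D v -> u (a%:C%C *: v) = a * u v.
  move=> Dv; have u0 : u 0 = 0.
    by have := ucomb (-1) _ _ Dv Dv; rewrite rmorphN rmorph1 scaleN1r !subrr mulN1r subrr.
  by have := ucomb a _ _ D0 Dv; rewrite !add0r u0 add0r.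
have uD v w : D v -> D w -> u (v + w) = u v + u w.
  by move=> Dv Dw; have := ucomb 1 _ _ Dv Dw; rewrite rmorph1 scale1r mul1r.
have uN v : D v -> u v <= N v by move=> Dv; have [] := Gle _ _ (uG _ Dv).
(* The complex-linear functional whose real part is u. *)
pose L v : R[i] := (u v -i* u ('i%C *: v))%C.
have uzv z v : D v -> u (z *: v) = Re z * u v + Im z * u ('i%C *: v).
  move=> Dv; rewrite {1}(complexE z) scalerDl (mulrC 'i%C) -scalerA.
  by rewrite uD ?uZ//; do ?exact: DZ; apply: DZ; exact: DZ.
have Lcomb a v w : D v -> D w -> L (a *: v + w) = a * L v + L w.
  move=> Dv Dw; have Dav := DZ a Dv; have Diw := DZ 'i%C Dw.
  apply/eqP; rewrite eq_complex ReD ImD ReM ImM /=; apply/andP; split; apply/eqP.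
    by rewrite uD// uzv//; ring.
  rewrite scalerDr uD//; last exact: DZ.
  rewrite scalerA uzv// ReM ImM /=; ring.
have L0 : L 0 = 0 by have := Lcomb (-1) 0 0 D0 D0; rewrite scaleN1r addNr mulN1r addNr.
have LZ a v : D v -> L (a *: v) = a * L v.
  by move=> Dv; have := Lcomb a _ _ Dv D0; rewrite !addr0 L0 addr0.
have LN v : D v -> normc (L v) <= N v.
  move=> Dv; have [z z1 zL] := unimodular (L v).
  have -> : normc (L v) = u (z *: v).
    by have := LZ z _ Dv; rewrite zL => /(congr1 (@complex.Re R)) /= ->.
  by apply: le_trans (uN _ (DZ z Dv)) _; rewrite NZ// z1 mul1r.
have uv0 : u v0 = N v0.
  apply: Gfun (uG _ Dv0) (G0G _ _); exists 1.
  by rewrite rmorph1 scale1r mul1r.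
(* L v0 has real part N v0 and modulus at most N v0, so its imaginary part is 0. *)
exists L; split => //; have := LN _ Dv0; rewrite /L uv0 => le.
apply/eqP; rewrite eq_complex /= eqxx /=.
move: le; rewrite /Normc.normc -[leRHS]ger0_norm ?N_ge0// -sqrtr_sqr.
rewrite ler_sqrt ?sqr_ge0// gerDl sqrrN => le.
by rewrite oppr_eq0 -sqrf_eq0 eq_le le sqr_ge0.
Qed.

End hahn_banach.

(** * From bounded functions on cubes to the whole block space *)

Section agreement.
Context {R : realType} {n : nat}.
Variables (p : n.-tuple R) (t : R) (r : \bar R).
Hypothesis p1 : all (fun s => 1 < s) p.
Hypothesis hr : r = +oo%E \/ exists2 rho : R, 1 < rho & r = rho%:E.
Local Notation X := (Rn R n).
Local Notation cube := (@dyadic_cube R n).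
Local Notation lq := (@lq_norm R (dyadic_index n) (hoelder_conjugate r)).
Local Notation BN := (block_norm p t r).
Local Notation BS := (block_space p t r).
Local Notation Lc := (Lp_norm (conj_exponents p)).
Implicit Types (g d : X -> R[i]) (q : dyadic_index n).

Lemma cut_id q g : (forall x, ~ cube q x -> g x = 0) -> cube_cut q g = g.
Proof.
move=> gq; apply/funext => x; rewrite /cube_cut indicE.
have [/set_mem xq|/negP xq] := boolP (x \in cube q); first by rewrite mul1r.
by rewrite mul0r gq// => /mem_set.
Qed.

Lemma scaled_block q d e : cmeasurable d -> (forall x, ~ cube q x -> d x = 0) ->
  0 < e -> (Lc d <= (e * vol p t q)%:E)%E -> BS d /\ fine (BN d) <= e.
Proof.
move=> md dq e0 dle.
have bb : is_block p t (cube q) (fun x => (e^-1)%:C%C * d x).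
  split; first by apply: cmeasurableM => //; exact: cmeasurable_cst.
    by move=> x xq; rewrite dq// mulr0.
  rewrite (Lp_conjZ p1)// volE normcR gtr0_norm ?invr_gt0//.
  apply: (@le_trans _ _ ((e^-1)%:E * (e * vol p t q)%:E)%E).
    by apply: lee_wpmul2l; [rewrite lee_fin invr_ge0 ltW|exact: dle].
  by rewrite -EFinM mulKf// gt_eqF.
have := single_block p1 hr e%:C%C bb.
have -> : (fun x => e%:C%C * ((e^-1)%:C%C * d x)) = d.
  by apply/funext => x; rewrite mulrA -rmorphM mulfV ?gt_eqF// mul1r.
move=> [dB dN]; split=> //; rewrite -lee_fin fineK; last exact: BN_fin dB.
by apply: le_trans dN _; rewrite normcR gtr0_norm.
Qed.

Lemma bounded_cube_BS q g M : cmeasurable g -> (forall x, normc (g x) <= M) ->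
  (forall x, ~ cube q x -> g x = 0) -> BS g.
Proof.
move=> mg gM gq; have v0 := vol_gt0 p t q.
have goo : (Lc g < +oo)%E by rewrite -(cut_id gq); exact: (Lc_cut_lty p1 q mg gM).
have gE : Lc g = (fine (Lc g))%:E by rewrite fineK// ge0_fin_numE// Lp_norm_ge0.
have g0 : 0 <= fine (Lc g) by apply: fine_ge0; exact: Lp_norm_ge0.
have e0 : 0 < (1 + fine (Lc g)) / vol p t q by rewrite divr_gt0// ltr_pwDl.
have [] := scaled_block mg gq e0 => //.
by rewrite mulfVK ?gt_eqF// gE lee_fin lerDr.
Qed.

Section vanishing.
Variables (L : (X -> R[i]) -> R[i]) (C : R).
Hypothesis Ll : linear_on_block_space p t r L.
Hypothesis C0 : 0 < C.
Hypothesis LC : functional_le p t r L C.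
Hypothesis Lbounded : forall q g M, cmeasurable g -> (forall x, normc (g x) <= M) ->
  (forall x, ~ cube q x -> g x = 0) -> L g = 0.

(** The part of b above height m vanishes at each point for large m and is dominated by b, whose
    norm is finite; hence its block norm tends to 0 and only the bounded part, killed by L,
    remains. *)
Lemma functional_block0 q (b : X -> R[i]) : is_block p t (cube q) b -> L b = 0.
Proof.
move=> bb; have [mb bq bV] := bb.
pose A m := [set x | normc (b x) <= m%:R].
have mA m : measurable (A m).
  rewrite -[A m]setTI (_ : A m = (fun x => normc (b x)) @^-1` `]-oo, m%:R]).
    by apply: measurable_normc.
  by apply/seteqP; split => x /=; rewrite in_itv/=.
pose bm m x := b x * \1_(A m) x; pose dm m x := b x * \1_(~` A m) x.
have mbm m : cmeasurable (bm m) by apply: cmeasurableM => //; exact: cmeasurable_indic.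
have mdm m : cmeasurable (dm m).
  by apply: cmeasurableM => //; apply: cmeasurable_indic; exact: measurableC.
have bE m : (fun x => bm m x + dm m x) = b.
  apply/funext => x; rewrite /bm /dm -mulrDr !indicE in_setC.
  by case: (_ \in _); rewrite ?addr0 ?add0r mulr1.
have bmM m x : normc (bm m x) <= m%:R.
  rewrite /bm Normc.normcM normc_indic indicE.
  have [/set_mem xA|_] := boolP (x \in A m); first by rewrite mulr1.
  by rewrite mulr0.
have bmq m x : ~ cube q x -> bm m x = 0 by move=> /bq bx; rewrite /bm bx mul0r.
have dmq m x : ~ cube q x -> dm m x = 0 by move=> /bq bx; rewrite /dm bx mul0r.
have v0 := vol_gt0 p t q.
have dc : (fun m => Lc (dm m)) @ \oo --> 0%E.
  have : (fun m => Lc (cube_cut q (dm m))) @ \oo --> 0%E.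
    apply: (Lc_cut_dominated_cvg0 p1 mdm mb).
    - by move=> m x; rewrite /dm Normc.normcM normc_indic ler_piMr ?normc_ge0.
    - move=> x; apply: cvg_near_cst; exists (Num.truncn (normc (b x))).+1 => // m /= tm.
      rewrite /dm indicE memNset ?mulr0 ?Normc.normc0//= => -[]; rewrite /A /=.
      by apply: le_trans (ltW (truncnS_gt _)) _; rewrite ler_nat.
    - by rewrite (cut_id bq); apply: le_lt_trans bV _; rewrite volE ltry.
  by under eq_fun do rewrite (cut_id (dmq _)).
apply/eqP; rewrite -normc_eq0 eq_le normc_ge0 andbT; apply/ler_addgt0Pr => e e0.
rewrite add0r; have eC : 0 < e / C by rewrite divr_gt0.
have ev : 0 < e / C * vol p t q by rewrite mulr_gt0.
have [m _ mN] := (cvge0P (u := fun m => Lc (dm m)) (fun m => Lp_norm_ge0 _ _)).1 dc _ ev.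
have [dB dN] := scaled_block (mdm m) (dmq m) eC (ltW (mN m (leqnn m))).
have bB : BS (bm m) by exact: bounded_cube_BS (mbm m) (bmM m) (bmq m).
rewrite -(bE m) (functionalD Ll bB dB) (Lbounded (mbm m) (bmM m) (bmq m)) add0r.
apply: (le_trans (LC dB)); rewrite mulrC -ler_pdivlMr//.
Qed.

(** Removing the cubes with code below k from a decomposition of g leaves a decomposition of the
    tail, whose coefficients tend to 0 in l^{r'} because r' is finite. So finite sums of blocks
    approximate g in block norm. *)
Lemma functional_vanishes g : BS g -> L g = 0.
Proof.
move=> gB; have [mg [l [b gd]]] := gB; have [lf bb gE] := gd.
have [s s1 sE] := conj_rE hr; have s0 : 0 < s by exact: lt_le_trans s1.
pose F k : {fset dyadic_index n} := [fset q in pmap (@pickle_inv (dyadic_index n)) (iota 0 k)]%fset.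
have FE k q : (q \in F k) = (choice.pickle q < k)%N.
  rewrite inE mem_pmap; apply/mapP/idP => [[j]|qk].
    rewrite mem_iota add0n => /andP[_ jk] jq.
    by have := @pickle_invK (dyadic_index n) j; rewrite -jq /= => ->.
  by exists (choice.pickle q); rewrite ?mem_iota// pickleK_inv.
pose lF k q := if q \in F k then l q else 0.
pose lT k q := if q \in F k then 0 else l q.
have lF0 k q : q \notin F k -> lF k q = 0 by rewrite /lF => /negbTE ->.
pose gF k x := \sum_(q <- F k) lF k q * b q x.
have gFB k : BS (gF k) by have [] := finite_block_sum hr bb (lF0 k).
have LgF k : L (gF k) = 0.
  have lB q : BS (fun x => lF k q * b q x) by have [] := single_block p1 hr (lF k q) (bb q).
  rewrite /gF (functional_sum p1 hr _ Ll lB) big1// => q _.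
  have b1 : BS (b q).
    have [] := single_block p1 hr 1 (bb q).
    by rewrite (_ : (fun x => 1 * b q x) = b q)//; apply/funext => x; rewrite mul1r.
  by rewrite (functionalZ p1 hr _ Ll b1) (functional_block0 (bb q)) mulr0.
have Td k : block_decomposition p t r (fun x => g x - gF k x) (lT k) b.
  split; last 2 first.
  - exact: bb.
  - move: gE; apply: filterS => x gx.
    have Fx := @partial_sum_cvg_finite R _ (fun q => lF k q * b q x) (F k)
      (fun q qF => etrans (congr1 (fun z => z * b q x) (lF0 k q qF)) (mul0r _)).
    have := partial_sum_cvg_lincomb (c := -1) Fx gx.
    rewrite mulN1r addrC; apply: cvg_trans.
    rewrite (_ : (fun q => lT k q * b q x) = (fun q => -1 * (lF k q * b q x) + l q * b q x))//.
    by apply/funext => q; rewrite /lT /lF; case: ifP => _; ring.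
  - apply: le_lt_trans lf; rewrite sE; apply: le_lq_norm => // q.
    by rewrite /lT; case: ifP => // _; rewrite Normc.normc0 normc_ge0.
have lc : (fun k => lq (lT k)) @ \oo --> 0%E.
  rewrite sE; rewrite sE in lf; apply: lq_norm_dominated_cvg0 lf => // [k q|q].
    by rewrite /lT; case: ifP => // _; rewrite Normc.normc0 normc_ge0.
  apply: cvg_near_cst; exists (choice.pickle q).+1 => // k /= qk.
  by rewrite /lT FE qk Normc.normc0.
apply/eqP; rewrite -normc_eq0 eq_le normc_ge0 andbT; apply/ler_addgt0Pr => e e0.
rewrite add0r; have eC : 0 < e / C by rewrite divr_gt0.
have [k _ kN] := (cvge0P (u := fun k => lq (lT k)) (fun k => lq_ge0 hr _)).1 lc _ eC.
have gT : BS (fun x => g x - gF k x) by exact: (BSB p1 hr gB (gFB k)).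
have -> : L g = L (fun x => g x - gF k x) by rewrite (functionalB Ll gB (gFB k)) LgF subr0.
apply: (le_trans (LC gT)); rewrite mulrC -ler_pdivlMr// -lee_fin fineK; last exact: BN_fin gT.
apply: (le_trans (BN_le (Td k))); exact: ltW (kN k (leqnn k)).
Qed.

End vanishing.
End agreement.

(** * The duality statements *)

Section duality.
Context {R : realType} {n : nat}.
Variables (p : n.-tuple R) (t : R) (r : \bar R).
Hypothesis p1 : all (fun s => 1 < s) p.
Hypothesis hr : r = +oo%E \/ exists2 rho : R, 1 < rho & r = rho%:E.
Local Notation X := (Rn R n).
Local Notation mu := (@lebesgueRn R n).
Local Notation BN := (block_norm p t r).
Local Notation BS := (block_space p t r).
Local Notation MS := (morrey_space p t r).
Local Notation MN := (morrey_norm p t r).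
Local Notation wm := (wmul p t).
Implicit Types (f g h u : X -> R[i]) (L : (X -> R[i]) -> R[i]).

Lemma morrey_fineK f : MS f -> (fine (MN f))%:E = MN f.
Proof. by case=> _ foo; rewrite fineK// ge0_fin_numE// morrey_norm_ge0. Qed.

Lemma functional_le_pairing f : MS f ->
  functional_le p t r (pairing f) (fine (MN f)).
Proof.
move=> fM g gB; rewrite -lee_fin EFinM morrey_fineK// muleC fineK ?BN_fin//.
exact: pairing_le.
Qed.

Lemma functional_representation L C : linear_on_block_space p t r L -> 0 < C ->
  functional_le p t r L C ->
  exists f, [/\ cmeasurable f, (MN f <= C%:E)%E & forall g, BS g -> L g = pairing f g].
Proof.
move=> Ll C0 LC.
have [h [ih [mh hE]]] := functional_density p1 hr Ll C0 LC.
have loc := local_representation p1 hr Ll C0 LC ih mh hE.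
set f : X -> R[i] := fun x => h x * ((weight p t x)^-1)%:C%C in loc.
have mf : cmeasurable f.
  by apply: cmeasurableM => //; apply: cmeasurable_real; exact: measurable_weightV.
have fC : (MN f <= C%:E)%E.
  apply: (morrey_norm_le p1 hr Ll (ltW C0) LC mf) => q g M mg gM gq.
  by have [_ ? ?] := loc q g M mg gM gq.
exists f; split; [exact: mf|exact: fC|].
have fM : MS f by split; [exact: mf|apply: le_lt_trans fC _; rewrite ltry].
(* The difference is bounded because the Morrey norm of f is already known to be finite, so the
   vanishing criterion applies to it. *)
pose D g := L g - pairing f g.
have Dl : linear_on_block_space p t r D.
  move=> z g g' gB gB'; rewrite /D (Ll z _ _ gB gB').
  by rewrite (pairing_linear p1 hr fM z gB gB'); ring.
have M0 : 0 <= fine (MN f) by apply: fine_ge0; exact: morrey_norm_ge0.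
have DC : functional_le p t r D (C + fine (MN f)).
  move=> g gB; rewrite /D mulrDl (le_trans (le_normcD _ _))// normcN lerD//.
    exact: LC.
  exact: functional_le_pairing.
have CM : 0 < C + fine (MN f) by rewrite ltr_wpDr.
move=> g gB; apply/eqP; rewrite -subr_eq0; apply/eqP.
apply: (functional_vanishes p1 hr Dl CM DC _ gB) => q g' M mg gM gq.
by have [_ _ E] := loc q g' M mg gM gq; rewrite /D E subrr.
Qed.

(** The functions w 1_A belong to the block space for every measurable A, so w f and w f' are
    integrable with equal integrals over all sets. They agree almost everywhere, and w is
    positive. *)
Lemma pairing_inj f f' : MS f -> MS f' ->
  (forall g, BS g -> pairing f g = pairing f' g) -> {ae mu, forall x, f' x = f x}.
Proof.
move=> fM fM' ff'.
have wE u A : (fun x => wm (\1_A) x * u x) = (fun x => \1_A x * wm u x).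
  by apply/funext => x; rewrite /wmul mulrA [\1_A x * _]mulrC.
have wi u : MS u -> cintegrable (wm u).
  move=> uM; have := pairing_integrable p1 hr uM (indic_BS t p1 hr (@measurableT _ X)).
  by rewrite wE; under eq_fun do rewrite indicT mul1r.
have key A : measurable A ->
    cintegral (fun x => \1_A x * wm f x) = cintegral (fun x => \1_A x * wm f' x).
  by move=> mA; rewrite -!wE; exact: ff' (indic_BS t p1 hr mA).
have S (part : R[i] -> R) :
    (forall u, cintegrable u -> mu.-integrable setT (fun x => (part (u x))%:E)) ->
    (forall u, part (cintegral u) = \int[mu]_x part (u x)) ->
    (forall (A : set X) x z, part (\1_A x * z) = \1_A x * part z) ->
    {ae mu, forall x, part (wm f x) = part (wm f' x)}.
  move=> parti partE partA.
  have i1 := parti _ (wi _ fM); have i2 := parti _ (wi _ fM').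
  have m2 : measurable_fun setT (fun x => (part (wm f' x))%:E) by case/integrableP: i2.
  have : ae_eq mu setT (fun x => (part (wm f x))%:E) (fun x => (part (wm f' x))%:E).
    apply: (integral_ae_eq measurableT i1 m2) => A _ mA.
    have IE u : MS u ->
        (\int[mu]_(x in A) (part (wm u x))%:E)%E =
        (part (cintegral (fun x => \1_A x * wm u x)))%:E.
      move=> uM; rewrite partE /Rintegral fineK.
        rewrite [LHS]integral_mkcond; apply: eq_integral => x _.
        by rewrite patchE partA indicE; case: (_ \in _); rewrite ?mul1r ?mul0r.
      apply: integrable_fin_num => //.
      have := pairing_integrable p1 hr uM (indic_BS t p1 hr mA); rewrite wE.
      exact: parti.
    by rewrite !IE// key.
  by apply: filterS => x /(_ Logic.I) [].
have rA (A : set X) x (z : R[i]) : Re (\1_A x * z) = \1_A x * Re z.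
  by rewrite !indicE; case: (_ \in _); rewrite ?mul1r ?mul0r.
have iA (A : set X) x (z : R[i]) : Im (\1_A x * z) = \1_A x * Im z.
  by rewrite !indicE; case: (_ \in _); rewrite ?mul1r ?mul0r.
have r_ := S (@complex.Re R) (fun u iu => proj1 iu) (fun u => erefl) rA.
have i_ := S (@complex.Im R) (fun u iu => proj2 iu) (fun u => erefl) iA.
apply: filterS2 r_ i_ => x rx ix.
have : wm f' x = wm f x by apply/eqP; rewrite eq_complex rx ix !eqxx.
rewrite /wmul; apply: mulfI.
by rewrite -(rmorph0 (real_complex R)) (inj_eq (@complexI R)) gt_eqF// weight_gt0.
Qed.

(** The nontrivial inequality is [morrey_norm_le] applied to the functional [pairing f] itself, with
    its dual norm as the constant. *)
Lemma morrey_dual f : MS f -> MN f = dual_norm p t r (pairing f).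
Proof.
move=> fM; have [mf foo] := fM.
have dle : (dual_norm p t r (pairing f) <= MN f)%E.
  apply: ge_ereal_sup => _ [g [gB g1] <-]; apply: (le_trans (pairing_le p1 hr fM gB)).
  by rewrite -[leRHS]mul1e lee_wpmul2r// morrey_norm_ge0.
apply/eqP; rewrite eq_le dle andbT.
have d0 : (0 <= dual_norm p t r (pairing f))%E.
  apply: (@le_trans _ _ (normc (pairing f (fun=> 0)))%:E); first by rewrite lee_fin normc_ge0.
  apply: ereal_sup_ubound; exists (fun=> 0) => //; split; first exact: (BS0 t p1 hr).
  have [_ ->] := @BN_ae0 _ _ p t r p1 hr (fun=> 0) (cmeasurable_cst 0) (nearW _ (fun=> erefl)).
  exact: lee01.
have dfin : dual_norm p t r (pairing f) \is a fin_num.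
  by rewrite ge0_fin_numE//; exact: le_lt_trans foo.
rewrite -(fineK dfin); set d := fine _.
have fl := pairing_linear p1 hr fM.
apply: (morrey_norm_le p1 hr fl (fine_ge0 d0) _ mf) => [g gB|q g M mg gM gq]; last first.
  by split; first exact: (pairing_integrable p1 hr fM (bounded_cube_BS t p1 hr mg gM gq)).
have N0 : 0 <= fine (BN g) by apply: fine_ge0; exact: BN_ge0.
(* A function of block norm 0 cannot be normalised, but boundedness already makes its pairing with f
   vanish. *)
have [Ng|Nn0] := eqVneq (fine (BN g)) 0.
  by have := functional_le_pairing fM gB; rewrite Ng !mulr0.
have Ngt0 : 0 < fine (BN g) by rewrite lt0r Nn0.
have : normc (pairing f (fun x => (fine (BN g))^-1%:C%C * g x)) <= d.
  rewrite -lee_fin (fineK dfin); apply: ereal_sup_ubound.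
  exists (fun x => (fine (BN g))^-1%:C%C * g x); last by [].
  split; first exact: (BSZ p1 hr _ gB).
  apply: (le_trans (BNZ p1 hr _ gB)).
  by rewrite normcR gtr0_norm ?invr_gt0// -[X in (_ * X)%E](fineK (BN_fin hr gB)) -EFinM mulVf.
rewrite (functionalZ p1 hr _ fl gB) Normc.normcM normcR gtr0_norm ?invr_gt0//.
by rewrite ler_pdivrMl// mulrC.
Qed.

Lemma block_norm_attained g : BS g -> exists f,
  [/\ MS f, (MN f <= 1)%E & (normc (pairing f g))%:E = BN g].
Proof.
move=> gB; pose V : lmodType R[i] := (X -> (R[i])^o).
pose N (v : V) := fine (BN v).
have combE (a : R[i]) (v w : V) : a *: v + w = (fun x => a * v x + w x).
  by apply/funext => x.
have DD (a : R[i]) (v w : V) : BS v -> BS w -> BS (a *: v + w : V).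
  by move=> vB wB; rewrite combE; exact: (BS_comb p1 hr _ vB wB).
have ND (v w : V) : BS v -> BS w -> N (v + w) <= N v + N w.
  move=> vB wB; have := BN_comb p1 hr 1 vB wB.
  rewrite -[v + w]/(fun x => v x + w x) (_ : (fun x => 1 * v x + w x) = (fun x => v x + w x)); last first.
    by apply/funext => x; rewrite mul1r.
  rewrite Normc.normc1 mul1e => le.
  have vw : (BN v + BN w)%E \is a fin_num by rewrite fin_numD; apply/andP; split; exact: BN_fin.
  have -> : N v + N w = fine (BN v + BN w)%E.
    exact: (esym (fineD (BN_fin hr vB) (BN_fin hr wB))).
  exact: (fine_le (BN_fin hr (BSD p1 hr vB wB)) vw le).
have NZle (a : R[i]) (v : V) : BS v -> N (a *: v) <= normc a * N v.
  move=> vB; have av : ((normc a)%:E * BN v)%E \is a fin_num.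
    by rewrite fin_numM//; exact: BN_fin.
  have -> : normc a * N v = fine ((normc a)%:E * BN v)%E.
    exact: (esym (fineM (isT : (normc a)%:E \is a fin_num) (BN_fin hr vB))).
  exact: (fine_le (BN_fin hr (BSZ p1 hr a vB)) av (BNZ p1 hr a vB)).
(* The missing inequality is [NZle] for a^-1 applied to a v. *)
have NZ (a : R[i]) (v : V) : BS v -> N (a *: v) = normc a * N v.
  move=> vB; apply/eqP; rewrite eq_le NZle//=.
  have [->|a0] := eqVneq a 0.
    by rewrite Normc.normc0 mul0r; apply: fine_ge0; exact: BN_ge0.
  have an0 : 0 < normc a by rewrite lt0r normc_eq0 a0 normc_ge0.
  have := NZle a^-1 _ (BSZ p1 hr a vB : BS (a *: v : V)).
  by rewrite scalerA mulVf// scale1r Normc.normcV ler_pdivlMl.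
have [L [Ll LN Lg]] := @hahn_banach R V BS N g gB DD ND NZ.
have Ll' : linear_on_block_space p t r L.
  by move=> a v w vB wB; rewrite -(Ll a v w vB wB) combE.
have L1 : functional_le p t r L 1 by move=> v vB; rewrite mul1r; exact: LN.
have [f [mf f1 fE]] := functional_representation Ll' ltr01 L1.
exists f; split => //; first by split => //; apply: le_lt_trans f1 (ltry _).
rewrite -(fE _ gB) Lg normcR ger0_norm; last by apply: fine_ge0; exact: BN_ge0.
exact: (fineK (BN_fin hr gB)).
Qed.

End duality.

Theorem theorem4p11 (R : realType) (n : nat) (p : n.-tuple R) (t : R)
    (r : \bar R)
    (n_gt0 : (0 < n)%N)
    (p_gt1 : forall i : 'I_n, 1 < tnth p i)
    (t_r : [/\ 1 < n%:R / sum_inv p, n%:R / sum_inv p < t,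
               (t%:E < r)%E & (r < +oo)%E]
           \/ [/\ 1 < n%:R / sum_inv p, n%:R / sum_inv p <= t & r = +oo%E]) :
  [/\ (* (i) *)
      forall f, morrey_space p t r f ->
        [/\ forall g, block_space p t r g ->
              cintegrable (fun x => g x * f x),
            linear_on_block_space p t r (pairing f) &
            bounded_on_block_space p t r (pairing f)],
      (* (ii) *)
      forall L : (Rn R n -> R[i]) -> R[i],
        linear_on_block_space p t r L ->
        continuous_on_block_space p t r L ->
        exists f, [/\ morrey_space p t r f,
          forall g, block_space p t r g -> L g = pairing f g &
          forall f', morrey_space p t r f' ->
            (forall g, block_space p t r g -> L g = pairing f' g) ->
            {ae (@lebesgueRn R n), forall x, f' x = f x}],
      forall f, morrey_space p t r f ->
        morrey_norm p t r f = dual_norm p t r (pairing f) &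
      forall g, block_space p t r g ->
        let values := [set (Normc.normc (pairing f g))%:E
                      | f in [set f | morrey_space p t r f /\
                                      (morrey_norm p t r f <= 1)%E]] in
        values (block_norm p t r g) /\ ubound values (block_norm p t r g)].
Proof.
have p1 : all (fun s => 1 < s) p by apply/all_tnthP.
have hr : r = +oo%E \/ exists2 rho : R, 1 < rho & r = rho%:E.
  case: t_r => [[s1 st tr roo]|[_ _ ->]]; last by left.
  right; move: tr roo; case: r => [rho| |] //; rewrite lte_fin => tr _.
  by exists rho => //; apply: lt_trans tr; exact: lt_trans st.
split.
- move=> f fM; split.
  + by move=> g gB; exact: (pairing_integrable p1 hr fM gB).
  + exact: (pairing_linear p1 hr fM).
  + exact: (pairing_bounded p1 hr fM).
- move=> L Ll Lc; have [C C0 LC] := continuous_functional_le p1 hr Ll Lc.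
  have [f [mf fC fE]] := functional_representation p1 hr Ll C0 LC.
  have fM : morrey_space p t r f.
    by split; [exact: mf|apply: le_lt_trans fC _; rewrite ltry].
  exists f; split; [exact: fM|exact: fE|move=> f' fM' fE'].
  by apply: (pairing_inj p1 hr fM fM') => g gB; rewrite -fE// fE'.
- by move=> f fM; exact: (morrey_dual p1 hr fM).
- move=> g gB; split.
    by have [f [fM f1 fg]] := block_norm_attained p1 hr gB; exists f.
  move=> _ [f [fM f1] <-]; apply: (le_trans (pairing_le p1 hr fM gB)).
  by rewrite -[leRHS]mule1 lee_wpmul2l// BN_ge0.
Qed.
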